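(* Let $n=2m+1\geq 3$ be an odd integer and set $$\Gamma_n:=\{(\alpha,\beta)\in\mathbb{N}\times\mathbb{N} \mid \alpha \text{ is odd},\ \beta \text{ is even and } \beta<\alpha\leq n\}.$$ Then the following hold. (i) To each $(\alpha,\beta)\in\Gamma_n$, written as $\alpha=2s+1$, $\beta=2t$, there corresponds (in the sense made precise in the context) a certain number of critical points of $\mu:X_n\to\mathbb{R}$. All critical points are non-degenerate, and those corresponding to $(\alpha,\beta)$ satisfy: their critical value is $\frac{\beta}{\alpha}\pi$; their number is $\binom{n}{m-s}$; and the index of $\mu$ at each of them is $m-s+2t-1$. (ii) Conversely, each critical point of $\mu$ corresponds to a unique $(\alpha,\beta)\in\Gamma_n$.
   Context: $\mathbb{N}=\{1,2,3,\dots\}$. $d(u,v)=\arccos(u\cdot v)$ denotes the spherical distance on the unit sphere $S^2\subset\mathbb{R}^3$. Set $$B_n:=\{((u_1,\dots,u_n),a)\in (S^2)^n\times(0,\pi) \mid d(u_i,u_{i+1})=a \text{ for } 1\leq i\leq n-1 \text{ and } d(u_n,u_1)=a\}.$$ $SO(3)$ acts on $B_n$ diagonally on the points $u_i$ and trivially on $a$, and $X_n:=B_n/SO(3)$. For odd $n$, $X_n$ is a smooth manifold of dimension $n-2$ (with $B_n$ regarded as a smooth submanifold of $(S^2)^n\times(0,\pi)$, on which $SO(3)$ acts freely). The smooth function $\mu:X_n\to\mathbb{R}$ is $\mu(P,a)=a$. The critical points of $\mu$ are exactly the $(P,a)$ with $P$ degenerate, i.e. with $P=(u_1,\dots,u_n)$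 contained in a great circle $\gamma$. Correspondence between critical points and $\Gamma_n$: let $(P,a)$ be a critical point, with $P=(u_1,\dots,u_n)$ contained in the great circle $\gamma$. Let $e_i$ be the shortest geodesic segment directed from $u_i$ to $u_{i+1}$ ($1\leq i\leq n-1$), and $e_n$ the one directed from $u_n$ to $u_1$. Orient $\gamma$ so that $e_n$ is negatively directed. An edge $e_i$ is a forward-track if its direction agrees with the orientation of $\gamma$, and a back-track otherwise. Let $f=f(P)$ and $b=b(P)$ be the numbers of forward-tracks and back-tracks, so $f+b=n$, and let the winding number $w=w(P)\in\mathbb{Z}$ be defined by $a(f-b)=2\pi w$ (it is nonzero since $n$ is odd). The critical point $(P,a)$ corresponds to $(\alpha,\beta)=(f-b,\,2w)$ if $w>0$, and to $(\alpha,\beta)=(b-f,\,-2w)$ if $w<0$. *)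

(* Defs.v *)
From HB Require Import structures.
From mathcomp Require Import all_boot all_order all_algebra.
From mathcomp Require Import all_classical all_reals all_analysis.

Set Implicit Arguments.
Unset Strict Implicit.
Unset Printing Implicit Defensive.

Import Order.TTheory GRing.Theory Num.Theory.
Import numFieldNormedType.Exports.

Local Open Scope classical_set_scope.
Local Open Scope ring_scope.

Section Smooth.
Context {R : realType} {V W : normedModType R}.
Implicit Types (f : V -> W) (O S : set V).

(* For finite-dimensional V and open O, having iterated directional derivatives
   of every order that are all differentiable on O is the same as being
   C^infinity on O. *)
Fixpoint diff_times (j : nat) f O : Prop :=
  if j is j'.+1 then
    (forall x, O x -> differentiable f x) /\
    (forall v, diff_times j' (fun x => 'D_v f x) O)
  else True.

Definition smooth_on f O : Prop := forall j, diff_times j f O.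

(* Smoothness along an arbitrary subset S of V, through local smooth extensions
   to V; on a subset that is open in an embedded submanifold this is smoothness
   for the submanifold structure. *)
Definition smooth_along f S : Prop :=
  forall p, S p -> exists O (g : V -> W),
    [/\ open O, O p, smooth_on g O & forall q, S q -> O q -> f q = g q].

End Smooth.

Section Morse.
Context {R : realType} {T : Type} {k : nat}.

(* param is the inverse of coord; its values matter only on coord @` dom. *)
Record chart := Chart {
  dom : set T;
  coord : T -> 'rV[R]_k;
  param : 'rV[R]_k -> T }.

Implicit Types (atlas : set chart) (f : T -> R) (x : T) (c : chart).

Definition critical atlas f x : Prop :=
  (exists2 c, atlas c & dom c x) /\
  (forall c, atlas c -> dom c x -> forall v, 'D_v (f \o param c) (coord c x) = 0).

Definition hessian f c x : 'M[R]_k :=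
  \matrix_(i, j)
    'D_(delta_mx 0 i) (fun y => 'D_(delta_mx 0 j) (f \o param c) y) (coord c x).

(* morse_nondegenerate and has_index are meant for critical points x; there the
   universal quantification over charts is not vacuous and the choice of the
   chart is immaterial. *)
Definition morse_nondegenerate atlas f x : Prop :=
  forall c, atlas c -> dom c x -> hessian f c x \in unitmx.

Definition negative_on (H V : 'M[R]_k) : Prop :=
  forall v : 'rV[R]_k, (v <= V)%MS -> v != 0 -> (v *m H *m v^T) 0 0 < 0.

Definition max_negative_dim (H : 'M[R]_k) (d : nat) : Prop :=
  (exists2 V : 'M[R]_k, \rank V = d & negative_on H V) /\
  (forall V : 'M[R]_k, negative_on H V -> (\rank V <= d)%N).

Definition has_index atlas f x (d : nat) : Prop :=
  forall c, atlas c -> dom c x -> max_negative_dim (hessian f c x) d.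

End Morse.

Arguments chart : clear implicits.

(* The type of pairs (P, a) with P = (u_1, ..., u_n); u_(i+1) is the row i of P, for i in
   {0, ..., n-1}, and below ordS is the cyclic successor on 'I_n. *)
Notation config R n := ('M[R]_(n, 3) * R)%type.

Section Polygons.
Context {R : realType}.

Definition dot (u v : 'rV[R]_3) : R := (u *m v^T) 0 0.

Definition cross (u v : 'rV[R]_3) : 'rV[R]_3 :=
  \row_k (u 0 (ordS k) * v 0 (ordS (ordS k)) - u 0 (ordS (ordS k)) * v 0 (ordS k)).

Definition sphere : set 'rV[R]_3 := [set u | dot u u = 1].

Definition sdist (u v : 'rV[R]_3) : R := acos (dot u v).

Definition SO3 : set 'M[R]_3 := [set A | A *m A^T = 1%:M /\ \det A = 1].

Variable n : nat.

Notation config := (config R n).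
Implicit Types (p q : config) (x : set config).

Definition Bn : set config :=
  [set p | [/\ forall i, sphere (row i p.1), 0 < p.2 < pi
             & forall i, sdist (row i p.1) (row (ordS i) p.1) = p.2]].

Definition orbit p : set config :=
  [set q | exists2 A, SO3 A & q = (p.1 *m A^T, p.2)].

(* X_n = B_n / SO(3): its points are the orbits. *)
Definition Xn : set (set config) := orbit @` Bn.

(* All the elements of an orbit have the same second component. *)
Definition mu x : R := (get x).2.

(* The coordinate charts of the quotient manifold X_n, of dimension n - 2, i.e.
   the diffeomorphisms from open subsets of X_n onto open subsets of R^(n-2).
   X_n has the quotient topology and the smooth structure that makes the
   projection orbit : B_n -> X_n a smooth submersion; hence a map out of X_n is
   smooth iff its composite with orbit is, and a map into X_n is smooth iff it
   lifts locally to a smooth map into B_n. *)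
Definition Xn_atlas : set (chart R (set config) (n - 2)) :=
  [set c |
    [/\ dom c `<=` Xn
          /\ (exists2 O : set config, open O & Bn `&` orbit @^-1` dom c = Bn `&` O),
        open (coord c @` dom c),
        forall x, dom c x -> param c (coord c x) = x,
        smooth_along (coord c \o orbit) (Bn `&` orbit @^-1` dom c)
      & forall y, (coord c @` dom c) y ->
          exists (O : set 'rV[R]_(n - 2)) (s : 'rV[R]_(n - 2) -> config),
            [/\ open O, O y, O `<=` coord c @` dom c, smooth_on s O
              & forall z, O z -> Bn (s z) /\ orbit (s z) = param c z]]].

Definition mu_critical x : Prop := critical Xn_atlas mu x.

(* A unit vector nu stands for the great circle orthogonal to nu, oriented by
   the direction cross nu u at each of its points u. *)
Definition in_great_circle (nu : 'rV[R]_3) (P : 'M[R]_(n, 3)) : Prop :=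
  sphere nu /\ forall i, dot nu (row i P) = 0.

(* The positively directed geodesic of length a issued from the vertex i is
   t |-> cos t *: u + sin t *: cross nu u, 0 <= t <= a; the edge, which is the
   shortest geodesic since a < pi, is positively directed iff it is that one. *)
Definition forward (nu : 'rV[R]_3) p (i : 'I_n) : Prop :=
  row (ordS i) p.1 = cos p.2 *: row i p.1 + sin p.2 *: cross nu (row i p.1).

Definition nforward (nu : 'rV[R]_3) p : nat := #|[pred i | `[< forward nu p i >]]|.
Definition nback (nu : 'rV[R]_3) p : nat := #|[pred i | ~~ `[< forward nu p i >]]|.

Definition corresponds x (ab : nat * nat) : Prop :=
  exists p (nu : 'rV[R]_3) (w : int),
    let f : int := (nforward nu p)%:Z in
    let b : int := (nback nu p)%:Z in
    [/\ x p,
        in_great_circle nu p.1,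
        forall i : 'I_n, i.+1 = n -> ~ forward nu p i,
        p.2 * (f - b)%:~R = 2 * pi * w%:~R
      & (0 < w /\ ab.1%:Z = f - b /\ ab.2%:Z = 2 * w) \/
        (w < 0 /\ ab.1%:Z = b - f /\ ab.2%:Z = - (2 * w))].

End Polygons.

Definition Gamma (n : nat) : set (nat * nat) :=
  [set ab | [/\ (0 < ab.1)%N /\ (0 < ab.2)%N, odd ab.1, ~~ odd ab.2
              & (ab.2 < ab.1 <= n)%N]].

(* Main.v *)
Require Import Defs.
From HB Require Import structures.
From mathcomp Require Import all_boot all_order all_algebra.
From mathcomp Require Import all_classical all_reals all_analysis.
From mathcomp Require Import ring lra zify.

(* Near a degenerate polygon P0 of edge length a0, with sign eps_i on edge i, a
   polygon is recovered, up to rotation, from its edge length a and its heights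
   h_i over the great circle of P0; it closes up iff
   sum_i eps_i acos ((cos a - h_i h_(i+1)) / (r_i r_(i+1))) = 2 pi t, where
   r_i = sqrt (1 - h_i^2). The implicit function theorem solves this for
   a = A(h), and the normalisation h_0 = h_1 = 0 yields a chart of X_n. Expanding
   to second order along the rays of heights, A(h) - a0 ~ - Q(h) / (alpha sin a0)
   with Q(h) = sum_i eps_i (h_i h_(i+1) - cos a0 (h_i^2 + h_(i+1)^2) / 2), and the
   Hessian of mu in an arbitrary chart pulls back to the Hessian of A. Two
   consecutive edges of opposite signs split off a hyperbolic plane from Q; what
   remains after m - s cancellations is the form of alpha forward edges, which is
   diagonalised by a discrete Hartley transform, with eigenvalues
   cos (2 pi k / alpha) - cos (2 pi t / alpha). So Q is positive on a space of
   dimension m - s + 2t - 1 and negative on one of the complementary dimension in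
   R^(n-2). Finally, a critical orbit is determined by (alpha, beta) and its set of
   m - s back-tracks. *)

Set Implicit Arguments.
Unset Strict Implicit.
Unset Printing Implicit Defensive.

Import Order.TTheory GRing.Theory Num.Theory.
Import numFieldNormedType.Exports.

Local Open Scope classical_set_scope.
Local Open Scope ring_scope.

(** Criticality, non-degeneracy and index quantify over all charts of X_n, so the chart of heights
    only shows that a degenerate orbit lies in some chart; Hessians are computed in an arbitrary
    one. At a critical point the second derivative of [mu] along a curve depends on its velocity
    alone. Comparison with the rays of heights therefore gives a linear map from R^n to R^(n-2) that
    pulls the Hessian form back to a negative multiple of Q. A subspace on which the pulled-back
    form is definite is mapped injectively, and two such subspaces of opposite signs whose
    dimensions add up to n - 2 determine both rank and index. The sum is n - 2 and not n because Q
    vanishes at the frequencies k = t and k = alpha - t, the heights of infinitesimally tilted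
    polygons. Degenerate orbits are critical because along a great circle the linearised closing
    condition reads (sum of signs) da = 0, and a sum of n signs is odd. Conversely, off the great
    circles the 2n linearised equations are independent, and a count of dimensions shows that the
    length can then be varied to first order. *)

Local Notation orbit := Defs.orbit.
Local Notation coord := Defs.coord.

(** * Iterated directional derivatives and implicit functions *)

Section Frechet.
Context {R : realType} {V W : normedModType R}.

Lemma differentiable_eps (f : V -> W) x : differentiable f x ->
  forall e, 0 < e -> \forall h \near (0:V), `|f (h + x) - f x - 'd f x h| <= e * `|h|.
Proof.
move=> /diff_locally; rewrite -[X in X -> _]/(f \o shift x = (cst (f x) + 'd f x) +o_ 0 id).
move=> /eqaddoP df e e0; have := df e e0; apply: filterS => h /=.
by rewrite !fctE /= opprD addrA.
Qed.

Lemma eps_differentiable (f : V -> W) x (L : {linear V -> W}) : continuous L ->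
  (forall e, 0 < e -> \forall h \near (0:V), `|f (h + x) - f x - L h| <= e * `|h|) ->
  differentiable f x /\ 'd f x = L :> (V -> W).
Proof.
move=> cL H.
have E : f \o shift x = (cst (f x) + L) +o_ 0 id.
  apply/eqaddoP => e e0; have := H e e0; apply: filterS => h /=.
  by rewrite !fctE /= opprD addrA.
have dE : 'd f x = L :> (V -> W) by apply: diff_unique.
by split=> //; apply/diff_locallyP; rewrite dE.
Qed.

Lemma near_eq_differentiable (f g : V -> W) x : (\near x, f x = g x) ->
  differentiable f x -> differentiable g x.
Proof.
move=> fg df; have fgx := nbhs_singleton fg.
have dfc : continuous ('d f x) by exact: diff_continuous.
apply: (eps_differentiable dfc _).1 => e e0.
have fg0 : \forall h \near (0:V), f (h + x) = g (h + x).
  by move: fg; rewrite (near_shift 0) /= subr0; apply: filterS.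
near=> h; rewrite -fgx -(near fg0 h) //; near: h.
exact: differentiable_eps.
Unshelve. all: by end_near. Qed.

End Frechet.

Section DiffTimes.
Context {R : realType} {V W : normedModType R}.
Implicit Types (O : set V).

Lemma open_near_eq (T : Type) (f g : V -> T) O x : open O -> O x -> (forall y, O y -> f y = g y) ->
  \near x, f x = g x.
Proof. by move=> oO Ox fg; near=> y; apply: fg; near: y; apply: open_nbhs_nbhs. Unshelve. all: by end_near. Qed.

(** [O] is open, so a formula valid only on [O] may be differentiated there; the closure properties
    below compute a derivative by such a formula and transport smoothness along it. *)
Lemma diff_times_ext j (f g : V -> W) O : open O -> (forall y, O y -> f y = g y) ->
  diff_times j f O -> diff_times j g O.
Proof.
move=> oO; elim: j f g => [//|j IH] f g fg [df Df]; split=> [x Ox|v].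
  by apply: near_eq_differentiable (df x Ox); apply: open_near_eq fg.
apply: IH (Df v) => y Oy; apply: near_eq_derive; exact: open_near_eq fg.
Qed.

Lemma smooth_on_ext (f g : V -> W) O : open O -> (forall y, O y -> f y = g y) ->
  smooth_on f O -> smooth_on g O.
Proof. by move=> oO fg sf j; apply: diff_times_ext (sf j). Qed.

Lemma diff_times_sub j (f : V -> W) O O' : O' `<=` O -> diff_times j f O -> diff_times j f O'.
Proof.
move=> s; elim: j f => [//|j IH] f [df Df]; split=> [x /s Ox|v]; [exact: df|exact: (IH _ (Df v))].
Qed.

Lemma smooth_on_differentiable (f : V -> W) O x : smooth_on f O -> O x -> differentiable f x.
Proof. by move=> /(_ 1%N) [+ _]; apply. Qed.

Lemma smooth_on_derive (f : V -> W) O v : smooth_on f O -> smooth_on (fun x => 'D_v f x) O.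
Proof. by move=> sf j; have [_] := sf j.+1; apply. Qed.

Lemma diff_times_S j (f : V -> W) O : diff_times j.+1 f O -> diff_times j f O.
Proof.
elim: j f => [//|j IH] f [df Df]; split=> // v; apply: IH; exact: Df.
Qed.

Lemma diff_times_cst j (w : W) O : diff_times j (cst w) O.
Proof.
elim: j w => [//|j IH] w; split=> [x _|v]; first exact: differentiable_cst.
have -> : (fun x : V => 'D_v (cst w) x) = cst 0 by apply/funext => x; rewrite derive_cst.
exact: IH.
Qed.

Lemma diff_times_lin j (L : {linear V -> W}) O : continuous L -> diff_times j L O.
Proof.
move=> cL; case: j => [//|j]; split=> [x _|v]; first exact: linear_differentiable.
have -> : (fun x : V => 'D_v L x) = cst (L v).
  by apply/funext => x; rewrite deriveE ?diff_lin //; exact: linear_differentiable.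
exact: diff_times_cst.
Qed.

Lemma diff_timesD j (f g : V -> W) O : open O ->
  diff_times j f O -> diff_times j g O -> diff_times j (fun x => f x + g x) O.
Proof.
move=> oO; elim: j f g => [//|j IH] f g [df Df] [dg Dg]; split=> [x Ox|v].
  by apply: (@differentiableD _ _ _ f g); [exact: df|exact: dg].
apply: (diff_times_ext oO _ (IH _ _ (Df v) (Dg v))) => x Ox.
by rewrite -(@deriveD _ _ _ f g) //; apply: diff_derivable; [exact: df|exact: dg].
Qed.

Lemma diff_times_sum j (I : Type) (r : seq I) (P : pred I) (f : I -> V -> W) O : open O ->
  (forall i, P i -> diff_times j (f i) O) -> diff_times j (fun x => \sum_(i <- r | P i) f i x) O.
Proof.
move=> oO H; elim: r => [|i r IH].
  by apply: (diff_times_ext oO _ (diff_times_cst j 0 O)) => y _; rewrite big_nil.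
case Pi: (P i).
  by apply: (diff_times_ext oO _ (diff_timesD oO (H i Pi) IH)) => y _; rewrite big_cons Pi.
by apply: (diff_times_ext oO _ IH) => y _; rewrite big_cons Pi.
Qed.

End DiffTimes.

Section DiffTimesScalar.
Context {R : realType} {V : normedModType R}.
Implicit Types (O : set V).

Lemma diff_timesM j (f g : V -> R) O : open O ->
  diff_times j f O -> diff_times j g O -> diff_times j (fun x => f x * g x) O.
Proof.
move=> oO; elim: j f g => [//|j IH] f g Cf Cg; have [df Df] := Cf; have [dg Dg] := Cg.
split=> [x Ox|v].
  by apply: (@differentiableM _ _ f g); [exact: df|exact: dg].
have H := diff_timesD oO (IH _ _ (diff_times_S Cf) (Dg v)) (IH _ _ (diff_times_S Cg) (Df v)).
apply: (diff_times_ext oO _ H) => x Ox.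
by rewrite -(@deriveM _ _ f g) //; apply: diff_derivable; [exact: df|exact: dg].
Qed.

Lemma diff_timesZl (W : normedModType R) j (f : V -> R) (w : W) O : open O ->
  diff_times j f O -> diff_times j (fun x => f x *: w) O.
Proof.
move=> oO; elim: j f => [//|j IH] f [df Df]; split=> [x Ox|v].
  exact/differentiableZl/df.
apply: (diff_times_ext oO _ (IH _ (Df v))) => x Ox.
have dfx := df x Ox.
by rewrite !deriveE ?diffZl //; exact/differentiableZl.
Qed.

(** The derivative is [phi' (f x)] times that of [f], so the induction runs over all [phi] smooth on
    [I]. *)
Lemma diff_times_comp1 j (phi : R -> R) (f : V -> R) O (I : set R) : open O -> open I ->
  (forall x, O x -> I (f x)) -> smooth_on phi I ->
  diff_times j f O -> diff_times j (fun x => phi (f x)) O.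
Proof.
move=> oO oI fI; elim: j phi => [//|j IH] phi sp Cf; have [df Df] := Cf.
split=> [x Ox|v].
  apply: (@differentiable_comp _ _ _ _ f phi); first exact: df.
  exact: smooth_on_differentiable sp (fI x Ox).
have H := diff_timesM oO (IH _ (smooth_on_derive (1:R) sp) (diff_times_S Cf)) (Df v).
apply: (diff_times_ext oO _ H) => x Ox.
have dfx := df x Ox; have dpx := smooth_on_differentiable sp (fI x Ox).
rewrite !deriveE //; last exact: (@differentiable_comp _ _ _ _ f phi).
rewrite (@diff_comp _ _ _ _ f phi) //= mulrC -[in RHS](mulr1 ('d f x v)).
by rewrite -[_ * 1]/(_ *: (1:R)) linearZ.
Qed.

End DiffTimesScalar.

Lemma diff_times_id (R : realType) (V : normedModType R) j (O : set V) : diff_times j (id : V -> V) O.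
Proof.
case: j => [//|j]; split=> [x _|v]; first exact: ex_diff.
have -> : 'D_v (id : V -> V) = cst v by apply/funext => x; rewrite derive_id.
exact: diff_times_cst.
Qed.

(** * Smoothness of the elementary functions *)

Section OneVar.
Context {R : realType}.

Lemma is_derive1_differentiable (phi : R -> R) (x d : R) : is_derive x 1 phi d -> differentiable phi x.
Proof. by move=> [H _]; apply/derivable1_diffP. Qed.

Lemma is_derive1_dir (phi : R -> R) (x d v : R) : is_derive x 1 phi d -> 'D_v phi x = v * d.
Proof.
move=> H; have dp := is_derive1_differentiable H.
by rewrite deriveE // diff1E // derive1E derive_val.
Qed.

(** Bootstrapping along the equation [phi' = psi]: when [psi] is built from [phi], as for the
    inverse and the square root, regularity of order [i] of [phi] passes to [psi] and hence gives
    order [i + 1] of [phi]. *)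
Lemma diff_times_ode j (phi psi : R -> R) (I : set R) : open I ->
  (forall x, I x -> is_derive x 1 phi (psi x)) ->
  (forall i, (i < j)%N -> diff_times i phi I -> diff_times i psi I) -> diff_times j phi I.
Proof.
move=> oI H; elim: j => [//|j IH] K.
have Dj : diff_times j phi I by apply: IH => i ij; apply: K; rewrite ltnS ltnW.
split=> [x Ix|v]; first exact: is_derive1_differentiable (H x Ix).
apply: (diff_times_ext oI _ (diff_timesM oI (diff_times_cst j v I) (K j (ltnSn j) Dj))).
by move=> x Ix; rewrite (is_derive1_dir v (H x Ix)).
Qed.

Lemma smooth_inv : smooth_on (fun x : R => x^-1) [set x | 0 < x].
Proof.
move=> j; apply: (@diff_times_ode _ _ (fun x => -1 * (x^-1 * x^-1))); first exact: open_gt.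
  move=> x /= x0; have xn : x != 0 by rewrite gt_eqF.
  have H : is_derive x (1:R) (id : R -> R) 1 by exact: is_derive_id.
  have := @is_deriveV R id x 1 1 xn H.
  by rewrite -[_ *: _]/(_ * 1) mulr1 mulN1r expr2 invfM.
move=> i _ H; have oI := @open_gt R 0.
by do !apply: diff_timesM => //; exact: diff_times_cst.
Qed.

Lemma smooth_sincos j : diff_times j (@sin R) setT /\ diff_times j (@cos R) setT.
Proof.
elim: j => [//|j [IH1 IH2]].
have oT : open (@setT R) by exact: openT.
split; split=> [x _|v].
- exact: (is_derive1_differentiable (is_derive_sin x)).
- apply: (diff_times_ext oT _ (diff_timesM oT (diff_times_cst j v _) IH2)) => x _.
  by rewrite (is_derive1_dir v (is_derive_sin x)).
- exact: (is_derive1_differentiable (is_derive_cos x)).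
- apply: (diff_times_ext oT _ (diff_timesM oT (diff_times_cst j (- v) _) IH1)) => x _.
  by rewrite (is_derive1_dir v (is_derive_cos x)) mulrN mulNr.
Qed.

Lemma smooth_sin : smooth_on (@sin R) setT. Proof. by move=> j; have [] := smooth_sincos j. Qed.
Lemma smooth_cos : smooth_on (@cos R) setT. Proof. by move=> j; have [] := smooth_sincos j. Qed.

Lemma smooth_sqrt : smooth_on (@Num.sqrt R) [set x | 0 < x].
Proof.
have oI := @open_gt R 0.
move=> j; apply: (@diff_times_ode _ _ (fun x => (2 * Num.sqrt x)^-1)) => //.

move=> i _ H; apply: (diff_times_comp1 oI oI _ smooth_inv).
  by move=> x /= x0; rewrite mulr_gt0 // sqrtr_gt0.
by apply: diff_timesM => //; exact: diff_times_cst.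
Qed.

Lemma open_oo (a b : R) : open [set x : R | a < x < b].
Proof.
have -> : [set x : R | a < x < b] = [set x | a < x] `&` [set x | x < b].
  by apply/seteqP; split=> x /=; [move=> /andP|move=> [-> ->]].
by apply: openI; [exact: open_gt|exact: open_lt].
Qed.

Lemma smooth_acos : smooth_on (@acos R) [set x | -1 < x < 1].
Proof.
have oI := @open_oo (-1) 1.
move=> j; apply: (@diff_times_ode _ _ (fun x => - (Num.sqrt (1 - x ^+ 2))^-1)) => //.

move=> i _ H.
have P x : -1 < x < 1 -> 0 < 1 - x ^+ 2 :> R by move=> /andP[a b]; nra.
have D1 : diff_times i (fun x : R => 1 + -1 * (x * x)) [set x | -1 < x < 1].
  apply: diff_timesD => //; first exact: diff_times_cst.
  have Di : diff_times i (id : R -> R) [set x | -1 < x < 1].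
    exact: diff_times_id.
  by do !apply: diff_timesM => //; exact: diff_times_cst.
have P2 x : -1 < x < 1 -> 0 < 1 + -1 * (x * x) :> R by move=> /andP[a b]; nra.
have D2 := diff_times_comp1 oI (@open_gt R 0) P2 smooth_sqrt D1.
have P3 x : -1 < x < 1 -> 0 < Num.sqrt (1 + -1 * (x * x)) :> R by move=> /P2; rewrite sqrtr_gt0.
have D3 := diff_times_comp1 oI (@open_gt R 0) P3 smooth_inv D2.
apply: (diff_times_ext oI _ (diff_timesM oI (diff_times_cst i (-1:R) _) D3)) => x _.
by rewrite !mulN1r expr2.
Qed.

End OneVar.

(** * Implicit functions with one real unknown *)

Section Implicit.
Context {R : realType} {V : normedModType R}.
Implicit Types (G : V * R -> R) (O : set (V * R)) (U : set V).

Lemma is_derive_slice G x c : differentiable G (x, c) ->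
  is_derive c (1:R) (fun a => G (x, a)) ('D_((0, 1) : V * R) G (x, c)).
Proof.
move=> dG.
have E : (fun h : R => h^-1 *: ((G \o shift (x, c)) (h *: ((0, 1) : V * R)) - G (x, c))) =
  (fun h : R => h^-1 *: (((fun a => G (x, a)) \o shift c) (h *: (1:R)) - G (x, c))).
  by apply/funext => h /=; rewrite -[h *: (0, 1) + _]/(h *: 0 + x, h *: (1:R) + c) scaler0 add0r.
have D : derivable G (x, c) (0, 1) by exact: diff_derivable.
split; first by rewrite /derivable -E.
by rewrite /derive -E.
Qed.

Lemma diff_pairE G p v k : differentiable G p ->
  'd G p (v, k) = 'D_(v, 0) G p + k * 'D_((0, 1) : V * R) G p.
Proof.
move=> dG; rewrite !deriveE //.
have -> : (v, k) = (v, 0) + k *: ((0, 1) : V * R).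
  by rewrite -[k *: _]/(k *: 0, k *: (1 : R)) scaler0 -[RHS]/(v + 0, 0 + k * 1) addr0 add0r mulr1.
by rewrite linearD linearZ.
Qed.

Lemma differentiable_graph (A : V -> R) x : differentiable A x ->
  differentiable (fun x => (x, A x)) x /\ forall v, 'd (fun x => (x, A x)) x v = (v, 'd A x v).
Proof.
move=> dA.
have di : differentiable (id : V -> V) x by exact: ex_diff.
split; first exact: (@differentiable_pair _ _ _ _ id A).
move=> v; rewrite (@diff_pair _ _ _ _ id A) // /=.
have -> : 'd (id : V -> V) x = id :> (V -> V) by exact: diff_val.
by [].
Qed.

(** [G] is smooth while [A] has a finite order [j]: this is the form in which an implicit function
    gains one order from the formula for its own derivative. *)
Lemma diff_times_graph j G O (A : V -> R) U : open U -> open O ->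
  (forall x, U x -> O (x, A x)) -> smooth_on G O -> diff_times j A U ->
  diff_times j (fun x => G (x, A x)) U.
Proof.
move=> oU oO UO; elim: j G => [//|j IH] G sG CA; have [dA DA] := CA.
have dG x : U x -> differentiable G (x, A x) by move=> /UO; exact: smooth_on_differentiable.
split=> [x Ux|v].
  have [d1 _] := differentiable_graph (dA x Ux).
  by apply: (@differentiable_comp _ _ _ _ (fun x => (x, A x)) G) => //; exact: dG.
have H := diff_timesD oU (IH _ (smooth_on_derive ((v, 0) : V * R) sG) (diff_times_S CA))
  (diff_timesM oU (DA v) (IH _ (smooth_on_derive ((0, 1) : V * R) sG) (diff_times_S CA))).
apply: (diff_times_ext oU _ H) => x Ux.
have [d1 e1] := differentiable_graph (dA x Ux).
rewrite [in RHS]deriveE; last first.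
  by apply: (@differentiable_comp _ _ _ _ (fun x => (x, A x)) G) => //; exact: dG.
rewrite (@diff_comp _ _ _ _ (fun x => (x, A x)) G) //=; last exact: dG.
by rewrite e1 diff_pairE ?(@deriveE _ _ _ A) //; [exact: dA|exact: dG].
Qed.

Lemma cvg_graph (A : V -> R) x : {for x, continuous A} -> (fun v => (v, A (v + x) - A x)) @ (0:V) --> ((0, 0) : V * R).
Proof.
move=> cA.
have H : (fun v => A (v + x) - A x) @ (0:V) --> (0 : R).
  rewrite -[X in _ --> X](subrr (A x)); apply: cvgB; last exact: cvg_cst.
  have S : (fun v : V => v + x) @ (0:V) --> x.
    by rewrite -[X in _ --> X]add0r; apply: cvgD; [exact: cvg_id|exact: cvg_cst].
  exact: (cvg_comp _ _ S cA).
exact: (cvg_pair (@cvg_id _ (nbhs (0 : V))) H).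
Qed.

(** Linearising [G (v, A v) = 0] bounds the error of the candidate differential [L] by a small
    multiple of the increments of [v] and of [A]; the latter is at most the error itself plus a
    multiple of the former, so the error term can be absorbed. *)
Lemma implicit_diff G (A : V -> R) x : differentiable G (x, A x) -> {for x, continuous A} ->
  (\forall v \near x, G (v, A v) = 0) -> 0 < 'D_((0, 1) : V * R) G (x, A x) ->
  differentiable A x /\
  forall v, 'D_v A x = - ('D_((v, 0) : V * R) G (x, A x) / 'D_((0, 1) : V * R) G (x, A x)).
Proof.
move=> dG cA G0; set g := 'D_(0, 1) G (x, A x) => g0.
pose l (v : V) : R := - g^-1 *: 'd G (x, A x) (v, 0).
have lin_l : linear l.
  move=> k u v; rewrite /l.
  have -> : (k *: u + v, 0) = k *: ((u, 0) : V * R) + (v, 0).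
    by rewrite -[RHS]/(k *: u + v, k *: 0 + 0) scaler0 addr0.
  by rewrite linearP scalerDr scalerA mulrC -scalerA.
pose lM := GRing.isLinear.Build _ _ _ _ _ lin_l.
pose L : {linear V -> R} := HB.pack l lM.
have cL : continuous L.
  move=> v.
  have S : (fun v : V => (v, 0 : R)) @ v --> ((v, 0) : V * R).
    exact: (cvg_pair (@cvg_id _ (nbhs v)) (@cvg_cst _ _ _ (nbhs v) _)).
  have dc : {for (v, 0), continuous ('d G (x, A x))} by exact: diff_continuous.
  have T := cvg_comp _ _ S dc.
  exact: (cvgM (cvg_cst (- g^-1)) T).
have [M M0 LM] := linear_lipschitz cL.
have [dA eA] : differentiable A x /\ 'd A x = L :> (V -> R).
  apply: eps_differentiable => // e e0.
  (* The bound [g / 2] absorbs half of the left-hand side [g * |k - L v|]; the other bound makes the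
     remaining [e' * (1 + M) * |v|] at most half of [e * g * |v|]. *)
  pose e' := Num.min (g / 2) (e * g / (2 * (1 + M))).
  have e'0 : 0 < e' by rewrite lt_min; apply/andP; split; [|rewrite divr_gt0 // ?mulr_gt0]; lra.
  have := cvg_graph cA (differentiable_eps dG e'0).
  have G0' : \forall v \near (0 : V), G (v + x, A (v + x)) = 0.
    by move: G0; rewrite (near_shift 0) /= subr0; apply: filterS.
  have Gx := nbhs_singleton G0.
  rewrite nbhs_simpl /=; apply: filterS2 G0' => v Gv /=.
  rewrite -[(v, _) + (x, A x)]/(v + x, A (v + x) - A x + A x) subrK Gv Gx subrr sub0r normrN.
  rewrite diff_pairE // -/g.
  set k := A (v + x) - A x => H.
  have Lv : 'D_(v, 0) G (x, A x) = - g * L v.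
    by rewrite /L /= /l -[_ *: _]/(_ * _) mulrA mulrNN divff ?gt_eqF // mul1r deriveE.
  have N : `|((v, k) : V * R)| <= `|v| + `|k|.
    by rewrite prod_normE /= ge_max lerDl lerDr !normr_ge0.
  move: H; rewrite Lv.
  have -> : - g * L v + k * g = g * (k - L v) by ring.
  rewrite normrM (gtr0_norm g0) => H.
  have K1 : `|k| <= `|k - L v| + M * `|v|.
    have := ler_normD (k - L v) (L v); rewrite subrK => /le_trans; apply.
    by rewrite lerD2l; exact: LM.
  have e'1 : e' <= g / 2 by rewrite ge_min lexx.
  have e'2 : e' * (2 * (1 + M)) <= e * g.
    by rewrite -ler_pdivlMr ?ge_min ?lexx ?orbT // mulr_gt0 //; lra.
  have H2 : g * `|k - L v| <= e' * (`|v| + (`|k - L v| + M * `|v|)).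
    apply: (le_trans H); rewrite ler_pM2l //; apply: (le_trans N).
    by rewrite lerD2l.
  have X0 := normr_ge0 (k - L v); have V0 := normr_ge0 v.
  have H3 : e' * `|k - L v| <= g / 2 * `|k - L v| by rewrite ler_wpM2r.
  have H4 : e' * (2 * (1 + M)) * `|v| <= e * g * `|v| by rewrite ler_wpM2r.
  have H5 : g * `|k - L v| <= g * (e * `|v|) by nra.
  by rewrite ler_pM2l in H5.
split=> // v; rewrite deriveE // eA /= /l -[_ *: _]/(_ * _) (@deriveE _ _ _ G) //.
by rewrite mulrC mulrN.
Qed.

Lemma near_continuous_sign (T : topologicalType) (f : T -> R) x (P : R -> Prop) : {for x, continuous f} ->
  open [set y | P y] -> P (f x) -> \forall y \near x, P (f y).
Proof. by move=> cf oP Pf; apply: cf; exact: (open_nbhs_nbhs (conj oP Pf)). Qed.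

(** [G] increases strictly in its last variable near the base point, so a zero exists by the
    intermediate value theorem and is unique by the mean value theorem. Uniqueness within [eta] is
    part of the conclusion because it identifies nearby solutions when the chart of X_n is built. *)
Lemma implicit_function G O x0 a0 : open O -> O (x0, a0) -> smooth_on G O ->
  G (x0, a0) = 0 -> 0 < 'D_((0, 1) : V * R) G (x0, a0) ->
  exists (U : set V) (eta : R) (A : V -> R),
    [/\ [/\ open U, U x0, 0 < eta & A x0 = a0], smooth_on A U &
      forall x, U x -> [/\ O (x, A x), G (x, A x) = 0, `|A x - a0| < eta &
        forall a, `|a - a0| < eta -> G (x, a) = 0 -> a = A x]].
Proof.
move=> oO O0 sG G0 g0.
pose Ga := fun p : V * R => 'D_((0, 1) : V * R) G p.
have dG p : O p -> differentiable G p by exact: smooth_on_differentiable.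
have dGa p : O p -> differentiable Ga p.
  by move=> Op; exact: smooth_on_differentiable (smooth_on_derive _ sG) Op.
have [d d0 dB] : exists2 d, 0 < d & forall x a, `|x - x0| < d -> `|a - a0| < d -> O (x, a) /\ 0 < Ga (x, a).
  have H : \forall p \near (x0, a0), O p /\ 0 < Ga p.
    apply: filterI; first exact: (open_nbhs_nbhs (conj oO O0)).
    exact: (near_continuous_sign (differentiable_continuous (dGa _ O0)) (@open_gt R 0) g0).
  have /nbhs_ballP[d d0 H'] := H; exists d => // x a xd ad; apply: H'.
  by split; rewrite -ball_normE /= distrC.
have mono x a b : `|x - x0| < d -> `|a - a0| < d -> `|b - a0| < d -> a < b -> G (x, a) < G (x, b).
  move=> xd ad bd ab.
  have inn c : c \in `[a, b] -> `|c - a0| < d.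
    rewrite in_itv /= => /andP[ac cb]; move: ad bd; rewrite !ltr_norml => /andP[? ?] /andP[? ?].
    by apply/andP; split; lra.
  have dv c : c \in `[a, b] -> is_derive c (1:R) (fun a => G (x, a)) (Ga (x, c)).
    by move=> /inn cd; apply/is_derive_slice/dG; have [] := dB x c xd cd.
  have [|c cab] := MVT ab (fun c cab => dv c (subset_itv_oo_cc cab)).
    by apply: derivable_within_continuous => c /dv [].
  have [_ Gc] := dB x c xd (inn c (subset_itv_oo_cc cab)).
  by move=> E; rewrite -subr_gt0 E mulr_gt0 // subr_gt0.
have sliceC a x : `|x - x0| < d -> `|a - a0| < d -> {for x, continuous (fun y => G (y, a))}.
  move=> xd ad; have [Oxa _] := dB x a xd ad.
  have C := differentiable_continuous (dG _ Oxa).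
  have S : (fun y : V => (y, a)) @ x --> ((x, a) : V * R).
    exact: (cvg_pair (@cvg_id _ (nbhs x)) (@cvg_cst _ _ _ (nbhs x) _)).
  exact: (cvg_comp _ _ S C).
(* The endpoints [a0 - eta] and [a0 + eta] lie strictly inside the box where [mono] applies. *)
pose eta := d / 2; have eta0 : 0 < eta by rewrite divr_gt0.
have etad : eta < d by rewrite /eta; lra.
have x0d : `|x0 - x0| < d by rewrite subrr normr0.
have a0d : `|a0 - a0| < d by rewrite subrr normr0.
have ap : `|a0 + eta - a0| < d by rewrite addrC addKr gtr0_norm.
have am : `|a0 - eta - a0| < d by rewrite addrC addKr normrN gtr0_norm.
have Gp : 0 < G (x0, a0 + eta) by rewrite -G0; apply: mono => //; lra.
have Gm : G (x0, a0 - eta) < 0 by rewrite -G0; apply: mono => //; lra.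
have [r r0 rB] : exists2 r, 0 < r & forall x, `|x - x0| < r -> [/\ `|x - x0| < d, 0 < G (x, a0 + eta) & G (x, a0 - eta) < 0].
  have H1 := near_continuous_sign (sliceC _ _ x0d ap) (@open_gt R 0) Gp.
  have H2 := near_continuous_sign (sliceC _ _ x0d am) (@open_lt R 0) Gm.
  have H12 : \forall x \near x0, 0 < G (x, a0 + eta) /\ G (x, a0 - eta) < 0 by exact: filterI.
  have /nbhs_ballP[r1 r10 H] := H12.
  exists (Num.min r1 d); first by rewrite lt_min r10 d0.
  move=> x; rewrite lt_min => /andP[xr xd].
  have [] : 0 < G (x, a0 + eta) /\ G (x, a0 - eta) < 0 by apply: H; rewrite -ball_normE /= distrC.
  by [].
pose U : set V := [set x | `|x - x0| < r].
have oU : open U.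
  have -> : U = ball x0 r by rewrite -ball_normE; apply/seteqP; split=> x /=; rewrite distrC.
  exact: ball_open.
have ex x : U x -> exists a, `|a - a0| < eta /\ G (x, a) = 0.
  move=> /rB[xd xp xm].
  have ab : a0 - eta <= a0 + eta by lra.
  have dv c : c \in `[a0 - eta, a0 + eta] -> derivable (fun a => G (x, a)) c 1.
    rewrite in_itv /= => /andP[c1 c2]; have cd : `|c - a0| < d by rewrite ltr_norml; apply/andP; split; lra.
    by have [Oc _] := dB x c xd cd; have [] := is_derive_slice (dG _ Oc).
  have [|c cI Gc] := IVT (v := 0) ab (derivable_within_continuous dv).
    by rewrite ge_min le_max (ltW xp) (ltW xm) orbT.
  exists c; split=> //.
  have c1 : c != a0 - eta by apply: contraTneq xm => <-; rewrite Gc ltxx.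
  have c2 : c != a0 + eta by apply: contraTneq xp => <-; rewrite Gc ltxx.
  move: cI; rewrite in_itv /= !le_eqVlt (negbTE c2) eq_sym (negbTE c1) /= => /andP[c3 c4].
  by rewrite ltr_norml; apply/andP; split; lra.
pose A x : R := get [set a | `|a - a0| < eta /\ G (x, a) = 0].
have AP x : U x -> `|A x - a0| < eta /\ G (x, A x) = 0.
  by move=> /ex[a Ha]; exact: (@getI _ [set a | `|a - a0| < eta /\ G (x, a) = 0] a Ha).
have Ad x : U x -> `|A x - a0| < d by move=> /AP[H _]; exact: lt_trans H etad.
have uniq x a : U x -> `|a - a0| < eta -> G (x, a) = 0 -> a = A x.
  move=> Ux ae Ga0; have [xd _ _] := rB x Ux; have [A1 A2] := AP x Ux.
  have ad := lt_trans ae etad; have Axd := Ad x Ux.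
  case: (ltgtP a (A x)) => // H; [have := mono x _ _ xd ad Axd H|have := mono x _ _ xd Axd ad H];
    by rewrite Ga0 A2 ltxx.
have U0 : U x0 by rewrite /U /= subrr normr0.
have OA x : U x -> O (x, A x) by move=> Ux; have [xd _ _] := rB x Ux; have [] := dB x _ xd (Ad x Ux).
have GaA x : U x -> 0 < Ga (x, A x) by move=> Ux; have [xd _ _] := rB x Ux; have [] := dB x _ xd (Ad x Ux).
have nU x : U x -> \forall v \near x, U v by move=> Ux; exact: (open_nbhs_nbhs (conj oU Ux)).
have cA x : U x -> {for x, continuous A}.
  move=> Ux; have [A1 A2] := AP x Ux; have [xd _ _] := rB x Ux.
  apply/cvgrPdist_le => e e0.
  (* Small enough for [A x - e1] and [A x + e1] to stay in the box; the signs of [G] at these two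
     heights persist for nearby [v] and trap [A v] between them. *)
  pose e1 := Num.min e ((d - `|A x - a0|) / 2).
  have Axd := Ad x Ux.
  have e10 : 0 < e1 by rewrite lt_min e0 divr_gt0 // subr_gt0.
  have e1e : e1 <= e by rewrite ge_min lexx.
  have e1d : e1 <= (d - `|A x - a0|) / 2 by rewrite ge_min lexx orbT.
  have B1 : `|A x + e1 - a0| < d.
    by rewrite addrAC (le_lt_trans (ler_normD _ _)) // (gtr0_norm e10); lra.
  have B2 : `|A x - e1 - a0| < d.
    by rewrite addrAC (le_lt_trans (ler_normD _ _)) // normrN (gtr0_norm e10); lra.
  have P1 : 0 < G (x, A x + e1) by rewrite -A2; apply: mono => //; lra.
  have P2 : G (x, A x - e1) < 0 by rewrite -A2; apply: mono => //; lra.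
  have N1 := near_continuous_sign (sliceC _ _ xd B1) (@open_gt R 0) P1.
  have N2 := near_continuous_sign (sliceC _ _ xd B2) (@open_lt R 0) P2.
  apply: filterS3 N1 N2 (nU x Ux) => v v1 v2 Uv; have [V1 V2] := AP v Uv; have Avd := Ad v Uv.
  have [vd _ _] := rB v Uv; rewrite distrC ler_norml.
  apply/andP; split; rewrite leNgt; apply/negP => H.
    have : A v < A x - e1 by lra.
    by move=> /(mono v _ _ vd Avd B2); rewrite V2 => /(lt_trans v2); rewrite ltxx.
  have : A x + e1 < A v by lra.
  by move=> /(mono v _ _ vd B1 Avd); rewrite V2 => /(lt_trans v1); rewrite ltxx.
have dA x : U x -> differentiable A x /\ forall v, 'D_v A x = - ('D_((v, 0) : V * R) G (x, A x) / Ga (x, A x)).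
  move=> Ux; apply: implicit_diff; [exact/dG/OA|exact: cA| |exact: GaA].
  by apply: filterS (nU x Ux) => v /AP[].
exists U, eta, A; split.
- by split=> //; apply/esym/uniq => //; rewrite subrr normr0.
(* On [B] the denominator [Ga] is positive, so the derivative of [A] is a smooth function of
   [(x, A x)] and each order of [A] yields the next. *)
- pose B := O `&` Ga @^-1` [set y | 0 < y].
  have oB : open B.
    rewrite openE => p [Op pp]; apply: filterI; first exact: (open_nbhs_nbhs (conj oO Op)).
    exact: (near_continuous_sign (differentiable_continuous (dGa _ Op)) (@open_gt R 0) pp).
  have sB v : smooth_on (fun p => -1 * ('D_((v, 0) : V * R) G p * (Ga p)^-1)) B.
    have BO : B `<=` O by move=> p [].
    move=> j; do !apply: diff_timesM => //; first exact: diff_times_cst.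
      exact: diff_times_sub BO (smooth_on_derive _ sG j).
    apply: (diff_times_comp1 oB (@open_gt R 0) _ smooth_inv); first by move=> p [].
    exact: diff_times_sub BO (smooth_on_derive _ sG j).
  elim=> [//|j IH]; split=> [x Ux|v]; first by have [] := dA x Ux.
  have UB x : U x -> B (x, A x) by move=> Ux; split; [exact: OA|exact: GaA].
  apply: (diff_times_ext oU _ (diff_times_graph oU oB UB (sB v) IH)) => x Ux.
  by rewrite (dA x Ux).2 mulN1r.
- by move=> x Ux; have [A1 A2] := AP x Ux; split=> //; [exact: OA|move=> a; exact: uniq].
Qed.

End Implicit.

(** * Second-order expansions *)

Section SecondOrder.
Context {R : realType}.

Lemma is_derive_line (V W : normedModType R) (f : V -> W) (p u : V) (t : R) :
  differentiable f (p + t *: u) ->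
  is_derive t (1:R) (fun t => f (p + t *: u)) ('D_u f (p + t *: u)).
Proof.
move=> df.
have E : (fun h : R => h^-1 *: ((f \o shift (p + t *: u)) (h *: u) - f (p + t *: u))) =
  (fun h : R => h^-1 *: (((fun t => f (p + t *: u)) \o shift t) (h *: (1:R)) - f (p + t *: u))).
  apply/funext => h /=; rewrite -[h *: (1:R)]/(h * 1) mulr1.
  by rewrite scalerDl addrCA.
have D : derivable f (p + t *: u) u by exact: diff_derivable.
split; first by rewrite /derivable -E.
by rewrite /derive -E.
Qed.

Lemma near0_norm (V : normedModType R) (P : V -> Prop) : (\forall h \near (0:V), P h) ->
  exists2 d : R, 0 < d & forall h, `|h| < d -> P h.
Proof.
move=> /nbhs_ballP[d d0 H]; exists d => // h hd; apply: H.
by rewrite -ball_normE /= sub0r normrN.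
Qed.

(** The mean value theorem in the direction [u] turns the second difference into an increment of
    ['D_u f], which the differentiability of ['D_u f] at [x] linearises. *)
Lemma second_difference (V : normedModType R) (f : V -> R) (x u v : V) :
  (\near x, differentiable f x) -> differentiable ('D_u f) x ->
  forall e, 0 < e -> exists2 d : R, 0 < d & forall s, 0 < s < d ->
   `|f (x + s *: u + s *: v) - f (x + s *: u) - f (x + s *: v) + f x
     - s ^+ 2 * 'D_v ('D_u f) x| <= e * s ^+ 2.
Proof.
move=> nf dF e e0.
(* [s * N] dominates the sum of the norms of [c *: u + s *: v] and [c *: u], the two increments at
   which the linearisation is used. *)
pose N := 2 * `|u| + `|v| + 1.
have u0 := normr_ge0 u; have v0 := normr_ge0 v.
have N0 : 0 < N by rewrite /N; lra.
have [d1 d10 H1] := near0_norm (differentiable_eps dF (divr_gt0 e0 N0)).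
have [d2 d20 H2] : exists2 d : R, 0 < d & forall h, `|h| < d -> differentiable f (h + x).
  by apply: near0_norm; move: nf; rewrite (near_shift 0) /= subr0.
pose d := Num.min d1 d2 / N.
have m0 : 0 < Num.min d1 d2 by rewrite lt_min d10.
exists d; first by rewrite divr_gt0.
move=> s /andP[s0]; rewrite ltr_pdivlMr // lt_min => /andP[sN1 sN2].
have bnd t : 0 <= t <= s -> `|t *: u + s *: v| <= s * (`|u| + `|v|) /\ `|t *: u| <= s * `|u|.
  move=> /andP[t0 ts].
  have A : `|t *: u| <= s * `|u| by rewrite normrZ ger0_norm // ler_wpM2r.
  split=> //; rewrite (le_trans (ler_normD _ _)) // mulrDr lerD // normrZ gtr0_norm //.
pose phi t := f (x + s *: v + t *: u) - f (x + t *: u).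
pose dphi t := 'D_u f (x + s *: v + t *: u) - 'D_u f (x + t *: u).
have dom t : 0 <= t <= s -> differentiable f (x + s *: v + t *: u) /\ differentiable f (x + t *: u).
  move=> ts; have [b1 b2] := bnd t ts; split.
    rewrite -addrA addrC [s *: v + _]addrC; apply: H2; apply: le_lt_trans b1 _.
    by apply: le_lt_trans sN2; rewrite ler_wpM2l ?ltW // /N; lra.
  rewrite addrC; apply: H2; apply: le_lt_trans b2 _.
  by apply: le_lt_trans sN2; rewrite ler_wpM2l ?ltW // /N; lra.
have dv t : t \in `[0, s] -> is_derive t (1:R) phi (dphi t).
  rewrite in_itv /= => /dom[D1 D2].
  by apply: (is_deriveB (is_derive_line D1) (is_derive_line D2)).
have [|c cs] := MVT s0 (fun c cab => dv c (subset_itv_oo_cc cab)).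
  by apply: derivable_within_continuous => c /dv [].
have {cs} cs : 0 <= c <= s by move: cs; rewrite in_itv /= => /andP[? ?]; rewrite !ltW.
rewrite subr0 => E.
have -> : f (x + s *: u + s *: v) - f (x + s *: u) - f (x + s *: v) + f x = phi s - phi 0.
  by rewrite /phi scale0r !addr0 [x + s *: u + _]addrAC; ring.
rewrite E.
have [b1 b2] := bnd c cs.
have K1 := H1 (c *: u + s *: v) (le_lt_trans b1 (le_lt_trans _ sN1)).
have K2 := H1 (c *: u) (le_lt_trans b2 (le_lt_trans _ sN1)).
have {}K1 := K1 (ler_wpM2l (ltW s0) _); have {}K2 := K2 (ler_wpM2l (ltW s0) _).
have T1 : `|u| + `|v| <= N by rewrite /N; lra.
have T2 : `|u| <= N by rewrite /N; lra.
have {T1}K1 := K1 T1; have {T2}K2 := K2 T2.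
have Q : dphi c - s * 'D_v ('D_u f) x =
  ('D_u f (c *: u + s *: v + x) - 'D_u f x - 'd ('D_u f) x (c *: u + s *: v)) -
  ('D_u f (c *: u + x) - 'D_u f x - 'd ('D_u f) x (c *: u)).
  rewrite /dphi (deriveE v dF) linearD [X in _ = _ - _ - (_ + X) - _]linearZ /= -[_ *: 'd _ _ v]/(_ * _).
  have -> : x + s *: v + c *: u = c *: u + s *: v + x by rewrite addrC [x + _]addrC addrA.
  rewrite [x + c *: u]addrC; ring.
have -> : dphi c * s - s ^+ 2 * 'D_v ('D_u f) x = s * (dphi c - s * 'D_v ('D_u f) x) by ring.
rewrite normrM gtr0_norm // Q.
have eN : e / N * N = e by rewrite divfK // gt_eqF.
have eN0 : 0 < e / N by rewrite divr_gt0.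
have -> : e * s ^+ 2 = s * (e * s) by rewrite expr2 mulrCA mulrA.
rewrite ler_pM2l //.
apply: le_trans (ler_normB _ _) _.
apply: le_trans (lerD K1 K2) _.
rewrite -mulrDr.
apply: le_trans (_ : e / N * (s * (`|u| + `|v|) + s * `|u|) <= _).
  by rewrite ler_pM2l //; lra.
apply: le_trans (_ : e / N * (N * s) <= _); last by rewrite mulrA eN.
by rewrite ler_pM2l // -mulrDr [N * s]mulrC ler_pM2l // /N; lra.
Qed.

(** The second difference is symmetric in [u] and [v], so after division by [s ^+ 2] it is close to
    both mixed derivatives. *)
Lemma derive_comm (V : normedModType R) (f : V -> R) (x u v : V) :
  (\near x, differentiable f x) -> differentiable ('D_u f) x -> differentiable ('D_v f) x ->
  'D_v ('D_u f) x = 'D_u ('D_v f) x.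
Proof.
move=> nf du dv; apply/eqP; rewrite -subr_eq0 -normr_eq0 eq_le normr_ge0 andbT.
apply/ler_addgt0Pl => e e0; rewrite addr0.
have e2 : 0 < e / 2 by lra.
have [d1 d10 H1] := second_difference v nf du e2.
have [d2 d20 H2] := second_difference u nf dv e2.
pose s := Num.min d1 d2 / 2.
have m0 : 0 < Num.min d1 d2 by rewrite lt_min d10.
have s0 : 0 < s by rewrite /s; lra.
have sm : s < Num.min d1 d2 by rewrite /s; lra.
move: sm; rewrite lt_min => /andP[s1 s2].
have {H1} := H1 s; have {H2} := H2 s; rewrite s0 s1 s2 => /(_ isT) K2 /(_ isT) K1.
have ss : 0 < s ^+ 2 by rewrite exprn_gt0.
rewrite -(ler_pM2r ss) -[X in `|_| * X](gtr0_norm ss) -normrM.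
move: K2 K1; rewrite [x + s *: v + _]addrAC.
move: (f _) (f (x + s *: v)) (f (x + s *: u)) (f x) ('D_v ('D_u f) x) ('D_u ('D_v f) x) => a b c d p q K2 K1.
have -> : (p - q) * s ^+ 2 = (a - b - c + d - s ^+ 2 * q) - (a - c - b + d - s ^+ 2 * p) by ring.
apply: le_trans (ler_normB _ _) _; apply: le_trans (lerD K2 K1) _.
by rewrite -mulrDl -splitr.
Qed.

Context {k : nat}.
Implicit Types (f : 'rV[R]_k -> R) (x z : 'rV[R]_k).

Lemma derive_row f x z : differentiable f x ->
  'D_z f x = \sum_i z 0 i * 'D_(delta_mx 0 i) f x.
Proof.
move=> df; rewrite deriveE // {1}[z]row_sum_delta linear_sum /=.
by apply: eq_bigr => i _; rewrite linearZ deriveE.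
Qed.

Lemma coord_le_norm z i : `|z 0 i| <= `|z|.
Proof.
rewrite [leRHS]/Num.Def.normr /= mx_normrE.
by apply: le_trans; last exact: (le_bigmax _ _ (0, i)).
Qed.

Definition hess f x : 'M[R]_k :=
  \matrix_(i, j) 'D_(delta_mx 0 i) (fun y => 'D_(delta_mx 0 j) f y) x.

Definition qform (H : 'M[R]_k) z : R := (z *m H *m z^T) 0 0.

Lemma qformE H z : qform H z = \sum_j (\sum_i z 0 i * H i j) * z 0 j.
Proof. by rewrite /qform mxE; apply: eq_bigr => j _; rewrite !mxE. Qed.

Lemma continuous_sum (T : topologicalType) (I : Type) (r : seq I) (F : I -> T -> R) (y : T) :
  (forall i, {for y, continuous (F i)}) -> {for y, continuous (fun t : T => \sum_(i <- r) F i t)}.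
Proof.
move=> H; elim: r => [|i r IH].
  have -> : (fun t : T => \sum_(i <- [::]) F i t) = cst 0 by apply/funext => t; rewrite big_nil.
  exact: cvg_cst.
have -> : (fun t : T => \sum_(j <- i :: r) F j t) = (fun t => F i t + \sum_(j <- r) F j t).
  by apply/funext => t; rewrite big_cons.
exact: cvgD (H i) IH.
Qed.

Lemma qform_continuous H : continuous (qform H).
Proof.
move=> z; have -> : qform H = fun z => \sum_j (\sum_i z 0 i * H i j) * z 0 j by apply/funext => y; exact: qformE.
have cc i : {for z, continuous (fun y : 'rV[R]_k => y 0 i)} by exact: coord_continuous.
apply: continuous_sum => j; apply: (cvgM _ (cc j)).
by apply: continuous_sum => i; exact: (cvgM (cc i) (cvg_cst _)).
Qed.

Lemma peano2 f x : (\near x, differentiable f x) ->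
  (forall i, differentiable ('D_(delta_mx 0 i) f) x) ->
  (forall i, 'D_(delta_mx 0 i) f x = 0) ->
  forall e, 0 < e -> \forall z \near (0 : 'rV[R]_k),
    `|f (x + z) - f x - 2^-1 * qform (hess f x) z| <= e * `|z| ^+ 2.
Proof.
move=> nf dF F0 e e0.
(* One share of [e] per coordinate; the successor keeps the divisor nonzero when [k = 0]. *)
pose e' := e / (k.+1)%:R.
have e'0 : 0 < e' by rewrite divr_gt0 // ltr0n.
have : \forall z \near (0 : 'rV[R]_k), forall i, `|'D_(delta_mx 0 i) f (z + x) - 'd ('D_(delta_mx 0 i) f) x z| <= e' * `|z|.
  have K i : \forall z \near (0 : 'rV[R]_k), `|'D_(delta_mx 0 i) f (z + x) - 'd ('D_(delta_mx 0 i) f) x z| <= e' * `|z|.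
    by have := differentiable_eps (dF i) e'0; apply: filterS => z; rewrite F0 subr0.
  exact: filter_forall K.
move=> /near0_norm[d1 d10 H1].
have [d2 d20 H2] : exists2 d : R, 0 < d & forall h, `|h| < d -> differentiable f (h + x).
  by apply: near0_norm; move: nf; rewrite (near_shift 0) /= subr0.
have m0 : 0 < Num.min d1 d2 by rewrite lt_min d10.
apply/nbhs_ballP; exists (Num.min d1 d2) => // z.
rewrite -ball_normE /= sub0r normrN lt_min => /andP[zd1 zd2].
set q := qform _ z.
have qE : q = \sum_j z 0 j * 'd ('D_(delta_mx 0 j) f) x z.
  rewrite /q qformE; apply: eq_bigr => j _; rewrite mulrC; congr (_ * _).
  by rewrite -deriveE // derive_row //; apply: eq_bigr => i _; rewrite mxE.
(* Subtracting the quadratic model reduces the estimate to the mean value theorem on the segment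
   from [x] to [x + z]. *)
pose phi (t : R) := f (x + t *: z) - t ^+ 2 * (2^-1 * q).
have zt t : 0 <= t <= 1 -> `|t *: z| <= `|z|.
  by move=> /andP[t0 t1]; rewrite normrZ ger0_norm // ler_piMl.
have dv (t : R) : t \in `[0, 1] -> is_derive t (1:R) phi ('D_z f (x + t *: z) - t * q).
  rewrite in_itv /= => t01.
  have D : differentiable f (x + t *: z) by rewrite addrC; apply: H2; apply: le_lt_trans zd2; exact: zt.
  have D2 : is_derive t (1:R) (fun t : R => t ^+ 2 * (2^-1 * q)) (t * q).
    have D3 := @is_deriveX _ _ (id : R -> R) 2 t 1 1 (is_derive_id _ _).
    have D4 := @is_deriveM _ _ (id ^+ 2 : R -> R) (cst (2^-1 * q)) t 1 _ _ D3 (is_derive_cst _ _ _).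
    apply: is_derive_eq.
    by rewrite scaler0 add0r -[LHS]/(2^-1 * q * (2 * t ^+ 1 * 1)) expr1; field.
  exact: (is_deriveB (is_derive_line D) D2).
have [|c cs] := MVT ltr01 (fun c cab => dv c (subset_itv_oo_cc cab)).
  by apply: derivable_within_continuous => c /dv [].
have {cs} c01 : 0 <= c <= 1 by move: cs; rewrite in_itv /= => /andP[? ?]; rewrite !ltW.
rewrite subr0 mulr1 /phi scale1r scale0r addr0 expr1n mul1r expr0n /= mul0r subr0 => E.
have -> : f (x + z) - f x - 2^-1 * q = 'D_z f (x + c *: z) - c * q by rewrite -E; ring.
have D : differentiable f (x + c *: z) by rewrite addrC; apply: H2; apply: le_lt_trans zd2; exact: zt.
rewrite derive_row // qE mulr_sumr -sumrB.
apply: le_trans (ler_norm_sum _ _ _) _.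
apply: le_trans (_ : \sum_(i < k) e' * `|z| ^+ 2 <= _).
  apply: ler_sum => i _.
  have -> : z 0 i * 'D_(delta_mx 0 i) f (x + c *: z) - c * (z 0 i * 'd ('D_(delta_mx 0 i) f) x z)
     = z 0 i * ('D_(delta_mx 0 i) f (c *: z + x) - 'd ('D_(delta_mx 0 i) f) x (c *: z)).
    have LZ : 'd ('D_(delta_mx 0 i) f) x (c *: z) = c * 'd ('D_(delta_mx 0 i) f) x z by rewrite linearZ.
    by rewrite LZ [x + _]addrC mulrBr mulrCA.
  rewrite normrM mulrC expr2 mulrA ler_pM ?normr_ge0 //; last exact: coord_le_norm.
  apply: le_trans (H1 _ (le_lt_trans (zt c c01) zd1) i) _.
  by rewrite ler_pM2l //; exact: zt.
rewrite sumr_const card_ord -mulr_natr mulrAC /e' ler_wpM2r ?exprn_ge0 //.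
by rewrite mulrAC ler_pdivrMr ?ltr0n // ler_pM2l // ler_nat.
Qed.

End SecondOrder.

Section AlongCurve.
Context {R : realType} {k : nat}.

Lemma cvg_slope (V : normedModType R) (y : R -> V) : differentiable y 0 ->
  (fun t : R => t^-1 *: (y t - y 0)) @ 0^' --> 'D_1 y 0.
Proof.
move=> dy; have D : derivable y 0 1 by exact: diff_derivable.
have -> : (fun t : R => t^-1 *: (y t - y 0)) = (fun h : R => h^-1 *: ((y \o shift 0) (h *: (1:R)) - y 0)).
  by apply/funext => t /=; rewrite addr0 -[t *: 1]/(t * 1) mulr1.
exact: D.
Qed.

Lemma qformZ (H : 'M[R]_k) a z : qform H (a *: z) = a ^+ 2 * qform H z.
Proof. by rewrite /qform linearZ /= -!scalemxAl -scalemxAr !mxE mulrA expr2. Qed.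

Lemma second_order_curve (f : 'rV[R]_k -> R) (y : R -> 'rV[R]_k) :
  (\forall z \near y 0, differentiable f z) ->
  (forall i, differentiable ('D_(delta_mx 0 i) f) (y 0)) ->
  (forall i, 'D_(delta_mx 0 i) f (y 0) = 0) -> differentiable y 0 ->
  (fun t : R => (f (y t) - f (y 0)) / t ^+ 2) @ 0^' --> 2^-1 * qform (hess f (y 0)) ('D_1 y 0).
Proof.
move=> nf dF F0 dy.
set x := y 0 in nf dF F0 *; set H := hess f x.
have sl := cvg_slope dy; set l := 'D_1 y 0 in sl *.
have q1 : (fun t : R => 2^-1 * qform H (t^-1 *: (y t - x))) @ 0^' --> 2^-1 * qform H l.
  apply: cvgM; first exact: cvg_cst.
  exact: (cvg_comp _ _ sl (@qform_continuous _ _ H l)).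
have q2 : (fun t : R => (f (y t) - f x) / t ^+ 2 - 2^-1 * qform H (t^-1 *: (y t - x))) @ 0^' --> (0 : R).
  apply/cvgrPdist_le => e e0.
  pose N := `|l| + 1.
  have N0 : 0 < N by rewrite /N ltr_wpDl.
  have e'0 : 0 < e / N ^+ 2 by rewrite divr_gt0 // exprn_gt0.
  have P := peano2 nf dF F0 e'0.
  have cz : (fun t => y t - x) @ (0:R)^' --> (0 : 'rV[R]_k).
    rewrite -(subrr x); apply: cvgB; last exact: cvg_cst.
    by apply: cvg_within_filter; exact: (differentiable_continuous dy).
  have {}P : \forall t \near (0:R)^',
    `|f (x + (y t - x)) - f x - 2^-1 * qform H (y t - x)| <= e / N ^+ 2 * `|y t - x| ^+ 2 := cz _ P.
  have Q : \forall t \near (0:R)^', `|t^-1 *: (y t - x)| <= N.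
    have /cvgrPdist_le/(_ _ ltr01) := sl; apply: filterS => t Ht.
    rewrite -[_ *: _](subrK l) (le_trans (ler_normD _ _)) // /N addrC lerD2l distrC //.
  have T0 : \forall t \near (0:R)^', t != 0 by exact: nbhs_dnbhs_neq.
  apply: filterS3 P Q T0 => t /= + Q t0.
  rewrite [x + _]addrC subrK sub0r normrN => P.
  have tt : 0 < t ^+ 2 by rewrite exprn_even_gt0 //= t0.
  have -> : (f (y t) - f x) / t ^+ 2 - 2^-1 * qform H (t^-1 *: (y t - x)) =
    (f (y t) - f x - 2^-1 * qform H (y t - x)) / t ^+ 2.
    by rewrite qformZ exprVn; field.
  rewrite normrM normfV (gtr0_norm tt) ler_pdivrMr //; apply: le_trans P _.
  have K : `|y t - x| <= N * `|t|.
    by rewrite -[y t - x](scalerKV t0) normrZ mulrC ler_wpM2r.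
  have -> : e * t ^+ 2 = e / N ^+ 2 * (N * `|t|) ^+ 2.
    by rewrite exprMn real_normK ?num_real // [RHS]mulrA divfK // lt0r_neq0 // exprn_gt0.
  rewrite ler_pM2l //.
  by rewrite lerXn2r ?nnegrE ?mulr_ge0 ?(ltW N0).
have -> : (fun t : R => (f (y t) - f x) / t ^+ 2) =
  (fun t => ((f (y t) - f x) / t ^+ 2 - 2^-1 * qform H (t^-1 *: (y t - x))) + 2^-1 * qform H (t^-1 *: (y t - x))).
  by apply/funext => t; rewrite subrK.
by rewrite -[X in _ --> X]add0r; exact: cvgD q2 q1.
Qed.

End AlongCurve.

(** * Quadratic forms on cycles *)

Section Index.
Context {R : realType} {k : nat}.
Implicit Types (H : 'M[R]_k) (v : 'rV[R]_k).

Lemma qform0 H : qform H 0 = 0.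
Proof. by rewrite /qform !mul0mx mxE. Qed.

Lemma definite_row_free p (s : R) H (M : 'M[R]_(p, k)) :
  (forall v : 'rV_p, v != 0 -> 0 < s * qform H (v *m M)) -> row_free M.
Proof.
move=> HM; apply/inj_row_free => v vM; apply/eqP; apply: contraT => /HM.
by rewrite vM qform0 mulr0 ltxx.
Qed.

(** Subspaces on which the form has opposite signs meet trivially, and [p + q = k] makes these two
    span the space; a negative subspace of dimension above [p] would meet the positive one. The
    factors [-1] and [1] match the sign [sigma] of [definite_dim]. *)
Lemma index_of_splitting p q H (M : 'M[R]_(p, k)) (N : 'M[R]_(q, k)) :
  (p + q = k)%N -> H^T = H ->
  (forall v : 'rV_p, v != 0 -> 0 < -1 * qform H (v *m M)) ->
  (forall v : 'rV_q, v != 0 -> 0 < 1 * qform H (v *m N)) ->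
  H \in unitmx /\ max_negative_dim H p.
Proof.
move=> pqk Hs HM HN.
have rM : \rank M = p by apply/eqP; exact: definite_row_free HM.
have rN : \rank N = q by apply/eqP; exact: definite_row_free HN.
have negM v : (v <= M)%MS -> v != 0 -> qform H v < 0.
  move=> /submxP[w ->] wM; rewrite -oppr_gt0 -mulN1r; apply: HM.
  by apply: contraNneq wM => ->; rewrite mul0mx.
have posN v : (v <= N)%MS -> v != 0 -> 0 < qform H v.
  move=> /submxP[w ->] wN; rewrite -[qform _ _]mul1r; apply: HN.
  by apply: contraNneq wN => ->; rewrite mul0mx.
have capN m (V : 'M[R]_(m, k)) : (forall v, (v <= V)%MS -> v != 0 -> qform H v < 0) -> (V :&: N)%MS = 0.
  move=> nV; apply/eqP; rewrite -submx0; apply/rV_subP => v; rewrite sub_capmx => /andP[vV vN].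
  have [->|v0] := eqVneq v 0; first exact: sub0mx.
  by have := lt_trans (nV v vV v0) (posN v vN v0); rewrite ltxx.
split; last split.
- rewrite -row_free_unit; apply/inj_row_free => v vH.
  have full : (1%:M <= M + N)%MS.
    rewrite sub1mx /row_full.
    have := mxrank_sum_cap M N; rewrite (capN _ M negM) mxrank0 addn0 rM rN pqk => ->.
    exact: eqxx.
  have /sub_addsmxP[[a b] /= E] := submx_trans (submx1 v) full.
  set x := a *m M in E; set y := b *m N in E.
  have xM : (x <= M)%MS by exact: submxMl.
  have yN : (y <= N)%MS by exact: submxMl.
  clearbody x y.
  (* For [v = x + y] in the kernel, pairing with [x] and with [y] and using the symmetry of [H]
     gives [qform H x = qform H y], a number both nonpositive and nonnegative. *)
  have S : (y *m H *m x^T) 0 0 = (x *m H *m y^T) 0 0.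
    have -> : y *m H *m x^T = (x *m H *m y^T)^T by rewrite !trmx_mul trmxK Hs mulmxA.
    by rewrite mxE.
  have Ex : qform H x + (y *m H *m x^T) 0 0 = 0.
    have e : x *m H *m x^T + y *m H *m x^T = 0 by rewrite -!mulmxDl -E vH mul0mx.
    by apply: (etrans (y := (x *m H *m x^T + y *m H *m x^T) 0 0)); [rewrite [RHS]mxE|rewrite e mxE].
  have Ey : (x *m H *m y^T) 0 0 + qform H y = 0.
    have e : x *m H *m y^T + y *m H *m y^T = 0 by rewrite -!mulmxDl -E vH mul0mx.
    by apply: (etrans (y := (x *m H *m y^T + y *m H *m y^T) 0 0)); [rewrite [RHS]mxE|rewrite e mxE].
  have qq : qform H x = qform H y by move: Ex Ey; rewrite S; lra.
  have x0 : x = 0.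
    apply/eqP; apply: contraT => x0; have := negM x xM x0; rewrite qq.
    have [->|y0] := eqVneq y 0; first by rewrite qform0 ltxx.
    by move/(lt_trans (posN y yN y0)); rewrite ltxx.
  have y0 : y = 0.
    apply/eqP; apply: contraT => y0; have := posN y yN y0.
    by rewrite -qq x0 qform0 ltxx.
  by rewrite E x0 y0 addr0.
- exists (genmx M); first by rewrite mxrank_gen.
  by move=> v; rewrite genmxE; exact: negM.
- move=> V nV.
  have := mxrank_sum_cap V N; rewrite (capN _ V nV) mxrank0 addn0 rN => E.
  by rewrite -(leq_add2r q) pqk -E rank_leq_col.
Qed.

End Index.

(** * Cycles of signed edges *)

Section Cycle.
Context {R : realType}.
Variable c : R.

Definition sgb (b : bool) : R := if b then 1 else -1.

Definition edgeform (b : bool) (x y : R) : R := sgb b * (x * y - c / 2 * (x ^+ 2 + y ^+ 2)).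

Fixpoint pathform (s : seq bool) (h : nat -> R) : R :=
  if s is b :: s' then edgeform b (h 0%N) (h 1%N) + pathform s' (fun j => h j.+1) else 0.

Lemma eq_pathform s h h' : (forall j, (j <= size s)%N -> h j = h' j) -> pathform s h = pathform s h'.
Proof.
elim: s h h' => [//|b s IH] h h' H /=; rewrite !H //; congr (_ + _).
by apply: IH => j js; exact: H.
Qed.

Lemma pathform_rcons s b h :
  pathform (rcons s b) h = pathform s h + edgeform b (h (size s)) (h (size s).+1).
Proof. by elim: s h => [|b' s IH] h /=; [rewrite add0r addr0|rewrite IH addrA]. Qed.

Lemma pathform0 s : pathform s (fun=> 0) = 0.
Proof. by elim: s => [//|b s IH] /=; rewrite IH /edgeform expr0n /=; ring. Qed.

Lemma pathformE s h : pathform s h = \sum_(i < size s) edgeform (nth true s i) (h i) (h i.+1).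
Proof. by elim: s h => [|b s IH] h /=; [rewrite big_ord0|rewrite big_ord_recl /= IH]. Qed.

(* A height function on a cycle is encoded as a function on nat with the same values at 0 and at the length of the
   cycle. *)
Definition definite_dim (sigma : R) (s : seq bool) (p : nat) : Prop :=
  exists L : 'rV[R]_p -> nat -> R,
    [/\ forall a u v j, L (a *: u + v) j = a * L u j + L v j,
        forall v, L v (size s) = L v 0%N
      & forall v, v != 0 -> 0 < sigma * pathform s (L v)].

Lemma definite_dim_rot1 sigma s p : definite_dim sigma s p -> definite_dim sigma (rot 1 s) p.
Proof.
case: s => [//|b s] [L [Ll Lc Lp]]; rewrite rot1_cons.
(* The last vertex of the rotated cycle, of index [(size s).+1], is again its vertex 0, that is, the
   old vertex 1. *)
exists (fun v j => if (j <= size s)%N then L v j.+1 else L v 1%N); split.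
- by move=> a u v j; case: ifP.
- by move=> v; rewrite size_rcons ltnn leq0n.
move=> v v0; have := Lp v v0; rewrite /= pathform_rcons leqnn ltnn.
rewrite -[L v (size s).+1]/(L v (size (b :: s))) Lc addrC.
rewrite (_ : pathform s (fun j => L v j.+1) = pathform s (fun j => if (j <= size s)%N then L v j.+1 else L v 1%N)) //.
by apply: eq_pathform => j ->.
Qed.

Lemma definite_dim_rot sigma s p i : definite_dim sigma s p -> definite_dim sigma (rot i s) p.
Proof.
move=> H; have [le|lt] := leqP i (size s); last by rewrite rot_oversize // ltnW.
elim: i le => [_|i IH le]; first by rewrite rot0.
rewrite -add1n rotD ?add1n //; apply: definite_dim_rot1; apply: IH; exact: ltnW.
Qed.

(* Two consecutive opposite edges split off a hyperbolic plane. *)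
Lemma definite_dim_cancel sigma s p b : sigma ^+ 2 = 1 -> (0 < size s)%N ->
  definite_dim sigma s p -> definite_dim sigma (b :: ~~ b :: s) (1 + p).
Proof.
case: s => [//|e s] sig1 _ [L [Ll Lc Lp]].
pose X (w : 'rV[R]_(1 + p)) := lsubmx w 0 0.
pose V (w : 'rV[R]_(1 + p)) := rsubmx w.
have Xl a u v : X (a *: u + v) = a * X u + X v by rewrite /X !mxE.
have Vl a u v : V (a *: u + v) = a *: V u + V v by apply/matrixP => i j; rewrite /V !mxE.
have sb2 b' : sgb b' * sgb b' = 1 by case: b'; rewrite /sgb; ring.
(* The two new edges contribute [X] times an expression linear in the height [Y] between them, and
   raising the start of edge [e] by [X] contributes a further multiple of [X]. [Y] is chosen so that
   the two factors add up to [sigma * X]. *)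
pose Y w := c * L (V w) 0%N + c / 2 * X w +
  sgb b * (sgb e * (L (V w) 1%N - c * L (V w) 0%N - c / 2 * X w) - sigma * X w).
(* The old vertex 0 is split: index 0 keeps its height, to which the end of the cycle returns, and
   index 2, where edge [e] now starts, is raised by [X]. *)
exists (fun w j => match j with 0 => L (V w) 0%N | 1 => Y w | 2 => L (V w) 0%N + X w | j'.+2 => L (V w) j' end).
split.
- by move=> a u v [|[|[|j]]]; rewrite /Y ?Vl ?Xl ?Ll //; ring.
- by move=> w /=; rewrite -[RHS]Lc.
move=> w w0 /=.
have E : edgeform b (L (V w) 0%N) (Y w) +
  (edgeform (~~ b) (Y w) (L (V w) 0%N + X w) +
   (edgeform e (L (V w) 0%N + X w) (L (V w) 1%N) + pathform s (fun j => L (V w) j.+1)))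
  = pathform (e :: s) (L (V w)) + sigma * X w ^+ 2.
  have sn : sgb (~~ b) = - sgb b by case: (b); rewrite /sgb /= ?opprK.
  rewrite /= /edgeform sn /Y.
  move: (L (V w) 0%N) (L (V w) 1%N) (X w) (pathform _ _) (sgb e) (sgb b) (sb2 b) => h0 h1 x P se sb sb1.
  have -> : sigma * x ^+ 2 = (sb * sb) * (sigma * x ^+ 2) by rewrite sb1 mul1r.
  have sb1' : sb ^+ 2 = 1 by rewrite expr2.
  by field: sb1 sb1'.
rewrite E mulrDr mulrA -expr2 sig1 mul1r.
have [V0|V0] := eqVneq (V w) 0; last by rewrite ltr_wpDr ?sqr_ge0 //; exact: Lp.
have L0 j : L (V w) j = 0.
  have := Ll 0 0 0 j; rewrite scaler0 addr0 mul0r add0r V0 => H.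
  by have := Ll (-1) 0 0 j; rewrite scaler0 addr0 mulN1r addNr.
rewrite (eq_pathform (h' := fun=> 0)) // pathform0 mulr0 add0r.
rewrite exprn_even_gt0 //=; apply: contraNneq w0 => X0.
rewrite -[w]hsubmxK -/(V w) V0.
have -> : lsubmx w = 0 by apply/matrixP => i j; rewrite !ord1 [RHS]mxE.
by rewrite row_mx0.
Qed.

(** A word that starts with [b] and contains [~~ b] changes letter somewhere; a rotation brings that
    place to the front. *)
Lemma opposite_neighbours (s : seq bool) : true \in s -> false \in s ->
  exists i b s', rot i s = b :: ~~ b :: s'.
Proof.
have H (t : seq bool) b : ~~ b \in t -> exists s1 s2 d, b :: t = s1 ++ d :: ~~ d :: s2.
  elim: t b => [//|d t IH] b; rewrite inE; have [<-|nd] := eqVneq (~~ b) d.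
    by move=> _; exists [::], t, b.
  have -> /= : d = b by move: nd; case: (b); case: (d).
  by move=> /IH[s1 [s2 [e ->]]]; exists (b :: s1), s2, e.
case: s => [//|b s] t1 f1.
have [s1 [s2 [d E]]] : exists s1 s2 d, b :: s = s1 ++ d :: ~~ d :: s2.
  by apply: H; case: b t1 f1; rewrite !inE.
by exists (size s1), d, (s2 ++ s1); rewrite E rot_size_cat.
Qed.

Lemma definite_dim_count sigma a p b s : sigma ^+ 2 = 1 -> (0 < a)%N ->
  definite_dim sigma (nseq a true) p ->
  count_mem true s = (a + b)%N -> count_mem false s = b -> definite_dim sigma s (b + p).
Proof.
move=> sig1 a0 Hp; elim: b s => [|b IH] s ct cf.
  suff -> : s = nseq a true by [].
  elim: s a {a0 Hp} ct cf => [|[] s IH] a /=; rewrite ?addn0 ?add0n.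
  - by move=> <-.
  - by move=> <- H; rewrite {1}(IH _ (esym (addn0 _)) H).
  - by [].
have mt : true \in s by rewrite -has_pred1 has_count ct addnS.
have mf : false \in s by rewrite -has_pred1 has_count cf.
have [i [d [s' E]]] := opposite_neighbours mt mf.
have C x : count_mem x s = (1 + count_mem x s')%N.
  have /permP/(_ (pred1 x)) : perm_eq (rot i s) s by rewrite perm_rot.
  by rewrite E => <- /=; case: d {E}; case: x.
have {}IH : definite_dim sigma s' (b + p).
  by apply: IH; [move: ct; rewrite C addnS => -[]|move: cf; rewrite C => -[]].
have : definite_dim sigma (rot i s) (b.+1 + p).
  rewrite E addSn -add1n; apply: definite_dim_cancel => //.
  have := C true; rewrite ct addnS add1n => -[E'].
  by apply: leq_trans (count_size (pred1 true) s'); rewrite -E' addn_gt0 a0.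
by move=> /(definite_dim_rot (size (rot i s) - i)); rewrite -/(rotr i (rot i s)) rotK.
Qed.

End Cycle.

(** * Discrete Hartley transform *)

Section Hartley.
Context {R : realType}.

(** The Hartley kernel, a real substitute for the characters of the cyclic group: one eigenfunction
    of the shift form for each frequency, without pairing cosines with sines. *)
Definition cas (x : R) : R := cos x + sin x.

Lemma casM x y : cas x * cas y = cos (x - y) + sin (x + y).
Proof. by rewrite /cas cosB sinD; ring. Qed.

Lemma cas_shift x y : cas (x + y) + cas (x - y) = 2 * cos y * cas x.
Proof. by rewrite /cas cosD cosB sinD sinB; ring. Qed.

Lemma cos_nat2pi (m : nat) : cos (2 * pi * m%:R : R) = 1 /\ sin (2 * pi * m%:R : R) = 0.
Proof.
have -> : 2 * pi * m%:R = 0 + (pi *+ 2) *+ m :> R.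
  by rewrite add0r -[pi *+ 2]mulr_natl -[RHS]mulr_natr.
by rewrite (periodicn (@cosD2pi R)) (periodicn (@sinD2pi R)) cos0 sin0.
Qed.

Lemma cos_neq1 (x : R) : 0 < x < 2 * pi -> cos x != 1.
Proof.
move=> /andP[x0 x1]; apply/eqP => c1.
have h : 0 < sin (x / 2) by apply: sin_gt0_pi; apply/andP; split; lra.
have xE : x = (x / 2) *+ 2 by rewrite -mulr_natl; field.
have := c1; rewrite xE cos_mulr2n cos2sin2 -mulr_natl => c2.
have := exprn_gt0 2 h; lra.
Qed.

Lemma sum_shift (n : nat) (f : nat -> R) : f n = f 0%N -> \sum_(j < n) f j.+1 = \sum_(j < n) f j.
Proof.
by case: n => [|n] fn; [rewrite !big_ord0|rewrite big_ord_recr [RHS]big_ord_recl /= fn addrC].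
Qed.

(** Shifting the index by one permutes the cycle, so the vector formed by the two sums is fixed by
    the rotation through [y]: it vanishes unless that rotation is the identity, and then every sine
    is 0. *)
Lemma trig_sums (n M : nat) : (0 < n)%N -> let y : R := 2 * pi * M%:R / n%:R in
  (\sum_(j < n) sin (y * j%:R) = 0) /\ (cos y != 1 -> \sum_(j < n) cos (y * j%:R) = 0).
Proof.
move=> n0 y; have nn : n%:R != 0 :> R by rewrite pnatr_eq0 -lt0n.
have yn : y * n%:R = 2 * pi * M%:R by rewrite /y divfK.
have [cn sn] := cos_nat2pi M.
pose C := \sum_(j < n) cos (y * j%:R); pose S := \sum_(j < n) sin (y * j%:R).
have yS j : y * j.+1%:R = y * j%:R + y by rewrite -addn1 natrD mulrDr mulr1.
have EC : cos y * C - sin y * S = C.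
  rewrite -[RHS](@sum_shift n (fun j => cos (y * j%:R))) ?yn ?cn ?mulr0 ?cos0 //.
  rewrite !mulr_sumr -sumrB; apply: eq_bigr => j _; rewrite yS cosD; ring.
have ES : sin y * C + cos y * S = S.
  rewrite -[RHS](@sum_shift n (fun j => sin (y * j%:R))) ?yn ?sn ?mulr0 ?sin0 //.
  rewrite !mulr_sumr -big_split; apply: eq_bigr => j _; rewrite yS sinD /=; ring.
have cs := cos2Dsin2 y.
rewrite -/S -/C; have [c1|c1] := eqVneq (cos y) 1; last first.
  have k x : 2 * (1 - cos y) * x = 0 -> x = 0.
    move=> /eqP; rewrite mulf_eq0 => /orP[|/eqP //].
    by rewrite mulf_eq0 pnatr_eq0 /= subr_eq0 eq_sym (negbTE c1).
  by split=> [|_]; apply: k; nra.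
have s0 : sin y = 0 by apply/eqP; rewrite -sqrf_eq0; apply/eqP; move: cs; rewrite c1; lra.
split=> //; rewrite /S big1 // => j _; elim: (val j) => [|i IH]; first by rewrite mulr0 sin0.
by rewrite yS sinD s0 IH mul0r mulr0 addr0.
Qed.

(* Discrete Hartley transform: the functions cas(2 pi m j / n) diagonalise the cyclic shift form. *)
Lemma hartley_definite (n p m0 : nat) (sigma c : R) : (0 < n)%N -> (p <= n)%N ->
  (forall l : 'I_p, 0 < sigma * (cos (2 * pi * (l + m0)%:R / n%:R) - c)) ->
  definite_dim c sigma (nseq n true) p.
Proof.
move=> n0 pn pos; have nn : n%:R != 0 :> R by rewrite pnatr_eq0 -lt0n.
pose th (l : 'I_p) : R := 2 * pi * (l + m0)%:R / n%:R.
have thn l : th l * n%:R = 2 * pi * (l + m0)%:R by rewrite /th divfK.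
pose H (v : 'rV[R]_p) (x : R) := \sum_l v 0 l * cas (th l * x).
have casn l x : cas (th l * (x + n%:R)) = cas (th l * x).
  have [c1 s0] := cos_nat2pi (l + m0).
  by rewrite /cas mulrDr thn cosD sinD c1 s0; ring.
have Hn v x : H v (x + n%:R) = H v x by apply: eq_bigr => l _; rewrite casn.
have Hs v x : H v (x + 1) + H v (x - 1) = \sum_l v 0 l * (2 * cos (th l) * cas (th l * x)).
  by rewrite /H -big_split; apply: eq_bigr => l _ /=; rewrite -mulrDr -cas_shift; congr (_ * (cas _ + cas _)); ring.
have orth (l l' : 'I_p) : \sum_(j < n) cas (th l * j%:R) * cas (th l' * j%:R) = if l == l' then n%:R else 0.
  under eq_bigr do rewrite casM -mulrBl -mulrDl.
  rewrite big_split /=.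
  have -> : th l + th l' = 2 * pi * (l + m0 + (l' + m0))%:R / n%:R.
    by rewrite /th natrD; generalize (pi : R) => P; field.
  have [-> _] := trig_sums (l + m0 + (l' + m0)) n0; rewrite addr0.
  have [->|ne] := eqVneq l l'.
    by under eq_bigr do rewrite subrr mul0r cos0; rewrite sumr_const card_ord.
  wlog lt : l l' ne / (l' < l)%N.
    move=> W; have [lt|lt|eq] := ltngtP l l'; last by case/eqP: ne; apply: val_inj.
      by rewrite -[RHS](W l' l) 1?eq_sym //; apply: eq_bigr => j _; rewrite -cosN -mulNr opprB.
    exact: W.
  have -> : th l - th l' = 2 * pi * (l - l')%:R / n%:R.
    by rewrite /th natrB ?(ltnW lt) // !natrD; generalize (pi : R) => P; field.
  (* Indices below [p <= n] differ by less than [n], so the angle lies strictly between 0 and a full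
     turn. *)
  apply: (trig_sums (l - l') n0).2; apply: cos_neq1.
  have nR : 0 < n%:R :> R by rewrite ltr0n.
  have p2 : 0 < 2 * pi :> R by rewrite mulr_gt0 ?pi_gt0.
  have lt0 : 0 < (l - l')%:R :> R by rewrite ltr0n subn_gt0.
  apply/andP; split; first by apply: divr_gt0 => //; exact: mulr_gt0.
  rewrite ltr_pdivrMr // ltr_pM2l // ltr_nat.
  by apply: leq_ltn_trans (leq_subr _ _) _; exact: leq_trans (ltn_ord l) pn.
exists (fun v j => H v j%:R); split.
- move=> a u v j; rewrite /H mulr_sumr -big_split; apply: eq_bigr => l _ /=.
  by rewrite !mxE mulrDl mulrA.
- by move=> v; rewrite size_nseq -[RHS]Hn add0r.
move=> v v0.
have Q : pathform c (nseq n true) (fun j => H v j%:R) = n%:R * \sum_l (cos (th l) - c) * v 0 l ^+ 2.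
  rewrite pathformE size_nseq.
  have jS (j : nat) : j.+1%:R = j%:R + 1 :> R by rewrite -addn1 natrD.
  have P0 : H v n%:R = H v 0%:R by rewrite -(Hn v 0%:R) add0r.
  (* Summation by parts on the cycle: the form becomes the pairing of [H] with its symmetrised shift
     minus [c] times [H], and each [cas] is an eigenfunction of the symmetrised shift. *)
  transitivity (\sum_(j < n) H v j%:R * (2^-1 * (H v (j%:R + 1) + H v (j%:R - 1)) - c * H v j%:R)).
    have A1 : \sum_(j < n) H v j%:R * H v (j%:R + 1) = \sum_(j < n) H v j%:R * H v (j%:R - 1).
      have := @sum_shift n (fun j => H v j%:R * H v (j%:R - 1)).
      rewrite P0 -[H v (n%:R - 1)]/(H v (n%:R - 1)) addrC Hn add0r => /(_ erefl) <-.
      by apply: eq_bigr => j _; rewrite jS addrK mulrC.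
    have A2 : \sum_(j < n) H v (j%:R + 1) ^+ 2 = \sum_(j < n) H v j%:R ^+ 2.
      rewrite -[RHS](@sum_shift n (fun j => H v j%:R ^+ 2)) ?P0 //.
      by apply: eq_bigr => j _; rewrite jS.
    transitivity (\sum_(j < n) H v j%:R * H v (j%:R + 1) - c / 2 * (\sum_(j < n) H v j%:R ^+ 2 + \sum_(j < n) H v (j%:R + 1) ^+ 2)).
      rewrite -big_split mulr_sumr -sumrB; apply: eq_bigr => j _.
      by rewrite nth_nseq ltn_ord /edgeform /sgb jS mul1r.
    rewrite A2.
    transitivity (2^-1 * (\sum_(j < n) H v j%:R * H v (j%:R + 1) + \sum_(j < n) H v j%:R * H v (j%:R - 1)) - c * \sum_(j < n) H v j%:R ^+ 2).
      by rewrite -A1; field.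
    by rewrite -big_split !mulr_sumr -sumrB; apply: eq_bigr => j _ /=; ring.
  transitivity (\sum_(j < n) \sum_l \sum_l' v 0 l * v 0 l' * (cos (th l') - c) * (cas (th l * j%:R) * cas (th l' * j%:R))).
    apply: eq_bigr => j _; rewrite Hs.
    have -> : 2^-1 * (\sum_l v 0 l * (2 * cos (th l) * cas (th l * j%:R))) - c * H v j%:R =
      \sum_l v 0 l * (cos (th l) - c) * cas (th l * j%:R).
      by rewrite /H !mulr_sumr -sumrB; apply: eq_bigr => l _; field.
    rewrite /H mulr_suml; apply: eq_bigr => l _; rewrite mulr_sumr; apply: eq_bigr => l' _; ring.
  rewrite exchange_big /= mulr_sumr; apply: eq_bigr => l _.
  rewrite exchange_big /= (bigD1 l) //= [X in _ + X]big1 ?addr0 => [|l' ne].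
    by rewrite -mulr_sumr orth eqxx; ring.
  by rewrite -mulr_sumr orth eq_sym (negbTE ne) mulr0.
rewrite Q mulrCA mulr_gt0 ?ltr0n // mulr_sumr.
have [l vl] : exists l, v 0 l != 0.
  apply/existsP; apply: contraNT v0; rewrite negb_exists => /forallP H0.
  by apply/eqP/rowP => l; rewrite mxE; apply/eqP; have := H0 l; rewrite negbK.
rewrite (bigD1 l) //= ltr_pwDl //.
  by rewrite mulrA mulr_gt0 ?exprn_even_gt0 //; exact: pos.
by apply: sumr_ge0 => l' _; rewrite mulrA mulr_ge0 ?sqr_ge0 // ltW //; exact: pos.
Qed.

Lemma ltr_cos_pi (x y : R) : 0 <= x -> x < y -> y <= pi -> cos y < cos x.
Proof. by move=> x0 xy yp; rewrite ltr_cos // in_itv /=; apply/andP; split; lra. Qed.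

(** Modulo [n], the eigenvalue is positive at the [2 t - 1] frequencies with [|k| < t] and negative
    at the [n - 1 - 2 t] ones with [t < k < n - t]; the two left out, [t] and [n - t], span the
    kernel. *)
Lemma definite_dim_forward (n t : nat) : (0 < t)%N -> (2 * t < n)%N ->
  let c : R := cos (2 * pi * t%:R / n%:R) in
  definite_dim c 1 (nseq n true) (2 * t - 1) /\ definite_dim c (-1) (nseq n true) (n - 1 - 2 * t).
Proof.
move=> t0 tn c; have n0 : (0 < n)%N by lia.
have nR : 0 < n%:R :> R by rewrite ltr0n.
have p0 := pi_gt0 R.
have le_ang (a b : R) : a < b -> 2 * pi * a / n%:R < 2 * pi * b / n%:R.
  by move=> ab; rewrite ltr_pM2r ?invr_gt0 // ltr_pM2l // mulr_gt0.
have ang_pi (a : R) : 2 * a <= n%:R -> 2 * pi * a / n%:R <= pi.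
  by move=> ab; rewrite ler_pdivrMr // -mulrA mulrCA ler_pM2l.
have ang0 (a : R) : 0 <= a -> 0 <= 2 * pi * a / n%:R.
  by move=> a0; rewrite divr_ge0 ?mulr_ge0 // ltW.
have t2 : 2 * t%:R <= n%:R :> R by rewrite -natrM ler_nat ltnW.
split.
(* The window from [n - t + 1] to [n + t - 1] is [|k| < t] shifted by [n] to stay among the natural
   numbers; [d] undoes the shift. *)
- apply: (@hartley_definite n _ (n - t + 1)) => //; first by lia.
  move=> l; rewrite mul1r subr_gt0.
  have ll := ltn_ord l.
  pose d : R := l%:R + 1 - t%:R.
  have -> : 2 * pi * (l + (n - t + 1))%:R / n%:R = 2 * pi * d / n%:R + pi *+ 2.
    have -> : (l + (n - t + 1))%:R = d + n%:R :> R by rewrite !natrD natrB ?/d //; [ring|lia].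
    by rewrite -[pi *+ 2]mulr_natl; generalize (pi : R) => P; field; rewrite gt_eqF.
  rewrite cosD2pi -cos_norm.
  have dt : `|d| < t%:R.
    have l1 : l%:R + 1 < 2 * t%:R :> R by rewrite -natrM natr1 ltr_nat; lia.
    have l2 : 0 <= l%:R :> R by rewrite ler0n.
    by rewrite ltr_norml /d; apply/andP; split; lra.
  rewrite -[`|_|](_ : 2 * pi * `|d| / n%:R = _).
    by apply: ltr_cos_pi; [exact: ang0|exact: le_ang|exact: ang_pi].
  by rewrite !normrM normfV (gtr0_norm p0) (gtr0_norm nR) normr_nat.
- apply: (@hartley_definite n _ (t + 1)) => //; first by lia.
  move=> l; rewrite mulN1r opprB subr_gt0.
  have ll := ltn_ord l.
  set m := (l + (t + 1))%N.
  have mt : t%:R < m%:R :> R by rewrite ltr_nat /m; lia.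
  have mn : m%:R < n%:R - t%:R :> R by rewrite -natrB ?ltr_nat /m; lia.
  have tR : 0 <= t%:R :> R by rewrite ler0n.
  have [mp|mp] := lerP (2 * m%:R) (n%:R : R).
    by apply: ltr_cos_pi; [exact: ang0|exact: le_ang|exact: ang_pi].
  (* Angles past the half turn are reflected, replacing [m] by [n - m], into the interval where the
     cosine decreases. *)
  have -> : cos (2 * pi * m%:R / n%:R : R) = cos (2 * pi * (n%:R - m%:R) / n%:R).
    rewrite -[RHS]cosN -[RHS]cosD2pi; congr cos.
    by rewrite -[pi *+ 2]mulr_natl; generalize (pi : R) => P; field; rewrite gt_eqF.
  by apply: ltr_cos_pi; [exact: ang0|apply: le_ang; lra|apply: ang_pi; lra].
Qed.

End Hartley.

(** * Configurations and the charts of X_n *)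

Section Vectors.
Context {R : realType}.
Implicit Types (u v w : 'rV[R]_3) (A B : 'M[R]_3).

Definition o0 : 'I_3 := @Ordinal 3 0 isT.
Definition o1 : 'I_3 := @Ordinal 3 1 isT.
Definition o2 : 'I_3 := @Ordinal 3 2 isT.

Lemma ordS0 : ordS o0 = o1. Proof. exact: val_inj. Qed.
Lemma ordS1 : ordS o1 = o2. Proof. exact: val_inj. Qed.
Lemma ordS2 : ordS o2 = o0. Proof. exact: val_inj. Qed.

Lemma ord3P (P : 'I_3 -> Prop) : P o0 -> P o1 -> P o2 -> forall i, P i.
Proof.
move=> H0 H1 H2 [[|[|[|//]]] Hi].
- by rewrite (_ : Ordinal Hi = o0) //; exact: val_inj.
- by rewrite (_ : Ordinal Hi = o1) //; exact: val_inj.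
- by rewrite (_ : Ordinal Hi = o2) //; exact: val_inj.
Qed.

Lemma sum3 (V : zmodType) (F : 'I_3 -> V) : \sum_i F i = F o0 + F o1 + F o2.
Proof.
rewrite !big_ord_recl big_ord0 addr0 addrA.
by congr (F _ + F _ + F _); apply: val_inj.
Qed.

Lemma row3P u v : u 0 o0 = v 0 o0 -> u 0 o1 = v 0 o1 -> u 0 o2 = v 0 o2 -> u = v.
Proof. by move=> *; apply/rowP; apply: ord3P. Qed.

Lemma dotE u v : dot u v = u 0 o0 * v 0 o0 + u 0 o1 * v 0 o1 + u 0 o2 * v 0 o2.
Proof. by rewrite /dot mxE sum3 !mxE. Qed.

Definition v3E := (dotE, mxE, ordS0, ordS1, ordS2).

Lemma dotC u v : dot u v = dot v u. Proof. by rewrite !v3E; ring. Qed.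
Lemma dotDl u v w : dot (u + v) w = dot u w + dot v w. Proof. by rewrite !v3E; ring. Qed.
Lemma dotDr u v w : dot u (v + w) = dot u v + dot u w. Proof. by rewrite !v3E; ring. Qed.
Lemma dotZl a u v : dot (a *: u) v = a * dot u v. Proof. by rewrite !v3E; ring. Qed.
Lemma dotZr a u v : dot u (a *: v) = a * dot u v. Proof. by rewrite !v3E; ring. Qed.
Lemma dotNr u v : dot u (- v) = - dot u v. Proof. by rewrite !v3E; ring. Qed.
Lemma dotNl u v : dot (- u) v = - dot u v. Proof. by rewrite !v3E; ring. Qed.
Lemma dot0l u : dot 0 u = 0. Proof. by rewrite !v3E; ring. Qed.
Lemma crossDr u v w : cross u (v + w) = cross u v + cross u w.
Proof. by apply: row3P; rewrite !v3E; ring. Qed.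
Lemma crossZr a u v : cross u (a *: v) = a *: cross u v.
Proof. by apply: row3P; rewrite !v3E; ring. Qed.
Lemma crossZl a u v : cross (a *: u) v = a *: cross u v.
Proof. by apply: row3P; rewrite !v3E; ring. Qed.
Lemma crossuu u : cross u u = 0.
Proof. by apply: row3P; rewrite !v3E; ring. Qed.
Lemma cross0r u : cross u 0 = 0.
Proof. by apply: row3P; rewrite !v3E; ring. Qed.
Lemma crossC u v : cross u v = - cross v u.
Proof. by apply: row3P; rewrite !v3E; ring. Qed.
Lemma dot_crossl u v : dot (cross u v) u = 0. Proof. by rewrite !v3E; ring. Qed.
Lemma dot_crossr u v : dot (cross u v) v = 0. Proof. by rewrite !v3E; ring. Qed.
Lemma cross_cross u v w : cross u (cross v w) = dot u w *: v - dot u v *: w.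
Proof. by apply: row3P; rewrite !v3E; ring. Qed.
Lemma dot_cross_cross u v : dot (cross u v) (cross u v) = dot u u * dot v v - dot u v ^+ 2.
Proof. by rewrite !v3E; ring. Qed.

Lemma dot_ge0 u : 0 <= dot u u.
Proof. by rewrite dotE -!expr2 !addr_ge0 ?sqr_ge0. Qed.

Lemma dot_eq0 u : dot u u = 0 -> u = 0.
Proof.
rewrite dotE -!expr2 => H; have := sqr_ge0 (u 0 o0); have := sqr_ge0 (u 0 o1); have := sqr_ge0 (u 0 o2).
move=> h2 h1 h0; apply: row3P; rewrite mxE; apply/eqP; rewrite -sqrf_eq0; apply/eqP; lra.
Qed.

Lemma dot_ext u v : (forall w, dot u w = dot v w) -> u = v.
Proof.
move=> H; apply/eqP; rewrite -subr_eq0; apply/eqP/dot_eq0.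
by rewrite dotDl dotNl H subrr.
Qed.

Definition mx3 u v w : 'M[R]_3 :=
  \matrix_(i < 3) (if i == o0 then u else if i == o1 then v else w).

Lemma row_mx3 u v w : [/\ row o0 (mx3 u v w) = u, row o1 (mx3 u v w) = v & row o2 (mx3 u v w) = w].
Proof. by split; rewrite rowK. Qed.

Lemma mul_trE u A i : (u *m A^T) 0 i = dot u (row i A).
Proof. by rewrite /dot !mxE; apply: eq_bigr => j _; rewrite !mxE. Qed.

Lemma det_rows A : \det A = dot (cross (row o0 A) (row o1 A)) (row o2 A).
Proof.
rewrite (expand_det_row _ o0) sum3 /cofactor !(expand_det_row _ (0 : 'I_2)) !big_ord_recl !big_ord0 /cofactor !det_mx11 !v3E /=.
have l00 : lift o0 (0 : 'I_2) = o1 by exact: val_inj.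
have l01 : lift o0 (lift (0 : 'I_2) (0 : 'I_1)) = o2 by exact: val_inj.
have l10 : lift o1 (0 : 'I_2) = o0 by exact: val_inj.
have l11 : lift o1 (lift (0 : 'I_2) (0 : 'I_1)) = o2 by exact: val_inj.
have l20 : lift o2 (0 : 'I_2) = o0 by exact: val_inj.
have l21 : lift o2 (lift (0 : 'I_2) (0 : 'I_1)) = o1 by exact: val_inj.
have m0 : lift (lift (0 : 'I_2) (0 : 'I_1)) (0 : 'I_1) = (0 : 'I_2) by exact: val_inj.
rewrite ?m0 ?l00 ?l01 ?l10 ?l11 ?l20 ?l21 /bump /= ?expr0 ?expr1.
ring.
Qed.

Lemma SO3_tr A : SO3 A -> A^T *m A = 1%:M.
Proof. by move=> [H _]; exact: mulmx1C. Qed.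

Lemma SO3_1 : SO3 (1%:M : 'M[R]_3).
Proof. by split; rewrite ?trmx1 ?mulmx1 ?det1. Qed.

Lemma SO3_M A B : SO3 A -> SO3 B -> SO3 (A *m B).
Proof.
move=> [a1 a2] [b1 b2]; split; last by rewrite det_mulmx a2 b2 mulr1.
by rewrite trmx_mul mulmxA -(mulmxA A) b1 mulmx1.
Qed.

Lemma SO3_T A : SO3 A -> SO3 A^T.
Proof. by move=> H; split; [rewrite trmxK; exact: SO3_tr|rewrite det_tr; case: H]. Qed.

Lemma dot_SO3 A u v : SO3 A -> dot (u *m A^T) (v *m A^T) = dot u v.
Proof. by move=> H; rewrite /dot trmx_mul trmxK mulmxA -(mulmxA u) SO3_tr // mulmx1. Qed.

Lemma mx3_mul u v w A : mx3 u v w *m A = mx3 (u *m A) (v *m A) (w *m A).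
Proof.
apply/row_matrixP; apply: ord3P; rewrite row_mul.
- by case: (row_mx3 u v w) => -> _ _; case: (row_mx3 (u *m A) (v *m A) (w *m A)).
- by case: (row_mx3 u v w) => _ -> _; case: (row_mx3 (u *m A) (v *m A) (w *m A)).
- by case: (row_mx3 u v w) => _ _ ->; case: (row_mx3 (u *m A) (v *m A) (w *m A)).
Qed.

Lemma det_mx3 u v w : \det (mx3 u v w) = dot (cross u v) w.
Proof. by rewrite det_rows; case: (row_mx3 u v w) => -> -> ->. Qed.

Lemma triple_SO3 A u v w : SO3 A -> dot (cross (u *m A^T) (v *m A^T)) (w *m A^T) = dot (cross u v) w.
Proof. by move=> [_ dA]; rewrite -!det_mx3 -mx3_mul det_mulmx det_tr dA mulr1. Qed.

(** Tested against all vectors, the identity becomes the invariance of the triple product, a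
    determinant, under matrices of determinant 1. *)
Lemma cross_SO3 A u v : SO3 A -> cross (u *m A^T) (v *m A^T) = cross u v *m A^T.
Proof.
move=> SA; apply: dot_ext => w.
have -> : w = (w *m A) *m A^T by rewrite -mulmxA; case: SA => -> _; rewrite mulmx1.
by rewrite triple_SO3 // dot_SO3.
Qed.

Lemma SO3_mx3 u v w : dot u u = 1 -> dot v v = 1 -> dot w w = 1 ->
  dot u v = 0 -> dot u w = 0 -> dot v w = 0 -> dot (cross u v) w = 1 -> SO3 (mx3 u v w).
Proof.
move=> uu vv ww uv uw vw d; split; last by rewrite det_mx3.
have [r0 r1 r2] := row_mx3 u v w.
apply/matrixP => i j.
have -> : (mx3 u v w *m (mx3 u v w)^T) i j = dot (row i (mx3 u v w)) (row j (mx3 u v w)).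
  by rewrite -mul_trE -row_mul [RHS]mxE.
rewrite mxE; move: j; apply: ord3P; move: i; apply: ord3P; rewrite ?r0 ?r1 ?r2 //= dotC //.
Qed.

Definition e1 : 'rV[R]_3 := delta_mx 0 o0.
Definition e3 : 'rV[R]_3 := delta_mx 0 o2.

Lemma frame u nu : dot u u = 1 -> dot nu nu = 1 -> dot nu u = 0 -> SO3 (mx3 u (cross nu u) nu).
Proof.
move=> uu nn nu0; apply: SO3_mx3 => //.
- by rewrite dot_cross_cross uu nn nu0 expr0n /= mulr1 subr0.
- by rewrite dotC dot_crossr.
- by rewrite dotC.
- by rewrite dot_crossl.
- by rewrite cross_cross uu [dot u nu]dotC nu0 scale0r subr0 scale1r.
Qed.

Lemma frame_expand u nu w : dot u u = 1 -> dot nu nu = 1 -> dot nu u = 0 ->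
  w = dot w u *: u + dot w (cross nu u) *: cross nu u + dot w nu *: nu.
Proof.
move=> uu nn nu0; have F := frame uu nn nu0.
have [r0 r1 r2] := row_mx3 u (cross nu u) nu.
rewrite -{1}[w]mulmx1 -(SO3_tr F) mulmxA; set A := mx3 _ _ _ in F r0 r1 r2 *.
by rewrite mulmx_sum_row sum3 !mul_trE r0 r1 r2.
Qed.

Lemma frame_maps u nu : dot u u = 1 -> dot nu nu = 1 -> dot nu u = 0 ->
  exists A, [/\ SO3 A, u *m A^T = e1 & nu *m A^T = e3].
Proof.
move=> uu nn nu0; exists (mx3 u (cross nu u) nu); have [r0 r1 r2] := row_mx3 u (cross nu u) nu.
split; first exact: frame.
- by apply: row3P; rewrite mul_trE ?r0 ?r1 ?r2 !mxE //= dotC ?dot_crossr.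
- by apply: row3P; rewrite mul_trE ?r0 ?r1 ?r2 !mxE //= dotC ?dot_crossl.
Qed.

End Vectors.

Lemma is_deriveE (R : realType) (V W : normedModType R) (f : V -> W) x v d : is_derive x v f d -> 'D_v f x = d.
Proof. by case. Qed.

Lemma derive_scalel (R : realType) (V W : normedModType R) (f : V -> R) (w : W) x v : differentiable f x ->
  'D_v (fun z => f z *: w) x = 'D_v f x *: w.
Proof. by move=> df; rewrite !deriveE ?diffZl //; exact/differentiableZl. Qed.

Lemma open_near (T : topologicalType) (O : set T) (y : T) : open O -> O y -> \forall z \near y, O z.
Proof. by move=> oO Oy; exact: (open_nbhs_nbhs (conj oO Oy)). Qed.

Lemma near_preimage (T U : topologicalType) (f : T -> U) x (W : set U) : {for x, continuous f} ->
  open W -> W (f x) -> \forall y \near x, W (f y).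
Proof. by move=> cf oW Wx; apply: cf; exact: open_near. Qed.

Section Orbits.
Context {R : realType} {n : nat}.
Notation config := (config R n).
Implicit Types (p q : config) (x : set config) (A : 'M[R]_3) (nu : 'rV[R]_3).

Lemma orbit_refl p : orbit p p.
Proof. by exists 1%:M; [exact: SO3_1|rewrite trmx1 mulmx1; case: p]. Qed.

Lemma orbit_act p A : SO3 A -> orbit p (p.1 *m A^T, p.2).
Proof. by move=> SA; exists A. Qed.

Lemma orbit_eq p q : orbit p q -> orbit q = orbit p.
Proof.
move=> [A SA ->]; apply/seteqP; split=> r [B SB ->] /=.
  by exists (B *m A); [exact: SO3_M|rewrite trmx_mul mulmxA].
exists (B *m A^T); first by apply: SO3_M => //; exact: SO3_T.
by rewrite /= trmx_mul trmxK mulmxA -(mulmxA p.1) SO3_tr // mulmx1.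
Qed.

Lemma orbit_snd p q : orbit p q -> q.2 = p.2.
Proof. by move=> [A _ ->]. Qed.

Lemma mu_orbit p : mu (orbit p) = p.2.
Proof. by apply: orbit_snd; exact: (getI (orbit_refl p)). Qed.

Lemma Bn_act p A : SO3 A -> Bn p -> Bn (p.1 *m A^T, p.2).
Proof.
move=> SA [s a d]; split=> //= i; rewrite ?row_mul.
  by rewrite /sphere /= dot_SO3 //; exact: s.
by rewrite /sdist dot_SO3 //; exact: d.
Qed.

Lemma Bn_orbit p q : Bn p -> orbit p q -> Bn q.
Proof. by move=> Bp [A SA ->]; exact: Bn_act. Qed.

Lemma Xn_mem x p : Xn x -> x p -> Bn p /\ x = orbit p.
Proof.
move=> [q Bq <-] qp; split; first exact: Bn_orbit qp.
by rewrite (orbit_eq qp).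
Qed.

Lemma great_circle_act nu p A : SO3 A -> in_great_circle nu p.1 -> in_great_circle (nu *m A^T) (p.1 *m A^T).
Proof.
move=> SA [sn dn]; split; first by rewrite /sphere /= dot_SO3.
by move=> i; rewrite row_mul dot_SO3.
Qed.

Lemma great_circle_opp nu p : in_great_circle nu p.1 -> in_great_circle (- nu) p.1.
Proof. by move=> [sn dn]; split=> [|i]; rewrite /sphere /= ?dotNl ?dotNr ?opprK // dn oppr0. Qed.

Lemma forward_act nu p A i : SO3 A -> forward (nu *m A^T) (p.1 *m A^T, p.2) i <-> forward nu p i.
Proof.
move=> SA; rewrite /forward /= !row_mul cross_SO3 // !scalemxAl -mulmxDl.
split=> [|-> //] H.
have := congr1 (fun u => u *m A) H.
by rewrite -!mulmxA SO3_tr // !mulmx1.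
Qed.

Lemma sphere_dot_itv (u v : 'rV[R]_3) : dot u u = 1 -> dot v v = 1 -> -1 <= dot u v <= 1.
Proof.
move=> uu vv.
have h1 := dot_ge0 (u + v); have h2 := dot_ge0 (u + - v).
move: h1 h2; rewrite !dotDl !dotDr !dotNl !dotNr uu vv [dot v u]dotC opprK => h1 h2.
by apply/andP; split; lra.
Qed.

Lemma Bn_dot p i : Bn p -> dot (row i p.1) (row (ordS i) p.1) = cos p.2.
Proof.
move=> [s _ d]; rewrite -(d i) /sdist acosK // in_itv /=.
by apply: sphere_dot_itv; exact: s.
Qed.

Lemma Bn_unit p i : Bn p -> dot (row i p.1) (row i p.1) = 1.
Proof. by move=> [s _ _]; exact: s. Qed.

Lemma Bn_sin p : Bn p -> 0 < sin p.2.
Proof. by move=> [_ a _]; exact: sin_gt0_pi. Qed.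

Lemma Bn_intro p : (forall i, dot (row i p.1) (row i p.1) = 1) -> 0 < p.2 < pi ->
  (forall i, dot (row i p.1) (row (ordS i) p.1) = cos p.2) -> Bn p.
Proof.
move=> s a d; split=> // i; rewrite /sdist d cosK // in_itv /=.
by case/andP: a => a1 a2; rewrite !ltW.
Qed.

(** In the plane orthogonal to [nu], the inner product [cos p.2] with the current vertex leaves two
    unit vectors, told apart by the sign of the sine; a non-forward edge takes the second one. *)
Lemma degenerate_edge nu p i : Bn p -> in_great_circle nu p.1 ->
  row (ordS i) p.1 = cos p.2 *: row i p.1 + (if `[< forward nu p i >] then 1 else -1) * sin p.2 *: cross nu (row i p.1).
Proof.
move=> Bp [sn dn]; set u := row i p.1; set w := row (ordS i) p.1.
have uu : dot u u = 1 by exact: Bn_unit.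
have ww : dot w w = 1 by exact: Bn_unit.
have wu : dot w u = cos p.2 by rewrite dotC; exact: Bn_dot.
have E := frame_expand w uu sn (dn i).
move: E; rewrite wu [dot w nu]dotC (dn (ordS i)) scale0r addr0.
set y := dot w _ => E.
have y2 : y ^+ 2 = sin p.2 ^+ 2.
  rewrite sin2cos2; have := ww; rewrite {1 2}E dotDl !dotDr !dotZl !dotZr uu dot_crossr [dot u _]dotC dot_crossr.
  rewrite dot_cross_cross sn uu (dn i) => H; lra.
have [ys|ys] : y = sin p.2 \/ y = - sin p.2.
  by move/eqP: y2; rewrite eqf_sqr => /orP[/eqP|/eqP]; [left|right].
- have F : forward nu p i by rewrite /forward -/w -/u E ys.
  by rewrite (asboolT F) mul1r -ys.
- case: ifP => [/asboolP F|_].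
    by rewrite mul1r.
  by rewrite mulN1r -ys.
Qed.

Lemma ordS_sum (V : zmodType) (F : 'I_n -> V) : \sum_i F (ordS i) = \sum_i F i.
Proof. by rewrite [RHS](reindex_inj (@ordS_inj n)). Qed.

(** The sum is twice a cardinal minus the odd number [n]. This is why a degenerate polygon with an
    odd number of edges has a nonzero winding number. *)
Lemma odd_sign_sum (b : 'I_n -> bool) : odd n -> \sum_i (if b i then 1 else -1) != 0 :> R.
Proof.
move=> on; have -> : \sum_i (if b i then 1 else -1) = (2 * #|[pred i | b i]|)%:R - n%:R :> R.
  have -> : \sum_i (if b i then 1 else -1) = \sum_i ((if b i then 2%:R else 0) - 1) :> R.
    by apply: eq_bigr => i _; case: (b i); ring.
  by rewrite natrM sumrB sumr_const card_ord -big_mkcond /= sumr_const mulr_natr.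
rewrite subr_eq0 eqr_nat; apply: contraTneq on => <-.
by rewrite mul2n odd_double.
Qed.

End Orbits.

(** * Linearised polygon equations *)

Section Tangent.
Context {R : realType} {n : nat}.
Notation config := (config R n).
Implicit Types (p q : config).

(** The kernel of the linearised equations of [Bn]: vertices of norm 1, and inner product [cos a] of
    consecutive vertices. *)
Definition tangent p (X : config) : Prop :=
  (forall i, dot (row i X.1) (row i p.1) = 0) /\
  (forall i, dot (row i X.1) (row (ordS i) p.1) + dot (row i p.1) (row (ordS i) X.1) = - sin p.2 * X.2).

(** The component [x i] of the velocity along the great circle changes by plus or minus [X.2] across
    edge [i]. Around the cycle these changes cancel, while the sum of the signs is nonzero. *)
Lemma degenerate_tangent nu p X : odd n -> Bn p -> in_great_circle nu p.1 -> tangent p X -> X.2 = 0.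
Proof.
move=> on Bp dp [T1 T2].
pose sg i : R := if `[< forward nu p i >] then 1 else -1.
have [sn dn] := dp.
pose x i := dot (row i X.1) (cross nu (row i p.1)).
have s0 := Bn_sin Bp.
have key i : x (ordS i) - x i = sg i * X.2.
  have E := degenerate_edge i Bp dp; rewrite -/(sg i) in E.
  have sg2 : sg i * sg i = 1 by rewrite /sg; case: ifP => _; rewrite ?mulrNN mulr1.
  have cs := cos2Dsin2 p.2.
  (* The edge relation solved backwards, by turning the other way from the next vertex; it expresses
     the second inner product through [x (ordS i)]. *)
  have E' : row i p.1 = cos p.2 *: row (ordS i) p.1 - sg i * sin p.2 *: cross nu (row (ordS i) p.1).
    rewrite E crossDr !crossZr cross_cross sn (dn i) scale0r sub0r scale1r.
    apply/rowP => k; move: sg2 cs; rewrite !mxE; move: (sg i) (cos _) (sin _) => s c d s2 cs.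
    generalize (nu 0 (ordS k) * p.1 i (ordS (ordS k)) - nu 0 (ordS (ordS k)) * p.1 i (ordS k)) => t.
    generalize (p.1 i k) => u.
    have cs' : c ^+ 2 = 1 - d ^+ 2 by lra.
    have s2' : s ^+ 2 = 1 by rewrite expr2.
    by ring: cs' s2'.
  have := T2 i; rewrite {1}E dotDr !dotZr T1 mulr0 add0r.
  rewrite {2}E' dotDl dotZl dotNl dotZl [dot (row (ordS i) _) _]dotC T1 mulr0 add0r.
  rewrite [dot (cross _ _) _]dotC -/(x i) -/(x (ordS i)) => H.
  have H2 : sin p.2 * (sg i * (x (ordS i) - x i) - X.2) = 0 by move: H; move: (sin _) (sg i) (x _) (x _) => a b c d; lra.
  move/eqP: H2; rewrite mulf_eq0 (gt_eqF s0) /= subr_eq0 => /eqP H2.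
  by rewrite -H2 mulrA sg2 mul1r.
have : \sum_i (x (ordS i) - x i) = 0 by rewrite sumrB ordS_sum subrr.
under eq_bigr do rewrite key.
rewrite -mulr_suml => /eqP; rewrite mulf_eq0 => /orP[|/eqP //].
by rewrite (negbTE (odd_sign_sum (fun i => `[< forward nu p i >]) on)).
Qed.

Lemma cyc_const (T : Type) (f : 'I_n -> T) : (forall i, f (ordS i) = f i) -> forall i j, f i = f j.
Proof.
move=> H i j.
have n0 : (0 < n)%N by exact: leq_ltn_trans (leq0n i) (ltn_ord i).
suff K (k : nat) (kn : (k < n)%N) : f (Ordinal kn) = f (Ordinal n0).
  by case: i => i Hi; case: j => j Hj; rewrite !K.
elim: k kn => [|k IH] kn; first by congr f; exact: val_inj.
rewrite -(IH (ltnW kn)) -[RHS]H; congr f; apply: val_inj => /=.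
by rewrite modn_small.
Qed.

(** A linear dependency is an equilibrium stress: at every vertex three weighted vertices cancel.
    Crossing this balance with the vertex itself shows that [lam i *: N i] is the same vector for
    all edges; if it were nonzero, it would be normal to every vertex and the polygon would lie on a
    great circle. *)
Lemma independent_edges p : (2 <= n)%N -> Bn p -> ~ (exists nu, in_great_circle nu p.1) ->
  forall kap lam : 'I_n -> R,
  (forall X : 'M[R]_(n, 3), \sum_i kap i * dot (row i X) (row i p.1) +
     \sum_i lam i * (dot (row i X) (row (ordS i) p.1) + dot (row i p.1) (row (ordS i) X)) = 0) ->
  (forall i, kap i = 0) /\ forall i, lam i = 0.
Proof.
move=> n2 Bp nd kap lam H.
pose u i := row i p.1; pose N i := cross (u i) (u (ordS i)).
have s0 := Bn_sin Bp.
have SP i : ordS (ord_pred i) = i by exact: ord_predK.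
have H1 i : kap i *: u i + lam i *: u (ordS i) + lam (ord_pred i) *: u (ord_pred i) = 0.
  apply: dot_ext => y; rewrite dot0l dotC !dotDr !dotZr.
  (* The test deformation moves vertex [i] alone. *)
  have := H (\matrix_j (if j == i then y else 0)).
  have D j (z : 'rV[R]_3) : dot (row j (\matrix_j (if j == i then y else 0))) z = if j == i then dot y z else 0.
    by rewrite rowK; case: ifP => // _; rewrite dot0l.
  under eq_bigr do rewrite D.
  have -> : \sum_j lam j * (dot (row j (\matrix_j (if j == i then y else 0))) (u (ordS j)) + dot (u j) (row (ordS j) (\matrix_j (if j == i then y else 0))))
    = \sum_j (if j == i then lam j * dot y (u (ordS j)) else 0) + \sum_j (if j == ord_pred i then lam j * dot y (u j) else 0).
    rewrite -big_split; apply: eq_bigr => j _ /=; rewrite D [dot (u j) _]dotC D mulrDr.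
    rewrite (_ : (ordS j == i) = (j == ord_pred i)); last by rewrite -[RHS](inj_eq (@ordS_inj n)) SP.
    by do 2!case: ifP; rewrite ?mulr0.
  have -> : \sum_j kap j * (if j == i then dot y (u j) else 0) = \sum_j (if j == i then kap j * dot y (u j) else 0).
    by apply: eq_bigr => j _; case: ifP; rewrite ?mulr0.
  by rewrite -!big_mkcond !big_pred1_eq addrA.
have H2 i : lam (ordS i) *: N (ordS i) = lam i *: N i.
  have := congr1 (cross (u (ordS i))) (H1 (ordS i)).
  have -> : ord_pred (ordS i) = i by exact: ordSK.
  rewrite !crossDr !crossZr crossuu scaler0 add0r cross0r -/(N (ordS i)) (crossC (u (ordS i)) (u i)) -/(N i) scalerN.
  by move/eqP; rewrite subr_eq0 => /eqP.
have NN i : dot (N i) (N i) = sin p.2 ^+ 2.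
  by rewrite dot_cross_cross !Bn_unit // Bn_dot // mulr1 sin2cos2.
have C := cyc_const H2.
have lam0 i : lam i = 0.
  apply/eqP; apply: contraT => li.
  have lj j : lam j != 0.
    apply: contra_neqN li => /eqP lj; have := congr1 (fun v => dot v v) (C i j).
    rewrite lj scale0r dot0l dotZl dotZr NN => /eqP.
    by rewrite mulf_eq0 mulf_eq0 sqrf_eq0 (gt_eqF s0) orbF orbb => /eqP.
  case: nd; exists ((sin p.2)^-1 *: N i); split.
    by rewrite /sphere /= dotZl dotZr NN mulrA -expr2 -exprMn mulVf ?expr1n // gt_eqF.
  move=> j; rewrite dotZl; have := congr1 (fun v => dot v (u j)) (C i j).
  rewrite !dotZl dot_crossl mulr0 => /eqP; rewrite mulf_eq0 (negbTE li) /= => /eqP ->.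
  by rewrite mulr0.
split=> // i; have := congr1 (fun v => dot v (u i)) (H1 i).
by rewrite !lam0 !scale0r !addr0 dotZl dot0l Bn_unit // mulr1.
Qed.

End Tangent.

Section Configs.
Context {R : realType} {n : nat}.
Notation config := (config R n).
Implicit Types (p q : config) (V : normedModType R).

Lemma continuous_entry i k : continuous (fun q : config => q.1 i k).
Proof.
move=> q; have C1 : {for q, continuous (fst : config -> 'M[R]_(n, 3))} by exact: cvg_fst.
have C2 : {for q.1, continuous (fun M : 'M[R]_(n, 3) => M i k)} by exact: coord_continuous.
exact: (continuous_comp C1 C2).
Qed.

Lemma entry_linear i k : linear (fun q : config => q.1 i k : R).
Proof. by move=> a u v; rewrite !mxE. Qed.

Lemma snd_linear : linear (fun q : config => q.2 : R).
Proof. by move=> a u v. Qed.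

Lemma lin_of (V W : normedModType R) (f : V -> W) : linear f -> exists L : {linear V -> W}, f = L.
Proof.
move=> Hf; pose fM := GRing.isLinear.Build _ _ _ _ _ Hf.
by pose L : {linear V -> W} := HB.pack f fM; exists L.
Qed.

Lemma diff_times_linear (V W : normedModType R) (f : V -> W) j O : linear f -> continuous f -> diff_times j f O.
Proof. by move=> /lin_of[L ->]; exact: diff_times_lin. Qed.

Lemma diff_times_entry j i k (O : set config) : diff_times j (fun q : config => q.1 i k) O.
Proof. by apply: diff_times_linear; [exact: entry_linear|exact: continuous_entry]. Qed.

Lemma diff_times_snd j (O : set config) : diff_times j (fun q : config => q.2) O.
Proof. by apply: diff_times_linear; [exact: snd_linear|move=> q; exact: cvg_snd]. Qed.

Lemma derive_linear_comp (V W U : normedModType R) (f : V -> W) (l : W -> U) x v :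
  linear l -> continuous l -> differentiable f x ->
  differentiable (fun y => l (f y)) x /\ 'D_v (fun y => l (f y)) x = l ('D_v f x).
Proof.
move=> /lin_of[L ->] cl df.
have dl y : differentiable L y by exact: linear_differentiable.
have dlf : differentiable (fun y => L (f y)) x by apply: (@differentiable_comp _ _ _ _ f L).
split=> //; rewrite !deriveE // (@diff_comp _ _ _ _ f L) //=.
by rewrite diff_lin.
Qed.

Lemma derive_entry V (s : V -> config) x v i k : differentiable s x ->
  differentiable (fun y => (s y).1 i k) x /\ 'D_v (fun y => (s y).1 i k) x = ('D_v s x).1 i k.
Proof. exact: (derive_linear_comp v (@entry_linear i k) (@continuous_entry i k)). Qed.

Lemma derive_snd V (s : V -> config) x v : differentiable s x ->
  differentiable (fun y => (s y).2) x /\ 'D_v (fun y => (s y).2) x = ('D_v s x).2.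
Proof. by apply: derive_linear_comp; [exact: snd_linear|move=> q; exact: cvg_snd]. Qed.

Lemma derive_dot V (s : V -> config) x v i j : differentiable s x ->
  is_derive x v (fun y => dot (row i (s y).1) (row j (s y).1))
   (dot (row i ('D_v s x).1) (row j (s x).1) + dot (row i (s x).1) (row j ('D_v s x).1)).
Proof.
move=> ds.
have E k : is_derive x v (fun y => (s y).1 i k) (('D_v s x).1 i k).
  by have [d e] := derive_entry v i k ds; split=> //; exact: diff_derivable.
have F k : is_derive x v (fun y => (s y).1 j k) (('D_v s x).1 j k).
  by have [d e] := derive_entry v j k ds; split=> //; exact: diff_derivable.
have M k := is_deriveM (E k) (F k).
have -> : (fun y => dot (row i (s y).1) (row j (s y).1)) =
  (fun y => (s y).1 i o0) * (fun y => (s y).1 j o0) + (fun y => (s y).1 i o1) * (fun y => (s y).1 j o1)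
  + (fun y => (s y).1 i o2) * (fun y => (s y).1 j o2).
  by apply/funext => y; rewrite !fctE /= dotE !mxE.
apply: (is_derive_eq (is_deriveD (is_deriveD (M o0) (M o1)) (M o2))).
rewrite !dotE !mxE -![_ *: _]/(_ * _).
move: ('D_v s x) (s x) => [X b] [P a] /=; ring.
Qed.

Lemma tangent_of_section V (s : V -> config) (O : set V) x v : open O -> O x ->
  (forall y, O y -> Bn (s y)) -> differentiable s x -> tangent (s x) ('D_v s x).
Proof.
move=> oO Ox sB ds; split=> i.
  have C : is_derive x v (fun y => dot (row i (s y).1) (row i (s y).1)) 0.
    apply: (@near_eq_is_derive R V R (cst 1)).
    by apply: (open_near_eq oO Ox) => y /sB /Bn_unit ->.
  have := is_deriveE C; rewrite (is_deriveE (derive_dot v i i ds)) [dot (row i (s x).1) _]dotC.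
  by move=> H; lra.
have [d2 e2] := derive_snd v ds.
have C : is_derive x v (fun y => dot (row i (s y).1) (row (ordS i) (s y).1)) (- sin (s x).2 * ('D_v s x).2).
  apply: (@near_eq_is_derive R V R (fun y => cos (s y).2)).
    by apply: (open_near_eq oO Ox) => y /sB /Bn_dot ->.
  have dc : differentiable (@cos R) (s x).2 by exact: is_derive1_differentiable.
  have dcs : differentiable (fun y => cos (s y).2) x by apply: (@differentiable_comp _ _ _ _ (fun y => (s y).2) cos).
  split; first exact: diff_derivable.
  rewrite deriveE // (@diff_comp _ _ _ _ (fun y => (s y).2) cos) //= -(deriveE _ d2) e2.
  by rewrite -deriveE // (is_derive1_dir _ (is_derive_cos _)) mulrC.
by have := is_deriveE C; rewrite (is_deriveE (derive_dot v i (ordS i) ds)).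
Qed.

End Configs.

(** * Rotations about an axis *)

Section Rotations.
Context {R : realType}.
Implicit Types (w u : 'rV[R]_3).

Lemma cross_linear w : linear (cross w).
Proof. by move=> a u v; rewrite crossDr crossZr. Qed.

Definition skew w : 'M[R]_3 := \matrix_(i, j) cross w (delta_mx 0 i) 0 j.

Lemma mul_skew w u : u *m skew w = cross w u.
Proof.
have [L eL] := lin_of (@cross_linear w).
rewrite {2}[u]row_sum_delta eL linear_sum -eL mulmx_sum_row; apply: eq_bigr => i _.
rewrite eL linearZ -eL /=; congr (_ *: _).
by apply/rowP => j; rewrite mxE [LHS]mxE.
Qed.

Lemma mx_row_ext (A B : 'M[R]_3) : (forall u, u *m A = u *m B) -> A = B.
Proof. by move=> H; apply/row_matrixP => i; rewrite !rowE H. Qed.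

Lemma mul_tr_outer w u : u *m (w^T *m w) = dot u w *: w.
Proof. by rewrite mulmxA [u *m w^T]mx11_scalar mul_scalar_mx. Qed.

(** Rodrigues' formula for a unit axis [w], acting on row vectors from the right; since [orbit] acts
    by [A^T], the element of [SO3] is the transpose. *)
Definition rotation w (t : R) : 'M[R]_3 :=
  cos t *: (1%:M - w^T *m w) + sin t *: skew w + w^T *m w.

Lemma mul_rotation w t u : u *m rotation w t = cos t *: (u - dot u w *: w) + sin t *: cross w u + dot u w *: w.
Proof. by rewrite !mulmxDr -!scalemxAr mulmxBr mulmx1 mul_skew mul_tr_outer. Qed.

Lemma rotationD w s t : dot w w = 1 -> rotation w s *m rotation w t = rotation w (s + t).
Proof.
move=> ww; apply: mx_row_ext => u; rewrite mulmxA !mul_rotation.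
have -> : dot (cos s *: (u - dot u w *: w) + sin s *: cross w u + dot u w *: w) w = dot u w.
  by rewrite !(dotDl, dotZl, dotNl) dot_crossl ww; ring.
rewrite !crossDr !crossZr crossDr -scaleN1r !crossZr crossuu !scaler0 !addr0 cross_cross ww scale1r.
rewrite [dot w u]dotC cosD sinD.
by apply/rowP => j; rewrite !mxE; ring.
Qed.

Lemma rotation0 w : rotation w 0 = 1%:M.
Proof. by rewrite /rotation cos0 sin0 scale0r scale1r addr0 subrK. Qed.

Lemma rotation_SO3 w t : dot w w = 1 -> SO3 (rotation w t)^T.
Proof.
move=> ww.
have O s : (rotation w s)^T *m (rotation w s) = 1%:M.
  have -> : (rotation w s)^T = rotation w (- s).
    have E : (w^T *m w)^T = w^T *m w by rewrite trmx_mul trmxK.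
    have K : (skew w)^T = - skew w.
      by apply/matrixP; apply: ord3P; apply: ord3P; rewrite !v3E /=; ring.
    have D (A B : 'M[R]_3) : (A + B)^T = A^T + B^T by exact: linearD.
    have Z a (A : 'M[R]_3) : (a *: A)^T = a *: A^T by exact: linearZ.
    have N (A : 'M[R]_3) : (- A)^T = - A^T by exact: linearN.
    by rewrite /rotation !(D, Z, N) trmx1 E K cosN sinN scalerN scaleNr.
  by rewrite rotationD // addNr rotation0.
split; first by rewrite trmxK.
(* Being the square of an orthogonal matrix, the rotation has determinant 1. *)
have -> : t = t / 2 + t / 2 by rewrite -splitr.
rewrite det_tr -rotationD // det_mulmx -{1}det_tr -det_mulmx.
by rewrite O det1.
Qed.

Lemma derive_rotation (n : nat) w (P : 'M[R]_(n, 3)) (a : R) :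
  differentiable (fun t : R => (P *m rotation w t, a) : config R n) 0 /\
  'D_1 (fun t : R => (P *m rotation w t, a) : config R n) 0 = (P *m skew w, 0).
Proof.
have -> : (fun t : R => (P *m rotation w t, a) : config R n) =
  ((fun t => cos t *: ((P *m (1%:M - w^T *m w), 0) : config R n)) + (fun t => sin t *: ((P *m skew w, 0) : config R n)))
  + cst (P *m (w^T *m w), a).
  apply/funext => t; rewrite !fctE /=.
  rewrite -[RHS]/(cos t *: (P *m (1%:M - w^T *m w)) + sin t *: (P *m skew w) + P *m (w^T *m w), cos t * 0 + sin t * 0 + a).
  by rewrite !mulr0 !add0r /rotation 2!mulmxDr -!scalemxAr.
have dc : differentiable (@cos R) 0 by exact: is_derive1_differentiable.
have ds : differentiable (@sin R) 0 by exact: is_derive1_differentiable.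
have d1 := differentiableZl ((P *m (1%:M - w^T *m w), 0) : config R n) dc.
have d2 := differentiableZl ((P *m skew w, 0) : config R n) ds.
split; first by apply: differentiableD; [exact: differentiableD|exact: differentiable_cst].
have i1 := derivableP (@diff_derivable _ _ _ _ _ (1 : R) d1).
have i2 := derivableP (@diff_derivable _ _ _ _ _ (1 : R) d2).
have i3 := is_derive_cst ((P *m (w^T *m w), a) : config R n) (0 : R) (1 : R).
rewrite (is_deriveE (is_deriveD (is_deriveD i1 i2) i3)) addr0.
rewrite (derive_scalel _ _ dc) (derive_scalel _ _ ds).
rewrite (is_derive1_dir _ (is_derive_cos _)) (is_derive1_dir _ (is_derive_sin _)) sin0 cos0 oppr0 mulr0 scale0r add0r.
by rewrite mulr1 scale1r.
Qed.

End Rotations.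

Section Charts.
Context {R : realType} {n : nat}.
Notation config := (config R n).
Notation atlas := (@Xn_atlas R n).
Implicit Types (p q : config) (x : set config) (c : chart R (set config) (n - 2)).

(* s is a local section of the orbit map over c, and g extends the coordinates of c
   from B_n to a neighbourhood of s y0. *)
Lemma chart_data c x : atlas c -> dom c x ->
  exists (O : set 'rV[R]_(n - 2)) (s : 'rV[R]_(n - 2) -> config) (W : set config) (g : config -> 'rV[R]_(n - 2)),
  let y0 := coord c x in
  [/\ [/\ open O, O y0, smooth_on s O & forall z, O z -> Bn (s z)],
      orbit (s y0) = x /\ (forall z, O z -> (s z).2 = mu (param c z)),
      [/\ open W, W (s y0) & differentiable g (s y0)],
      (forall z, O z -> W (s z) -> g (s z) = z)
    & forall q, Bn q -> W q -> g q = coord c (orbit q) /\ dom c (orbit q)].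
Proof.
move=> [[dX [W1 oW1 domW]] oI ck sm sec] dx.
have y0I : (coord c @` dom c) (coord c x) by exists x.
have [Q [s [oO Oy0 OI ss sP]]] := sec _ y0I.
have Bs0 := (sP _ Oy0).1; have os0 : orbit (s (coord c x)) = x by rewrite (sP _ Oy0).2 ck.
have ds0 : (@Bn R n `&` @Defs.orbit R n @^-1` dom c) (s (coord c x)) by split=> //; rewrite /= os0.
have [Q2 [g [oO2 O2s sg gE]]] := sm _ ds0.
have W1s : W1 (s (coord c x)) by move: ds0; rewrite domW => -[].
exists Q, s, (W1 `&` Q2), g; split.
- by split=> // z /sP[].
- by split=> // z Oz; rewrite -(sP z Oz).2 mu_orbit.
- split; [exact: openI|by split|exact: smooth_on_differentiable sg O2s].
- move=> z Oz [W1z O2z]; have [Bz oz] := sP z Oz.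
  have dz : (@Bn R n `&` @Defs.orbit R n @^-1` dom c) (s z) by rewrite domW; split.
  rewrite -(gE _ dz O2z) /= oz.
  by have [x' dx' <-] := OI z Oz; rewrite ck.
- move=> q Bq [W1q O2q].
  have dq : (@Bn R n `&` @Defs.orbit R n @^-1` dom c) q by rewrite domW; split.
  by split; [rewrite -(gE _ dq O2q)|case: dq].
Qed.

(** In a chart, [mu] is the length component of a local section into [Bn], and the derivatives of
    the section are tangent vectors at a degenerate polygon. *)
Lemma degenerate_derive nu c x p v : odd n -> atlas c -> dom c x -> x p -> in_great_circle nu p.1 ->
  'D_v (@mu R n \o param c) (coord c x) = 0.
Proof.
move=> on ac dx xp gp; have [Q [s [W [g [[oO Oy0 ss sB] [os0 mus] _ _ _]]]]] := chart_data ac dx.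
have ds := smooth_on_differentiable ss Oy0.
have -> : 'D_v (@mu R n \o param c) (coord c x) = 'D_v (fun z => (s z).2) (coord c x).
  by apply: near_eq_derive; apply: (open_near_eq oO Oy0) => z /mus.
rewrite (derive_snd v ds).2.
have : orbit p (s (coord c x)).
  have xX : Xn x by case: ac => -[dX _] _ _ _ _; exact: dX.
  by rewrite -(Xn_mem xX xp).2 -{1}os0; exact: orbit_refl.
move=> [A SA E].
apply: (@degenerate_tangent _ _ (nu *m A^T) (s (coord c x))) => //; first exact: sB.
  by rewrite E; exact: great_circle_act.
exact: tangent_of_section oO Oy0 sB ds.
Qed.

Lemma chart_derive_id c x (O : set 'rV[R]_(n - 2)) (s : 'rV[R]_(n - 2) -> config) W g v :
  open O -> O (coord c x) -> open W -> W (s (coord c x)) -> differentiable s (coord c x) ->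
  differentiable g (s (coord c x)) -> (forall z, O z -> W (s z) -> g (s z) = z) ->
  'd g (s (coord c x)) ('D_v s (coord c x)) = v.
Proof.
move=> oO Oy oW Wy ds dg gs; rewrite deriveE //.
have dgs := @differentiable_comp _ _ _ _ s g (coord c x) ds dg.
have := @diff_comp _ _ _ _ s g (coord c x) ds dg => /(congr1 (fun f => f v)) /= <-.
rewrite -deriveE // -[RHS](derive_id (coord c x) v); apply: near_eq_derive.
have N1 := open_near oO Oy.
have N2 := near_preimage (differentiable_continuous ds) oW Wy.
by apply: filterS2 N1 N2 => z Oz Wz /=; exact: gs.
Qed.

(** [g] is constant along the rotations of [p], so its differential kills their velocities; a
    nonzero [w] is a multiple of a unit axis, to which Rodrigues' formula applies. *)
Lemma rotation_tangent p (W : set config) (g : config -> 'rV[R]_(n - 2)) (w : 'rV[R]_3) :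
  Bn p -> open W -> W p -> differentiable g p ->
  (forall q, Bn q -> W q -> orbit q = orbit p -> g q = g p) ->
  'd g p (p.1 *m skew w, 0) = 0.
Proof.
move=> Bp oW Wp dg gI.
have unit_case (w' : 'rV[R]_3) : dot w' w' = 1 -> 'd g p (p.1 *m skew w', 0) = 0.
  move=> ww; have [dr er] := derive_rotation w' p.1 p.2.
  set r := (fun t : R => _) in dr er.
  have r0 : r 0 = p by rewrite /r rotation0 mulmx1; case: (p).
  have dg' : differentiable g (r 0) by rewrite r0.
  rewrite -er -r0 deriveE //.
  have dgr := @differentiable_comp _ _ _ _ r g 0 dr dg'.
  have := @diff_comp _ _ _ _ r g 0 dr dg' => /(congr1 (fun f => f 1)) /= <-.
  rewrite -deriveE // -[RHS](derive_cst (g p) (0 : R) 1); apply: near_eq_derive.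
  have Wr : W (r 0) by rewrite r0.
  have N := near_preimage (differentiable_continuous dr) oW Wr.
  apply: filterS N => t Wt /=.
  have o : orbit p (r t).
    by exists (rotation w' t)^T; [exact: rotation_SO3|rewrite trmxK].
  by apply: gI => //; [exact: Bn_orbit o|exact: orbit_eq].
have [->|w0] := eqVneq w 0.
  have -> : p.1 *m skew (0 : 'rV[R]_3) = 0.
    by apply/row_matrixP => i; rewrite row_mul mul_skew -(scale0r 0) crossZl scale0r row0.
  by rewrite -[(0, 0)]/(0 : config) linear0.
pose l := Num.sqrt (dot w w).
have d0 : 0 < dot w w.
  by rewrite lt_neqAle dot_ge0 andbT eq_sym; apply: contra_neqN w0 => /eqP; exact: dot_eq0.
have l0 : 0 < l by rewrite sqrtr_gt0.
have l2 : l ^+ 2 = dot w w by rewrite sqr_sqrtr // ltW.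
have -> : (p.1 *m skew w, 0) = l *: ((p.1 *m skew (l^-1 *: w), 0) : config).
  rewrite -[RHS]/(l *: (p.1 *m skew (l^-1 *: w)), l * 0) mulr0; congr (_, _).
  apply/row_matrixP => i; rewrite linearZ /= !row_mul !mul_skew crossZl scalerA divff ?scale1r //.
  by rewrite gt_eqF.
have u1 : dot (l^-1 *: w) (l^-1 *: w) = 1.
  by rewrite dotZl dotZr -l2; field; rewrite gt_eqF.
by rewrite linearZ (unit_case _ u1) /= scaler0.
Qed.

End Charts.

Section Nondegenerate.
Context {R : realType} {n : nat}.
Notation config := (config R n).
Notation atlas := (@Xn_atlas R n).

Lemma linear_matrix (k l m : nat) (f : 'rV[R]_k -> 'M[R]_(l, m)) : linear f ->
  exists M : 'M[R]_(k, l * m), forall v, v *m M = mxvec (f v).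
Proof.
move=> fl; have gl : linear (fun v => mxvec (f v)) by move=> a u v; rewrite fl linearP.
by have [L eL] := lin_of gl; exists (lin1_mx L) => v; rewrite mul_rV_lin1 -eL.
Qed.

(* Were the edge equations independent at P, the image of the chart, together with the three infinitesimal
   rotations, would span a space of dimension (n - 2) + 3 inside the n-dimensional space of infinitesimal deformations preserving a. *)
Lemma critical_degenerate (c : chart R (set config) (n - 2)) x : (2 <= n)%N -> atlas c -> dom c x ->
  (forall v, 'D_v (@mu R n \o param c) (coord c x) = 0) ->
  forall p, x p -> exists nu, in_great_circle nu p.1.
Proof.
move=> n2 ac dx crit p xp.
have xX : Xn x by case: (ac) => -[dX _] _ _ _ _; exact: dX.
have [Q [s [W [g [[oO Oy0 ss sB] [os0 mus] [oW Wy dg] gs gq]]]]] := chart_data ac dx.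
have ds := smooth_on_differentiable ss Oy0.
set y0 := coord c x in Oy0 os0 Wy dg ds crit *; set q := s y0 in os0 Wy dg *.
have Bq : Bn q by exact: sB.
have xq : x q by rewrite -os0; exact: orbit_refl.
suff [nu gnu] : exists nu, in_great_circle nu q.1.
  have : orbit q p by rewrite os0.
  by move=> [A SA ->]; exists (nu *m A^T); exact: great_circle_act.
apply: contrapT => nd.
have D0 v : ('D_v s y0).2 = 0.
  rewrite -(derive_snd v ds).2 -(crit v); apply: near_eq_derive.
  by apply: (open_near_eq oO Oy0) => z /mus.
have gI r : Bn r -> W r -> orbit r = orbit q -> g r = g q.
  by move=> Br Wr e; rewrite (gq r Br Wr).1 (gq q Bq Wy).1 e.
pose Phi (z : 'rV[R]_(n - 2 + 3)) : 'M[R]_(n, 3) := ('D_(lsubmx z) s y0).1 + q.1 *m skew (rsubmx z).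
pose E (X : 'M[R]_(n, 3)) : 'rV[R]_(n + n) := row_mx (\row_i dot (row i X) (row i q.1))
  (\row_i (dot (row i X) (row (ordS i) q.1) + dot (row i q.1) (row (ordS i) X))).
have PhiL : linear Phi.
  move=> a u v; rewrite /Phi !deriveE // !linearP /=.
  have -> : skew (a *: rsubmx u + rsubmx v) = a *: skew (rsubmx u) + skew (rsubmx v).
    by apply/matrixP => i; apply: ord3P; rewrite !v3E; ring.
  by rewrite mulmxDr -scalemxAr scalerDr addrACA.
have EL : linear E.
  move=> a X Y; rewrite /E scale_row_mx add_row_mx; congr row_mx; apply/rowP => i; rewrite !mxE !linearP /=.
    by rewrite dotDl dotZl.
  by rewrite !(dotDl, dotDr, dotZl, dotZr); ring.
have PhiI z : Phi z = 0 -> z = 0.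
  move=> H.
  have H2 : 'D_(lsubmx z) s y0 + ((q.1 *m skew (rsubmx z), 0) : config) = 0.
    move: H (D0 (lsubmx z)); rewrite /Phi; case: ('D_(lsubmx z) s y0) => X b /= H ->; by rewrite -[LHS]/(X + q.1 *m skew (rsubmx z), 0 + 0) H addr0.
  (* The differential of [g] recovers the chart direction and kills the rotational one. *)
  have l0 : lsubmx z = 0.
    rewrite -(chart_derive_id (lsubmx z) oO Oy0 oW Wy ds dg gs) -[RHS](linear0 ('d g q)) -H2 linearD /=.
    by rewrite (rotation_tangent (rsubmx z) Bq oW Wy dg gI) addr0.
  (* A rotation fixing two consecutive vertices to first order has an axis parallel to both; they
     are not parallel to each other, so it is trivial. *)
  have r0 : rsubmx z = 0.
    have n0 : (0 < n)%N by exact: ltn_trans n2.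
    pose i0 := Ordinal n0; set w := rsubmx z in H *.
    have C i : cross w (row i q.1) = 0.
      move: H; rewrite /Phi l0 deriveE // linear0 add0r => /(congr1 (row i)).
      by rewrite row_mul mul_skew row0.
    have F i : dot w (row i q.1) *: row i q.1 = w.
      have := congr1 (cross (row i q.1)) (C i).
      rewrite cross_cross Bn_unit // scale1r cross0r [dot (row i _) w]dotC => /eqP.
      by rewrite subr_eq0 => /eqP.
    have := congr1 (fun v => dot v v) (C i0).
    rewrite dot_cross_cross Bn_unit // dot0l mulr1 => K0.
    have := congr1 (fun v => dot v v) (F i0); have := congr1 (fun v => dot v v) (F (ordS i0)).
    rewrite !(dotZl, dotZr) !Bn_unit // !mulr1 => K1 K2.
    have K3 := Bn_dot i0 Bq.
    have e : dot w (row (ordS i0) q.1) = dot w (row i0 q.1) * cos q.2.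
      by rewrite -K3 -dotZl F.
    apply: dot_eq0; move: K1 K2; rewrite e.
    have s0 := Bn_sin Bq; have cs := cos2Dsin2 q.2.
    move: (dot w w) (dot w (row i0 q.1)) (cos _) (sin _) s0 cs => a b co si s0 cs K1 K2.
    have : b ^+ 2 * si ^+ 2 = 0 by nra.
    move/eqP; rewrite mulf_eq0 !sqrf_eq0 (gt_eqF s0) orbF => /eqP b0.
    by rewrite -K2 b0 mulr0.
  by rewrite -[z]hsubmxK l0 r0 row_mx0.
have EPhi z : E (Phi z) = 0.
  have T := tangent_of_section (lsubmx z) oO Oy0 sB ds.
  have [T1 T2] := T.
  have -> : 0 = row_mx 0 0 :> 'rV[R]_(n + n) by rewrite row_mx0.
  congr row_mx; apply/rowP => i; rewrite !mxE /Phi !linearD /= !row_mul !mul_skew !(dotDl, dotDr).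
    by rewrite T1 dot_crossr addr0.
  have := T2 i; rewrite D0 mulr0 => T2i.
  rewrite addrACA T2i add0r [dot (row i q.1) _]dotC.
  by rewrite !v3E; ring.
have [MP hMP] := linear_matrix PhiL.
have [ME hME] : exists ME : 'M[R]_(n * 3, n + n), forall X, mxvec X *m ME = E X.
  have El : linear (fun v : 'rV[R]_(n * 3) => E (vec_mx v)) by move=> a u v; rewrite linearP EL.
  by have [L eL] := lin_of El; exists (lin1_mx L) => X; rewrite mul_rV_lin1 -eL mxvecK.
have rP : \rank MP = (n - 2 + 3)%N.
  apply/eqP/inj_row_free => v; rewrite hMP => vP; apply: PhiI.
  by rewrite -[LHS]mxvecK vP linear0.
have rE : \rank ME = (n + n)%N.
  rewrite -mxrank_tr; apply/eqP/inj_row_free => w wE.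
  pose kap i := w 0 (lshift n i); pose lam i := w 0 (rshift n i).
  have K X : \sum_i kap i * dot (row i X) (row i q.1) + \sum_i lam i *
    (dot (row i X) (row (ordS i) q.1) + dot (row i q.1) (row (ordS i) X)) = 0.
    have : E X *m w^T = 0 by rewrite -hME -mulmxA -[ME *m w^T]trmxK trmx_mul trmxK wE trmx0 mulmx0.
    move/(congr1 (fun M : 'M[R]_1 => M 0 0)); rewrite !mxE big_split_ord /= => H; rewrite -[RHS]H.
    by congr (_ + _); apply: eq_bigr => i _; rewrite mulrC /E ?row_mxEl ?row_mxEr !mxE.
  have [k0 l0] := independent_edges n2 Bq nd K.
  by apply/rowP => i; rewrite mxE; case: (split_ordP i) => j ->; [exact: k0|exact: l0].
have := mulmx0_rank_max (A := MP) (B := ME); rewrite rP rE.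
have PE : MP *m ME = 0.
  apply/row_matrixP => i; rewrite row0 rowE mulmxA hMP hME; exact: EPhi.
by move=> /(_ PE); lia.
Qed.

End Nondegenerate.

(** * Polygons with prescribed heights *)

Section Sections.
Context {R : realType} {n : nat}.
Notation config := (config R n).
Variable eps : 'I_n -> bool.
Implicit Types (h : 'rV[R]_n) (a : R).

Local Notation sg i := (@sgb R (eps i)).

Definition level_radius h i : R := Num.sqrt (1 - h 0 i ^+ 2).

(** Cosine of the longitude difference between two points of the sphere at the given heights whose
    inner product is [cos a]. *)
Definition cosang h a i : R := (cos a - h 0 i * h 0 (ordS i)) / (level_radius h i * level_radius h (ordS i)).

Definition turn h a i : R := sg i * acos (cosang h a i).

Definition longitude h a (i : nat) : R := \sum_(j < n | (j < i)%N) turn h a j.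

Definition total_turn h a : R := \sum_j turn h a j.

(* The longitudes are chosen so that the edges have length a and run eastwards exactly for the i with eps i; the
   polygon closes up only if total_turn h a is a multiple of 2 pi. *)
Definition polygon h a : config :=
  (\matrix_(i < n, k < 3) (if k == o0 then level_radius h i * cos (longitude h a i)
     else if k == o1 then level_radius h i * sin (longitude h a i) else h 0 i), a).

Definition height_dom : set ('rV[R]_n * R) := [set p : 'rV[R]_n * R | forall i : 'I_n, 0 < 1 - p.1 0 i ^+ 2].

Definition turn_dom : set ('rV[R]_n * R) :=
  [set p : 'rV[R]_n * R | [/\ height_dom p, forall i : 'I_n, -1 < cosang p.1 p.2 i < 1 & 0 < p.2 < pi]].

Lemma sgb_sqr b : sgb b * sgb b = 1 :> R.
Proof. by case: b; rewrite /sgb; ring. Qed.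

Lemma radius_gt0 h a i : height_dom (h, a) -> 0 < level_radius h i.
Proof. by move=> /(_ i) /= H; rewrite sqrtr_gt0. Qed.

Lemma radius_sqr h a i : height_dom (h, a) -> level_radius h i ^+ 2 = 1 - h 0 i ^+ 2.
Proof. by move=> /(_ i) /= H; rewrite sqr_sqrtr // ltW. Qed.

Lemma polygon_row h a i : [/\ row i (polygon h a).1 0 o0 = level_radius h i * cos (longitude h a i),
  row i (polygon h a).1 0 o1 = level_radius h i * sin (longitude h a i) & row i (polygon h a).1 0 o2 = h 0 i].
Proof. by split; rewrite !mxE. Qed.

Lemma longitude0 h a : longitude h a 0 = 0.
Proof. by rewrite /longitude big_pred0. Qed.

Lemma longitudeS h a (i : 'I_n) : longitude h a i.+1 = longitude h a i + turn h a i.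
Proof.
rewrite /longitude (bigD1 i) //= addrC; congr (_ + _); apply: eq_bigl => j.
by rewrite ltnS ltn_neqAle andbC.
Qed.

Lemma longitude_n h a : longitude h a n = total_turn h a.
Proof. by rewrite /longitude /total_turn; apply: eq_bigl => j; rewrite ltn_ord. Qed.

Lemma longitude_next h a (t : nat) (i : 'I_n) : total_turn h a = 2 * pi * t%:R ->
  cos (longitude h a (ordS i)) = cos (longitude h a i + turn h a i) /\
  sin (longitude h a (ordS i)) = sin (longitude h a i + turn h a i).
Proof.
move=> tt; rewrite -longitudeS /=; have [lt|ge] := ltnP i.+1 n; first by rewrite modn_small.
have -> : i.+1 = n by apply/eqP; rewrite eqn_leq ge ltn_ord.
have [c s] := cos_nat2pi (R := R) t.
by rewrite modnn longitude0 longitude_n tt c s cos0 sin0.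
Qed.

Lemma cos_turn h a i : turn_dom (h, a) -> cos (turn h a i) = cosang h a i /\
  sin (turn h a i) = sg i * Num.sqrt (1 - cosang h a i ^+ 2).
Proof.
move=> [_ /(_ i) /= /andP[c1 c2] _].
have cc : -1 <= cosang h a i <= 1 by rewrite !ltW.
rewrite /turn; have <- := sin_acos cc.
have ck : cos (acos (cosang h a i)) = cosang h a i by rewrite acosK // in_itv.
by rewrite /sgb; case: (eps i); rewrite ?mulN1r ?mul1r ?cosN ?sinN.
Qed.

Lemma cosangK h a i : height_dom (h, a) -> level_radius h i * level_radius h (ordS i) * cosang h a i = cos a - h 0 i * h 0 (ordS i).
Proof.
move=> hd; rewrite /cosang mulrC divfK // mulf_neq0 // gt_eqF //; exact: radius_gt0 hd.
Qed.

Lemma polygon_Bn h a (t : nat) : turn_dom (h, a) -> total_turn h a = 2 * pi * t%:R -> Bn (polygon h a).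
Proof.
move=> hd tt; have [hd1 hd2 /= ha] := hd; apply: Bn_intro => //= i; rewrite dotE.
  have [-> -> ->] := polygon_row h a i; have := radius_sqr i hd1; have := cos2Dsin2 (longitude h a i).
  move: (cos _) (sin _) (level_radius h i) (h 0 i) => c s r x cs r2.
  have -> : r * c * (r * c) + r * s * (r * s) + x * x = r ^+ 2 * (c ^+ 2 + s ^+ 2) + x ^+ 2 by ring.
  by rewrite cs r2; ring.
have [-> -> ->] := polygon_row h a i; have [-> -> ->] := polygon_row h a (ordS i).
have [-> ->] := longitude_next i tt; have := cosangK i hd1; have [<- _] := cos_turn i hd.
rewrite cosD sinD => E; have := cos2Dsin2 (longitude h a i); move: E.
move: (cos (longitude _ _ _)) (sin (longitude _ _ _)) (cos (turn _ _ _)) (sin (turn _ _ _)) => c s c' s' E cs.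
set r := level_radius h i in E *; set r' := level_radius h (ordS i) in E *.
have -> : r * c * (r' * (c * c' - s * s')) + r * s * (r' * (s * c' + c * s')) = r * r' * c' * (c ^+ 2 + s ^+ 2) by ring.
by rewrite cs mulr1 E subrK.
Qed.

Lemma sqrt_1Bsqr_gt0 (c : R) : -1 < c < 1 -> 0 < Num.sqrt (1 - c ^+ 2).
Proof. by move=> /andP[? ?]; rewrite sqrtr_gt0; nra. Qed.

(** Seen from the pole, edge [i] turns in the direction [eps i]: the other factors are positive on
    [turn_dom]. *)
Lemma polygon_cross h a (t : nat) i : turn_dom (h, a) -> total_turn h a = 2 * pi * t%:R ->
  cross (row i (polygon h a).1) (row (ordS i) (polygon h a).1) 0 o2 =
  sg i * (level_radius h i * level_radius h (ordS i) * Num.sqrt (1 - cosang h a i ^+ 2)).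
Proof.
move=> hd tt; have [hd1 hd2 /= ha] := hd.
have [c1 s1] := cos_turn i hd.
have -> : sg i * (level_radius h i * level_radius h (ordS i) * Num.sqrt (1 - cosang h a i ^+ 2)) =
  level_radius h i * level_radius h (ordS i) * sin (turn h a i) by rewrite s1 mulrCA.
have crossz (u v : 'rV[R]_3) : cross u v 0 o2 = u 0 o0 * v 0 o1 - u 0 o1 * v 0 o0.
  by rewrite mxE ordS2 ordS0.
rewrite crossz; have [-> -> _] := polygon_row h a i; have [-> -> _] := polygon_row h a (ordS i).
have [-> ->] := longitude_next i tt; rewrite cosD sinD.
have := cos2Dsin2 (longitude h a i).
move: (cos (longitude _ _ _)) (sin (longitude _ _ _)) (cos (turn _ _ _)) (sin (turn _ _ _)) => c s c' s' cs.
set r := level_radius h i; set r' := level_radius h (ordS i).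
have -> : r * c * (r' * (s * c' + c * s')) - r * s * (r' * (c * c' - s * s')) = r * r' * s' * (c ^+ 2 + s ^+ 2) by ring.
by rewrite cs mulr1.
Qed.

Lemma continuous_height i : continuous (fun p : 'rV[R]_n * R => p.1 0 i).
Proof.
move=> q; have C1 : {for q, continuous (fst : 'rV[R]_n * R -> 'rV[R]_n)} by exact: cvg_fst.
have C2 : {for q.1, continuous (fun M : 'rV[R]_n => M 0 i)} by exact: coord_continuous.
exact: (continuous_comp C1 C2).
Qed.

Lemma diff_times_height j i (O : set ('rV[R]_n * R)) : diff_times j (fun p : 'rV[R]_n * R => p.1 0 i) O.
Proof. by apply: diff_times_linear; [move=> k u v; rewrite !mxE|exact: continuous_height]. Qed.

Lemma diff_times_len j (O : set ('rV[R]_n * R)) : diff_times j (fun p : 'rV[R]_n * R => p.2) O.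
Proof. by apply: diff_times_linear; [move=> k u v|move=> q; exact: cvg_snd]. Qed.

Lemma open_of_near (T : topologicalType) (A : set T) : (forall x, A x -> \forall y \near x, A y) -> open A.
Proof. by move=> H; rewrite openE => x /H. Qed.

Lemma open_height_dom : open height_dom.
Proof.
apply: open_of_near => p hp.
suff K (i : 'I_n) : \forall q \near p, 0 < 1 - (q : 'rV[R]_n * R).1 0 i ^+ 2 by exact: filter_forall K.
have c : {for p, continuous (fun q : 'rV[R]_n * R => 1 - q.1 0 i ^+ 2)}.
  apply: cvgB; first exact: cvg_cst.
  have -> : (fun q : 'rV[R]_n * R => q.1 0 i ^+ 2) = (fun q => q.1 0 i * q.1 0 i) by apply/funext => q; rewrite expr2.
  by rewrite expr2; apply: cvgM; exact: continuous_height.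
exact: (near_preimage c (@open_gt R 0) (hp i)).
Qed.

Lemma diff_times_sqrt_comp (V : normedModType R) j (f : V -> R) (O : set V) : open O -> (forall x, O x -> 0 < f x) ->
  diff_times j f O -> diff_times j (fun x => Num.sqrt (f x)) O.
Proof. by move=> oO fO; apply: (diff_times_comp1 oO (@open_gt R 0) fO smooth_sqrt). Qed.

Lemma diff_times_inv_comp (V : normedModType R) j (f : V -> R) (O : set V) : open O -> (forall x, O x -> 0 < f x) ->
  diff_times j f O -> diff_times j (fun x => (f x)^-1) O.
Proof. by move=> oO fO; apply: (diff_times_comp1 oO (@open_gt R 0) fO smooth_inv). Qed.

Lemma diff_timesN (V : normedModType R) j (f : V -> R) (O : set V) : open O -> diff_times j f O -> diff_times j (fun x => - f x) O.
Proof.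
move=> oO df; apply: (diff_times_ext oO _ (diff_timesM oO (diff_times_cst j (-1 : R) O) df)) => y _.
by rewrite mulN1r.
Qed.

Lemma diff_timesB (V : normedModType R) j (f g : V -> R) (O : set V) : open O ->
  diff_times j f O -> diff_times j g O -> diff_times j (fun x => f x - g x) O.
Proof. by move=> oO df dg; apply: diff_timesD => //; exact: diff_timesN. Qed.

Lemma diff_times_radius j i : diff_times j (fun p : 'rV[R]_n * R => level_radius p.1 i) height_dom.
Proof.
have oH := open_height_dom.
apply: diff_times_sqrt_comp => //; apply: diff_timesB => //; first exact: diff_times_cst.
by apply: diff_timesM => //; exact: diff_times_height.
Qed.

Lemma diff_times_cosang j i : diff_times j (fun p : 'rV[R]_n * R => cosang p.1 p.2 i) height_dom.
Proof.
have oH := open_height_dom.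
apply: diff_timesM => //.
  apply: diff_timesB => //; last by apply: diff_timesM => //; exact: diff_times_height.
  by apply: (diff_times_comp1 oH openT _ smooth_cos (diff_times_len j _)).
apply: diff_times_inv_comp => //; last by apply: diff_timesM => //; exact: diff_times_radius.
by move=> [h a] hd; apply: mulr_gt0; exact: radius_gt0 hd.
Qed.

Lemma open_turn_dom : open turn_dom.
Proof.
apply: open_of_near => p [hp cp ap].
have H1 := open_near open_height_dom hp.
have H2 : \forall q \near p, forall i, -1 < cosang q.1 q.2 i < 1.
  suff K (i : 'I_n) : \forall q \near p, -1 < cosang (q : 'rV[R]_n * R).1 q.2 i < 1 by exact: filter_forall K.
  have [dc _] := diff_times_cosang 1 i.
  exact: (near_preimage (differentiable_continuous (dc p hp)) (@open_oo R (-1) 1) (cp i)).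
have H3 : \forall q \near p, 0 < q.2 < pi.
  have c : {for p, continuous (fun q : 'rV[R]_n * R => q.2)} by exact: cvg_snd.
  exact: (near_preimage c (@open_oo R 0 pi) ap).
by apply: filterS3 H1 H2 H3 => q.
Qed.

Lemma turn_sub_height : turn_dom `<=` height_dom. Proof. by move=> p []. Qed.

Lemma diff_times_turn j i : diff_times j (fun p : 'rV[R]_n * R => turn p.1 p.2 i) turn_dom.
Proof.
have oT := open_turn_dom.
apply: diff_timesM => //; first exact: diff_times_cst.
apply: (diff_times_comp1 oT (@open_oo R (-1) 1) _ smooth_acos).
  by move=> p [_ cp _]; exact: cp.
exact: diff_times_sub turn_sub_height (diff_times_cosang j i).
Qed.

Lemma diff_times_longitude j i : diff_times j (fun p : 'rV[R]_n * R => longitude p.1 p.2 i) turn_dom.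
Proof. by apply: diff_times_sum => [|k _]; [exact: open_turn_dom|exact: diff_times_turn]. Qed.

Lemma diff_times_total j : diff_times j (fun p : 'rV[R]_n * R => total_turn p.1 p.2) turn_dom.
Proof. by apply: diff_times_sum => [|k _]; [exact: open_turn_dom|exact: diff_times_turn]. Qed.

Lemma diff_times_polygon_entry j i k :
  diff_times j (fun p : 'rV[R]_n * R => (polygon p.1 p.2).1 i k) turn_dom.
Proof.
have oT := open_turn_dom.
have r : diff_times j (fun p : 'rV[R]_n * R => level_radius p.1 i) turn_dom.
  exact: diff_times_sub turn_sub_height (diff_times_radius j i).
have C := diff_timesM oT r (diff_times_comp1 oT openT (fun _ _ => I) smooth_cos (diff_times_longitude j i)).
have S := diff_timesM oT r (diff_times_comp1 oT openT (fun _ _ => I) smooth_sin (diff_times_longitude j i)).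
have [k0|k0] := boolP (k == o0); first by apply: (diff_times_ext oT _ C) => p _; rewrite mxE k0.
have [k1|k1] := boolP (k == o1); first by apply: (diff_times_ext oT _ S) => p _; rewrite mxE (negbTE k0) k1.
by apply: (diff_times_ext oT _ (diff_times_height j i _)) => p _; rewrite mxE (negbTE k0) (negbTE k1).
Qed.

(** Reduces smoothness of a map into configurations to that of its entries. *)
Lemma config_sum (q : config) : q = \sum_i \sum_k q.1 i k *: ((delta_mx i k, 0) : config) + q.2 *: ((0, 1) : config).
Proof.
have F : linear (fst : config -> 'M[R]_(n, 3)) by [].
have S : linear (snd : config -> R) by [].
have [LF eF] := lin_of F; have [LS eS] := lin_of S.
apply/eqP; rewrite -subr_eq0; apply/eqP.
have Z (r : config) : r.1 = 0 -> r.2 = 0 -> r = 0 by case: r => ? ? /= -> ->.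
apply: Z.
  rewrite -[_.1]/(fst _) eF linearB linearD /= linear_sum /=.
  under [X in _ - (X + _)]eq_bigr do rewrite linear_sum.
  under [X in _ - (X + _)]eq_bigr do under eq_bigr do rewrite linearZ.
  rewrite linearZ -!eF /= scaler0 addr0.
  by rewrite -matrix_sum_delta subrr.
rewrite -[_.2]/(snd _) eS linearB linearD /= linear_sum /= big1.
  by rewrite linearZ -!eS /= add0r -[_ *: _]/(_ * _) mulr1 subrr.
by move=> i _; rewrite linear_sum big1 // => k _; rewrite linearZ -eS /= scaler0.
Qed.

Lemma diff_times_polygon j (A : 'rV[R]_n -> R) (U : set 'rV[R]_n) : open U -> (forall h, U h -> turn_dom (h, A h)) ->
  diff_times j A U -> diff_times j (fun h => polygon h (A h)) U.
Proof.
move=> oU UT dA.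
have D : diff_times j (fun h => \sum_i \sum_k (polygon h (A h)).1 i k *: ((delta_mx i k, 0) : config)
   + A h *: ((0, 1) : config)) U.
  apply: diff_timesD => //; last exact: diff_timesZl.
  apply: diff_times_sum => // i _; apply: diff_times_sum => // k _; apply: diff_timesZl => //.
  have sE : smooth_on (fun p : 'rV[R]_n * R => (polygon p.1 p.2).1 i k) turn_dom by move=> j'; exact: diff_times_polygon_entry.
  exact: (diff_times_graph oU open_turn_dom UT sE dA).
by apply: (diff_times_ext oU _ D) => h _; rewrite [RHS]config_sum.
Qed.

End Sections.

(** * The edge length as a function of the heights *)

Section Implicit.
Context {R : realType} {n : nat}.
Notation config := (config R n).
Variable eps : 'I_n -> bool.
Implicit Types (h : 'rV[R]_n) (a : R).

Definition sign_sum : R := \sum_i sgb (eps i).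

Lemma height_dom0 a : height_dom (0 : 'rV[R]_n, a).
Proof. by move=> i; rewrite mxE expr0n /= subr0. Qed.

Lemma cosang0 a i : cosang (0 : 'rV[R]_n) a i = cos a.
Proof. by rewrite /cosang /level_radius !mxE mulr0 expr0n /= !subr0 sqrtr1 mulr1 divr1. Qed.

Lemma cos_lt1 a : 0 < a < pi -> -1 < cos a < 1.
Proof.
move=> /andP[a0 ap].
have h1 : cos pi < cos a by apply: ltr_cos_pi => //; exact: ltW.
have h2 : cos a < cos 0 by apply: ltr_cos_pi => //; exact: ltW.
by rewrite cospi in h1; rewrite cos0 in h2; rewrite h1.
Qed.

Lemma turn_dom0 a : 0 < a < pi -> turn_dom (0 : 'rV[R]_n, a).
Proof. by move=> ha; split=> //; [exact: height_dom0|move=> i; rewrite /= cosang0; exact: cos_lt1]. Qed.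

Lemma turn0 a i : 0 < a < pi -> turn eps (0 : 'rV[R]_n) a i = sgb (eps i) * a.
Proof. by move=> /andP[a0 ap]; rewrite /turn cosang0 cosK // in_itv /= !ltW. Qed.

Lemma total_turn0 a : 0 < a < pi -> total_turn eps (0 : 'rV[R]_n) a = sign_sum * a.
Proof. by move=> ha; rewrite /total_turn mulr_suml; apply: eq_bigr => i _; rewrite turn0. Qed.

(** At zero heights the total turn is [sign_sum * a], so its derivative in [a] is [sign_sum], whose
    positivity is what the implicit function theorem asks for. *)
Lemma implicit_length a0 (t : nat) : 0 < a0 < pi -> 0 < sign_sum -> sign_sum * a0 = 2 * pi * t%:R ->
  exists (U : set 'rV[R]_n) (eta : R) (A : 'rV[R]_n -> R),
    [/\ [/\ open U, U 0, 0 < eta & A 0 = a0], smooth_on A U &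
      forall h, U h -> [/\ turn_dom (h, A h), total_turn eps h (A h) = 2 * pi * t%:R, `|A h - a0| < eta &
        forall a, `|a - a0| < eta -> total_turn eps h a = 2 * pi * t%:R -> a = A h]].
Proof.
move=> ha ss st.
pose G (p : 'rV[R]_n * R) := total_turn eps p.1 p.2 - 2 * pi * t%:R.
have sG : smooth_on G turn_dom.
  move=> j; apply: diff_timesB; [exact: open_turn_dom|exact: diff_times_total|exact: diff_times_cst].
have G0 : G (0, a0) = 0 by rewrite /G /= total_turn0 // st subrr.
have dG : differentiable G (0, a0) by exact: smooth_on_differentiable sG (turn_dom0 ha).
have g0 : 'D_((0, 1) : 'rV[R]_n * R) G (0, a0) = sign_sum.
  rewrite -(is_deriveE (is_derive_slice dG)).
  have -> : 'D_(1:R) (fun a => G (0, a)) a0 = 'D_1 (fun a => a * sign_sum + (- (2 * pi * t%:R))) a0.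
    apply: near_eq_derive; apply: (open_near_eq (@open_oo R 0 pi) ha) => a aa.
    by rewrite /G /= total_turn0 // mulrC.
  have H := is_deriveD (is_deriveM (is_derive_id a0 (1:R)) (is_derive_cst sign_sum a0 (1:R))) (is_derive_cst (- (2 * pi * t%:R)) a0 (1:R)).
  rewrite (is_deriveE H) addr0 scaler0 add0r -[LHS]/(_ * _) mulr1 //.
have [|U [eta [A [UA sA AP]]]] := implicit_function open_turn_dom (turn_dom0 ha) sG G0; first by rewrite g0.
exists U, eta, A; split=> // h /AP[D1 D2 D3 D4]; split=> //.
  by apply/eqP; rewrite -subr_eq0; apply/eqP.
by move=> a ae ta; apply: D4 => //; rewrite /G /= ta subrr.
Qed.

End Implicit.

(* Derivative with respect to t^2 at t = 0. *)
Section EvenDerivative.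
Context {R : realType}.
Implicit Types (u v : R -> R) (d e k : R).

Definition even_derive u d : Prop := (fun t : R => (u t - u 0) / t ^+ 2) @ 0^' --> d.

Lemma even_derive_uniq u d d' : even_derive u d -> even_derive u d' -> d = d'.
Proof. by move=> H1 H2; exact: (cvg_unique _ H1 H2). Qed.

Lemma even_derive_eq u d d' : even_derive u d -> d = d' -> even_derive u d'.
Proof. by move=> H <-. Qed.

Lemma cvg_dnbhs_eq (f g : R -> R) (l : R) : (forall t, t != 0 -> f t = g t) ->
  f t @[t --> (0:R)^'] --> l -> g t @[t --> (0:R)^'] --> l.
Proof.
move=> fg; apply: cvg_trans; apply: near_eq_cvg.
have T0 : \forall t \near (0:R)^', t != 0 by exact: nbhs_dnbhs_neq.
by apply: filterS T0 => t t0; rewrite fg.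
Qed.

Lemma even_derive_ext u v d : (forall t, u t = v t) -> even_derive u d -> even_derive v d.
Proof. by move=> uv; have -> : u = v by apply/funext. Qed.

Lemma even_derive_near u v d : (\forall t \near (0:R), u t = v t) -> even_derive u d -> even_derive v d.
Proof.
move=> uv; apply: cvg_trans; apply: near_eq_cvg; apply: cvg_within.
by have e0 := nbhs_singleton uv; apply: filterS uv => t e; rewrite e e0.
Qed.

Lemma even_derive_cst k : even_derive (fun=> k) 0.
Proof.
rewrite /even_derive; have -> : (fun t : R => (k - k) / t ^+ 2) = cst 0 by apply/funext => t; rewrite subrr mul0r.
exact: cvg_cst.
Qed.

Lemma even_derive_sqr k : even_derive (fun t => t ^+ 2 * k) k.
Proof.
apply: (@cvg_dnbhs_eq (cst k)); last exact: cvg_cst.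
by move=> t t0; rewrite expr0n /= mul0r subr0 mulrC mulKf // expf_neq0.
Qed.

Lemma even_deriveD u v d e : even_derive u d -> even_derive v e -> even_derive (fun t => u t + v t) (d + e).
Proof.
move=> H1 H2; rewrite /even_derive.
have <- : ((fun t : R => (u t - u 0) / t ^+ 2) + (fun t : R => (v t - v 0) / t ^+ 2)) =
  (fun t => (u t + v t - (u 0 + v 0)) / t ^+ 2).
  by apply/funext => t; rewrite fctE -mulrDl; congr (_ * _); ring.
exact: (cvgD H1 H2).
Qed.

Lemma even_derive_cvg u d : even_derive u d -> u t @[t --> (0:R)^'] --> u 0.
Proof.
move=> H.
have S : (fun t : R => t ^+ 2) @ (0:R)^' --> (0 : R).
  have := @exprn_continuous R 2 0; rewrite /continuous_at expr0n /= => S.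
  exact: cvg_within_filter S.
have K : (fun t => (u t - u 0) / t ^+ 2 * t ^+ 2 + u 0) @ (0:R)^' --> d * 0 + u 0.
  exact: (cvgD (cvgM H S) (cvg_cst (u 0))).
rewrite mulr0 add0r in K; apply: cvg_dnbhs_eq K => t t0.
by rewrite divfK ?subrK // expf_neq0.
Qed.

Lemma even_deriveM u v d e : even_derive u d -> even_derive v e ->
  even_derive (fun t => u t * v t) (d * v 0 + u 0 * e).
Proof.
move=> H1 H2; rewrite /even_derive.
have <- : ((fun t : R => (u t - u 0) / t ^+ 2) * v) + (cst (u 0) * (fun t : R => (v t - v 0) / t ^+ 2)) =
  (fun t => (u t * v t - (u 0 * v 0)) / t ^+ 2).
  by apply/funext => t; rewrite !fctE /=; ring.
exact: (cvgD (cvgM H1 (even_derive_cvg H2)) (cvgM (cvg_cst (u 0)) H2)).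
Qed.

Lemma even_derive_comp (f : R -> R) u d k : is_derive (u 0) (1:R) f k -> even_derive u d ->
  even_derive (fun t => f (u t)) (k * d).
Proof.
move=> df H.
have Df := is_derive1_differentiable df.
(* The difference quotient of [f], extended by [k] at [u 0]: it is continuous there and avoids a
   division by zero at those [t] where [u t = u 0]. *)
pose q x := if x == u 0 then k else (f x - f (u 0)) / (x - u 0).
have cq : {for u 0, continuous q}.
  have q0 : q (u 0) = k by rewrite /q eqxx.
  apply/cvgrPdist_le => e e0; rewrite q0.
  have := differentiable_eps Df e0; rewrite (near_shift (u 0)) /= sub0r; apply: filterS => x /=.
  rewrite subrK -deriveE // (is_derive1_dir _ df) /q.
  have [->|ne] := eqVneq x (u 0); first by move=> _; rewrite subrr normr0 ltW.
  have ne0 : x - u 0 != 0 by rewrite subr_eq0.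
  move=> Hx; have -> : k - (f x - f (u 0)) / (x - u 0) = - (f x - f (u 0) - (x - u 0) * k) / (x - u 0) by field.
  by rewrite normrM normfV normrN ler_pdivrMr ?normr_gt0.
have C := cvg_comp _ _ (even_derive_cvg H) cq.
rewrite /even_derive; have <- : (q \o u) * (fun t : R => (u t - u 0) / t ^+ 2) = (fun t => (f (u t) - f (u 0)) / t ^+ 2).
  apply/funext => t; rewrite fctE /= /q; have [->|ne] := eqVneq (u t) (u 0); first by rewrite !subrr mul0r mulr0.
  by rewrite mulrA divfK // subr_eq0.
have qu : q (u 0) = k by rewrite /q eqxx.
by rewrite -qu; exact: (cvgM C H).
Qed.

Lemma even_derive_sum (I : Type) (r : seq I) (F : I -> R -> R) (d : I -> R) :
  (forall i, even_derive (F i) (d i)) -> even_derive (fun t => \sum_(i <- r) F i t) (\sum_(i <- r) d i).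
Proof.
move=> H; elim: r => [|i r IH].
  by rewrite big_nil; apply: even_derive_ext (even_derive_cst 0) => t; rewrite big_nil.
by rewrite big_cons; apply: even_derive_ext (even_deriveD (H i) IH) => t; rewrite big_cons.
Qed.

End EvenDerivative.

Section LinearMaps.
Context {R : realType}.

Lemma diff_times_mulmx j k l (M : 'M[R]_(k, l)) (O : set 'rV[R]_k) : open O -> diff_times j (fun z : 'rV[R]_k => z *m M) O.
Proof.
move=> oO; have D : diff_times j (fun z : 'rV[R]_k => \sum_i z 0 i *: row i M) O.
  apply: diff_times_sum => // i _; apply: diff_timesZl => //.
  by apply: diff_times_linear; [move=> a u v; rewrite !mxE|move=> z; exact: coord_continuous].
by apply: (diff_times_ext oO _ D) => z _; rewrite mulmx_sum_row.
Qed.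

Lemma mulmx_continuous k l (M : 'M[R]_(k, l)) : continuous (fun z : 'rV[R]_k => z *m M).
Proof.
move=> z; have [D _] := diff_times_mulmx 1 M openT.
exact: differentiable_continuous (D z I).
Qed.

Lemma diff_times_complin (V W U : normedModType R) j (L : V -> W) (f : W -> U) (O : set W) : open O -> linear L -> continuous L ->
  diff_times j f O -> diff_times j (fun x => f (L x)) (L @^-1` O).
Proof.
move=> oO lL cL; have oLO : open (L @^-1` O) by apply: open_comp => // x _; exact: cL.
have [M eM] := lin_of lL; rewrite eM in oLO cL *.
elim: j f => [//|j IH] f [df Df].
have dM x : differentiable M x by exact: linear_differentiable.
have dc x : O (M x) -> differentiable (fun y => f (M y)) x.
  by move=> /df dfx; apply: (@differentiable_comp _ _ _ _ M f).
split=> [x Ox|v]; first exact: dc.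
apply: (diff_times_ext oLO _ (IH _ (Df (M v)))) => x Ox; have dfx := df _ Ox.
rewrite [in RHS]deriveE; last exact: dc.
by rewrite deriveE // (@diff_comp _ _ _ _ M f) //= diff_lin.
Qed.

End LinearMaps.

(** * Recovering a polygon from its heights *)

Section Frame.
Context {R : realType} {n : nat}.
Notation config := (config R n).
Variable (eps : 'I_n -> bool) (i0 : 'I_n).
Hypothesis (i00 : nat_of_ord i0 = 0%N) (n2 : (1 < n)%N).
Implicit Types (h : 'rV[R]_n) (a : R) (q : config).
Local Notation sg i := (@sgb R (eps i)).

(** Heights over the plane of the first edge: on [Bn] the cross product has norm [sin q.2], and the
    sign orients the normal as in the standard polygon. A triple product is invariant under
    rotations, so these functions descend to orbits. *)
Definition heights q : 'rV[R]_n :=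
  \row_i (sg i0 * dot (cross (row i0 q.1) (row (ordS i0) q.1)) (row i q.1) / sin q.2).

Lemma heights_orbit p q : orbit p q -> heights q = heights p.
Proof.
move=> [A SA ->]; apply/rowP => i; rewrite !mxE /= !row_mul triple_SO3 //.
Qed.

Lemma heights_base q (i : 'I_n) : (i < 2)%N -> heights q 0 i = 0.
Proof.
move=> i2; rewrite mxE; have [->|->] : i = i0 \/ i = ordS i0.
    have [i1|i1] : (i = 0%N :> nat) \/ (i = 1%N :> nat) by case: (nat_of_ord i) i2 => [|[|]] //; [left|right].
      by left; apply: val_inj; rewrite /= i00.
    by right; apply: val_inj; rewrite /= i00 modn_small.
  by rewrite dot_crossl mulr0 mul0r.
by rewrite dot_crossr mulr0 mul0r.
Qed.

Lemma ordS_i0 : nat_of_ord (ordS i0) = 1%N.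
Proof. by rewrite /= i00 modn_small. Qed.

Lemma heights_polygon h a (t : nat) : turn_dom (h, a) -> total_turn eps h a = 2 * pi * t%:R ->
  (forall i : 'I_n, (i < 2)%N -> h 0 i = 0) -> heights (polygon eps h a) = h.
Proof.
move=> hd tt h0; have [hd1 hd2 /= ha] := hd.
have h00 : h 0 i0 = 0 by apply: h0; rewrite i00.
have h01 : h 0 (ordS i0) = 0 by apply: h0; rewrite ordS_i0.
have s0 : 0 < sin a by exact: sin_gt0_pi.
have c := polygon_cross i0 hd tt.
have r1 i : h 0 i = 0 -> level_radius h i = 1 by move=> hi; rewrite /level_radius hi expr0n /= subr0 sqrtr1.
have ca : cosang h a i0 = cos a by rewrite /cosang h00 h01 !r1 // mulr0 subr0 mulr1 divr1.
have sq : Num.sqrt (1 - cos a ^+ 2) = sin a by rewrite -sin2cos2 sqrtr_sqr gtr0_norm.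
rewrite ca sq !r1 // !mul1r in c.
have [_ _ z0] := polygon_row eps h a i0; have [_ _ z1] := polygon_row eps h a (ordS i0).
rewrite h00 in z0; rewrite h01 in z1.
set u := row i0 (polygon eps h a).1 in c z0 *; set v := row (ordS i0) _ in c z1 *.
have cx : cross u v 0 o0 = 0 by rewrite mxE ordS0 ordS1 z0 z1; ring.
have cy : cross u v 0 o1 = 0 by rewrite mxE ordS1 ordS2 z0 z1; ring.
apply/rowP => i; rewrite mxE -/u -/v dotE cx cy c /=.
have [_ _ ->] := polygon_row eps h a i.
rewrite !mul0r !add0r mulrA mulrA sgb_sqr mul1r mulrC mulrA mulVf ?mul1r // gt_eqF //.
Qed.

Lemma cos_eq1_near (x : R) (t : nat) : cos x = 1 -> `|x - 2 * pi * t%:R| < 2 * pi -> x = 2 * pi * t%:R.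
Proof.
move=> cx; have [ct st] := cos_nat2pi (R := R) t.
move=> H; apply/eqP; rewrite -subr_eq0; apply: contraT => ne.
have : cos `|x - 2 * pi * t%:R| = 1 by rewrite cos_norm cosB ct st mulr0 addr0 mulr1.
by move/eqP; rewrite (negbTE (cos_neq1 _)) // normr_gt0 ne.
Qed.

(** The horizontal projections of consecutive vertices have known lengths and a known inner product,
    [E1]; the sign of the vertical component of the cross product selects its value, [E2], and the
    two determine the next vertex. *)
Lemma frame_step q h i (th : R) : Bn q -> turn_dom (h, q.2) ->
  (forall i, row i q.1 0 o2 = h 0 i) ->
  0 < sg i * cross (row i q.1) (row (ordS i) q.1) 0 o2 ->
  row i q.1 0 o0 = level_radius h i * cos th -> row i q.1 0 o1 = level_radius h i * sin th ->
  row (ordS i) q.1 0 o0 = level_radius h (ordS i) * cos (th + turn eps h q.2 i) /\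
  row (ordS i) q.1 0 o1 = level_radius h (ordS i) * sin (th + turn eps h q.2 i).
Proof.
move=> Bq hd hz pos x0 y0; have [hd1 hd2 _] := hd.
have [ct st] := cos_turn eps i hd.
have c2 := sqrt_1Bsqr_gt0 (hd2 i); rewrite /= in c2.
have K := cosangK i hd1.
have rs := radius_sqr i hd1; have rs' := radius_sqr (ordS i) hd1.
have r0 := radius_gt0 i hd1; have r0' := radius_gt0 (ordS i) hd1.
have uu := Bn_unit i Bq; have vv := Bn_unit (ordS i) Bq; have uv := Bn_dot i Bq.
have cz : cross (row i q.1) (row (ordS i) q.1) 0 o2 = row i q.1 0 o0 * row (ordS i) q.1 0 o1 - row i q.1 0 o1 * row (ordS i) q.1 0 o0.
  by rewrite mxE ordS2 ordS0.
rewrite cz in pos; rewrite !dotE !hz in uu vv uv.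
have sgs := @sgb_sqr R (eps i).
have sqs : Num.sqrt (1 - cosang h q.2 i ^+ 2) ^+ 2 = 1 - cosang h q.2 i ^+ 2.
  by rewrite sqr_sqrtr //; apply: ltW; rewrite -sqrtr_gt0.
rewrite cosD sinD ct st; have cs := cos2Dsin2 th.
move: (row i q.1 0 o0) (row i q.1 0 o1) (row (ordS i) q.1 0 o0) (row (ordS i) q.1 0 o1) x0 y0 pos uu vv uv => x y x' y' x0 y0 pos uu vv uv.
move: (Num.sqrt (1 - _)) c2 sqs => S S0 S2.
move: (level_radius h i) (level_radius h (ordS i)) (cosang h q.2 i) (h 0 i) (h 0 (ordS i)) (cos q.2) (sgb _) (cos th) (sin th) r0 r0' rs rs' K S0 S2 sgs cs x0 y0 pos uu vv uv.
clear => r r' C z z' ca s c d r0 r0' rs rs' K S0 S2 sgs cs x0 y0 pos uu vv uv.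
have E1 : x * x' + y * y' = r * r' * C by rewrite K; lra.
have E2 : x * y' - y * x' = s * (r * r' * S).
  have P : s * (x * y' - y * x') = r * r' * S.
    have P2 : (s * (x * y' - y * x')) ^+ 2 = (r * r' * S) ^+ 2.
      have -> : (s * (x * y' - y * x')) ^+ 2 = (s * s) * ((x * x + y * y) * (x' * x' + y' * y') - (x * x' + y * y') ^+ 2) by ring.
      have xx : x * x + y * y = r ^+ 2 by lra.
      have xx' : x' * x' + y' * y' = r' ^+ 2 by lra.
      have -> : (r * r' * S) ^+ 2 = r ^+ 2 * r' ^+ 2 * S ^+ 2 by ring.
      by rewrite sgs E1 xx xx' S2; ring.
    have pos' : 0 < r * r' * S by rewrite !mulr_gt0.
    by apply/eqP; rewrite -(@eqrXn2 _ 2%N) ?(ltW pos) ?(ltW pos') // P2.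
  by rewrite -P mulrA sgs mul1r.
have F1 : c * x' + d * y' = r' * C.
  apply: (mulfI (lt0r_neq0 r0)); rewrite mulrA -E1 x0 y0; ring.
have F2 : c * y' - d * x' = s * (r' * S).
  apply: (mulfI (lt0r_neq0 r0)); have := E2; rewrite x0 y0 => E2'.
  have -> : r * (s * (r' * S)) = s * (r * r' * S) by ring.
  by rewrite -E2'; ring.
split.
  have -> : r' * (c * C - d * (s * S)) = c * (r' * C) - d * (s * (r' * S)) by ring.
  rewrite -F1 -F2; have -> : c * (c * x' + d * y') - d * (c * y' - d * x') = x' * (c ^+ 2 + d ^+ 2) by ring.
  by rewrite cs mulr1.
have -> : r' * (d * C + c * (s * S)) = d * (r' * C) + c * (s * (r' * S)) by ring.
rewrite -F1 -F2; have -> : d * (c * x' + d * y') + c * (c * y' - d * x') = y' * (c ^+ 2 + d ^+ 2) by ring.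
by rewrite cs mulr1.
Qed.

(** Induction along the vertices by [frame_step]; the last edge comes back to vertex 0, which makes
    the total turn a multiple of [2 pi]. *)
Lemma frame_polygon q h : Bn q -> turn_dom (h, q.2) ->
  row i0 q.1 = e1 -> (forall i, row i q.1 0 o2 = h 0 i) ->
  (forall i, 0 < sg i * cross (row i q.1) (row (ordS i) q.1) 0 o2) ->
  q = polygon eps h q.2 /\ cos (total_turn eps h q.2) = 1.
Proof.
move=> Bq hd q0 hz pos.
have r1 : level_radius h i0 = 1 by rewrite /level_radius -hz q0 mxE /= expr0n /= subr0 sqrtr1.
have step (k : nat) (kn : (k < n)%N) :
  row (Ordinal kn) q.1 0 o0 = level_radius h (Ordinal kn) * cos (longitude eps h q.2 k) /\
  row (Ordinal kn) q.1 0 o1 = level_radius h (Ordinal kn) * sin (longitude eps h q.2 k).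
  elim: k kn => [|k IH] kn.
    have -> : Ordinal kn = i0 by apply: val_inj; rewrite /= i00.
    by rewrite longitude0 cos0 sin0 q0 r1 !mxE /= mulr1 mulr0.
  have [x0 y0] := IH (ltnW kn).
  have := frame_step Bq hd hz (pos (Ordinal (ltnW kn))) x0 y0.
  have -> : ordS (Ordinal (ltnW kn)) = Ordinal kn by apply: val_inj; rewrite /= modn_small.
  by rewrite -(longitudeS eps h q.2 (Ordinal (ltnW kn))).
have rows (i : 'I_n) : row i q.1 0 o0 = level_radius h i * cos (longitude eps h q.2 i) /\
    row i q.1 0 o1 = level_radius h i * sin (longitude eps h q.2 i).
  by case: i => k kn; exact: step.
split.
  rewrite [LHS]surjective_pairing; congr pair; apply/matrixP => i.
  have [e f] := rows i; have := hz i; rewrite !mxE in e f * => g.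
  by apply: ord3P; rewrite mxE /= ?e ?f ?g.

have li : (n.-1 < n)%N by rewrite prednK // ltnW.
have [x0 y0] := rows (Ordinal li).
have := frame_step Bq hd hz (pos (Ordinal li)) x0 y0.
have -> : ordS (Ordinal li) = i0 by apply: val_inj; rewrite /= prednK ?modnn ?i00 // ltnW.
rewrite -(longitudeS eps h q.2 (Ordinal li)) /= prednK; last exact: ltnW.
by rewrite longitude_n q0 r1 !mul1r !mxE /= => -[<- _].
Qed.

End Frame.

(** * A chart around a degenerate orbit *)

Section StandardChart.
Context {R : realType} {n : nat}.
Notation config := (config R n).
Variable (eps : 'I_n -> bool) (i0 : 'I_n).
Hypothesis (i00 : nat_of_ord i0 = 0%N) (n3 : (2 < n)%N).
Implicit Types (h : 'rV[R]_n) (a : R) (q : config).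
Local Notation sg i := (@sgb R (eps i)).

Let n2 : (1 < n)%N. Proof. exact: ltnW. Qed.

(** Inserts two leading zeros, the normalisation of the heights; its transpose drops the first two
    entries. *)
Definition pad : 'M[R]_(n - 2, n) := \matrix_(i, j) ((j : nat) == i.+2)%:R.

Lemma mul_padT h (i : 'I_(n - 2)) (j : 'I_n) : nat_of_ord j = i.+2 -> (h *m pad^T) 0 i = h 0 j.
Proof.
move=> ji; rewrite mxE (bigD1 j) //= !mxE ji eqxx mulr1 big1 ?addr0 // => k ne.
by rewrite !mxE -ji (inj_eq val_inj) (negbTE ne) mulr0.
Qed.

Lemma mul_pad (z : 'rV[R]_(n - 2)) (i : 'I_(n - 2)) (j : 'I_n) : nat_of_ord j = i.+2 -> (z *m pad) 0 j = z 0 i.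
Proof.
move=> ji; rewrite mxE (bigD1 i) //= !mxE ji eqxx mulr1 big1 ?addr0 // => k ne.
by rewrite !mxE ji !eqSS (inj_eq val_inj) eq_sym (negbTE ne) mulr0.
Qed.

Lemma mul_pad0 (z : 'rV[R]_(n - 2)) (j : 'I_n) : (j < 2)%N -> (z *m pad) 0 j = 0.
Proof.
move=> j2; rewrite mxE big1 // => k _; rewrite mxE.
by case: eqP j2 => [->|] //; rewrite mulr0.
Qed.

Lemma padK (z : 'rV[R]_(n - 2)) : z *m pad *m pad^T = z.
Proof.
apply/rowP => i; have ij : (i.+2 < n)%N by have := ltn_ord i; lia.
by rewrite (@mul_padT _ i (Ordinal ij)) // (@mul_pad _ i).
Qed.

Lemma padTK h : (forall j : 'I_n, (j < 2)%N -> h 0 j = 0) -> h *m pad^T *m pad = h.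
Proof.
move=> h0; apply/rowP => j; have [j2|j2] := ltnP j 2; first by rewrite mul_pad0 // h0.
have ij : (j - 2 < n - 2)%N by have := ltn_ord j; lia.
have e : nat_of_ord j = (Ordinal ij).+2 by rewrite /=; lia.
by rewrite (mul_pad _ e) (mul_padT _ e).
Qed.

Lemma open_sin : open [set q : config | 0 < sin q.2].
Proof.
have c : continuous (fun q : config => sin q.2).
  move=> q; have c1 : {for q, continuous (snd : config -> R)} by exact: cvg_snd.
  have c2 : {for q.2, continuous (@sin R)} by exact: continuous_sin.
  exact: (continuous_comp c1 c2).
by apply: (@open_comp _ _ (fun q : config => sin q.2) [set x | 0 < x]) => [q _|]; [exact: c|exact: open_gt].
Qed.

Lemma diff_times_heights_entry j i : diff_times j (fun q => heights eps i0 q 0 i) [set q : config | 0 < sin q.2].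
Proof.
have oS := open_sin; set S := [set q : config | 0 < sin q.2] in oS *.
have E l k : diff_times j (fun q : config => row l q.1 0 k) S.
  by apply: (diff_times_ext oS _ (diff_times_entry j l k S)) => q _; rewrite mxE.
have D : diff_times j (fun q : config =>
  sg i0 * dot (cross (row i0 q.1) (row (ordS i0) q.1)) (row i q.1) * (sin q.2)^-1) S.
  apply: diff_timesM => //; last first.
    apply: diff_times_inv_comp => //.
    exact: (diff_times_comp1 oS openT (fun _ _ => I) smooth_sin (diff_times_snd j _)).
  apply: diff_timesM => //; first exact: diff_times_cst.
  have DM (f g : config -> R) : diff_times j f S -> diff_times j g S -> diff_times j (fun q : config => f q * g q) S by exact: diff_timesM.
  have C k : diff_times j (fun q : config => cross (row i0 q.1) (row (ordS i0) q.1) 0 k) S.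
    apply: (diff_times_ext oS _ (diff_timesB oS (DM _ _ (E i0 (ordS k)) (E (ordS i0) (ordS (ordS k))))
      (DM _ _ (E i0 (ordS (ordS k))) (E (ordS i0) (ordS k))))) => q _.
    by rewrite [RHS]mxE.
  apply: (diff_times_ext oS _ (diff_timesD oS (diff_timesD oS (DM _ _ (C o0) (E i o0)) (DM _ _ (C o1) (E i o1))) (DM _ _ (C o2) (E i o2)))).
  by move=> q _; rewrite dotE.
by apply: (diff_times_ext oS _ D) => q _; rewrite [RHS]mxE.
Qed.

Lemma diff_times_heights j : diff_times j (heights eps i0) [set q : config | 0 < sin q.2].
Proof.
have oS := open_sin; set S := [set q : config | 0 < sin q.2] in oS *.
have D : diff_times j (fun q : config => \sum_i heights eps i0 q 0 i *: (delta_mx 0 i : 'rV[R]_n)) S.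
  by apply: diff_times_sum => // i _; apply: diff_timesZl => //; exact: diff_times_heights_entry.
by apply: (diff_times_ext oS _ D) => q _; rewrite [RHS]row_sum_delta.
Qed.

Variables (a0 : R) (t : nat).
Hypotheses (ha : 0 < a0 < pi) (ss : 0 < @sign_sum R n eps) (st : sign_sum eps * a0 = 2 * pi * t%:R).

(** [critical] asks for at least one chart around the point. The coordinates of this one are the
    heights of all vertices but the first two. *)
Lemma standard_chart : exists2 c, @Xn_atlas R n c & dom c (orbit (polygon eps (0 : 'rV[R]_n) a0)).
Proof.
have [U [eta [A [[oU U0 eta0 A0] sA AP]]]] := implicit_length ha ss st.
pose S := [set q : config | 0 < sin q.2].
pose pg h := polygon eps h (A h).
pose iota (z : 'rV[R]_(n - 2)) := z *m pad.
have li : linear iota by move=> k u v; rewrite /iota mulmxDl scalemxAl.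
have ci : continuous iota by exact: mulmx_continuous.
pose Z := iota @^-1` U.
have oZ : open Z by apply: open_comp => // z _; exact: ci.
have iz (z : 'rV[R]_(n - 2)) (j : 'I_n) : (j < 2)%N -> iota z 0 j = 0 by exact: mul_pad0.
have spg : smooth_on pg U.
  by move=> j; apply: diff_times_polygon => // h /AP[].
have pgB h : U h -> Bn (pg h) by move=> /AP[D T _ _]; exact: polygon_Bn D T.
have hpg z : Z z -> heights eps i0 (pg (iota z)) = iota z.
  by move=> /AP[D T _ _]; apply: (heights_polygon i00 n2 D T); exact: iz.
pose crd x : 'rV[R]_(n - 2) := heights eps i0 (get x) *m pad^T.
have crdE q : crd (orbit q) = heights eps i0 q *m pad^T.
  by rewrite /crd (heights_orbit eps i0 (getI (orbit_refl q))).
have crdK z : Z z -> crd (orbit (pg (iota z))) = z.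
  by move=> Zz; rewrite crdE hpg // padK.
pose c : chart R (set config) (n - 2) := Chart [set orbit (pg (iota z)) | z in Z] crd (fun z => orbit (pg (iota z))).
have cZ : crd @` dom c = Z.
  apply/seteqP; split=> [y [x [z Zz <-] <-]|z Zz]; first by rewrite crdK.
  by exists (orbit (pg (iota z))); [exists z|rewrite crdK].
exists c; last first.
  exists 0; first by rewrite /Z /= /iota mul0mx.
  by rewrite /iota mul0mx /pg A0.
split.
- split; first by move=> x [z Zz <-]; exists (pg (iota z)) => //; exact: pgB.
  (* In order: a nonzero sine; heights where [A] is defined; a length in the interval where [A] is
     the unique solution; a total turn that can close up only with winding [t]; edge directions
     relative to the first edge as prescribed by [eps]. These are open conditions that cut out the
     domain on [Bn]. *)
  pose W := [set q : config | [/\ S q, U (heights eps i0 q) /\ turn_dom (heights eps i0 q, q.2), `|q.2 - a0| < eta,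
     `|total_turn eps (heights eps i0 q) q.2 - 2 * pi * t%:R| < 2 * pi &
     forall i, 0 < sg i0 * sg i * dot (cross (row i0 q.1) (row (ordS i0) q.1)) (cross (row i q.1) (row (ordS i) q.1))]].
  exists W.
    apply: open_of_near => q [Sq [Uq Dq] aq tq cq].
    have [dh _] := diff_times_heights 1.
    have ch : {for q, continuous (heights eps i0)} := differentiable_continuous (dh q Sq).
    have c2 : {for q, continuous (snd : config -> R)} by exact: cvg_snd.
    have chp : {for q, continuous (fun q : config => (heights eps i0 q, q.2))} by exact: (cvg_pair ch c2).
    have N1 := open_near open_sin Sq.
    have N2 := near_preimage ch oU Uq.
    have N3 := near_preimage chp open_turn_dom Dq.
    have N4 : \forall q' \near q, `|(q' : config).2 - a0| < eta.
      have c3 : {for q, continuous (fun q' : config => `|q'.2 - a0|)}.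
        by apply: cvg_norm; apply: cvgB; [exact: c2|exact: cvg_cst].
      exact: (near_preimage c3 (@open_lt R eta) aq).
    have N5 : \forall q' \near q, `|total_turn eps (heights eps i0 q') (q' : config).2 - 2 * pi * t%:R| < 2 * pi.
      have [dt _] := diff_times_total (R := R) eps 1.
      have c4 : {for (heights eps i0 q, q.2), continuous (fun p : 'rV[R]_n * R => total_turn eps p.1 p.2)}.
        exact: differentiable_continuous (dt _ Dq).
      have c5 := continuous_comp chp c4.
      have c6 : {for q, continuous (fun q' : config => `|total_turn eps (heights eps i0 q') q'.2 - 2 * pi * t%:R|)}.
        by apply: cvg_norm; apply: cvgB; [exact: c5|exact: cvg_cst].
      exact: (near_preimage c6 (@open_lt R (2 * pi)) tq).
    have N6 : \forall q' \near q, forall i, 0 < sg i0 * sg i *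
       dot (cross (row i0 (q' : config).1) (row (ordS i0) q'.1)) (cross (row i q'.1) (row (ordS i) q'.1)).
      suff K (i : 'I_n) : \forall q' \near q, 0 < sg i0 * sg i *
        dot (cross (row i0 (q' : config).1) (row (ordS i0) q'.1)) (cross (row i q'.1) (row (ordS i) q'.1)) by exact: filter_forall K.
      have ce k l : {for q, continuous (fun q' : config => row k q'.1 0 l)}.
        have -> : (fun q' : config => row k q'.1 0 l) = (fun q' : config => q'.1 k l) by apply/funext => q'; rewrite mxE.
        exact: continuous_entry.
      have cc k l : {for q, continuous (fun q' : config => cross (row k q'.1) (row (ordS k) q'.1) 0 l)}.
        have -> : (fun q' : config => cross (row k q'.1) (row (ordS k) q'.1) 0 l) =
          (fun q' : config => row k q'.1 0 (ordS l) * row (ordS k) q'.1 0 (ordS (ordS l)) - row k q'.1 0 (ordS (ordS l)) * row (ordS k) q'.1 0 (ordS l)).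
          by apply/funext => q'; rewrite [LHS]mxE.
        exact: (cvgB (cvgM (ce _ _) (ce _ _)) (cvgM (ce _ _) (ce _ _))).
      have cd : {for q, continuous (fun q' : config => sg i0 * sg i * dot (cross (row i0 q'.1) (row (ordS i0) q'.1)) (cross (row i q'.1) (row (ordS i) q'.1)))}.
        have -> : (fun q' : config => sg i0 * sg i * dot (cross (row i0 q'.1) (row (ordS i0) q'.1)) (cross (row i q'.1) (row (ordS i) q'.1))) =
          (fun q' : config => sg i0 * sg i * (cross (row i0 q'.1) (row (ordS i0) q'.1) 0 o0 * cross (row i q'.1) (row (ordS i) q'.1) 0 o0
             + cross (row i0 q'.1) (row (ordS i0) q'.1) 0 o1 * cross (row i q'.1) (row (ordS i) q'.1) 0 o1
             + cross (row i0 q'.1) (row (ordS i0) q'.1) 0 o2 * cross (row i q'.1) (row (ordS i) q'.1) 0 o2)).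
          by apply/funext => q'; rewrite dotE.
        exact: (cvgM (cvg_cst _) (cvgD (cvgD (cvgM (cc _ _) (cc _ _)) (cvgM (cc _ _) (cc _ _))) (cvgM (cc _ _) (cc _ _)))).
      exact: (near_preimage cd (@open_gt R 0) (cq i)).
    have FF := @nbhs_filter _ q.
    have M1 := filterI (filterI N1 N2) (filterI N3 N4); have M2 := filterI N5 N6.
    by apply: filterS2 (M1 _ _ _) (M2 _) => q' [[? ?] [? ?]] [? ?]; split.
  apply/seteqP; split=> q [Bq].
    move=> /= [z Zz oz]; split=> //.
    have oq : orbit (pg (iota z)) q by rewrite oz; exact: orbit_refl.
    have hq : heights eps i0 q = iota z by rewrite (heights_orbit eps i0 oq) hpg.
    have aq : q.2 = A (iota z) by rewrite (orbit_snd oq).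
    have [D T e u] := AP _ Zz.
    split; rewrite ?hq ?aq //.
    + exact: Bn_sin.
    + by rewrite T subrr normr0 mulr_gt0 // pi_gt0.
    + move=> i; have [B SB ->] := oq; rewrite /= !row_mul !cross_SO3 // dot_SO3 //.
      rewrite dotE; have h0 : iota z 0 i0 = 0 by apply: iz; rewrite i00.
      have h1 : iota z 0 (ordS i0) = 0 by apply: iz; rewrite (ordS_i0 i00 n2).
      have cz k := polygon_cross k D T.
      have [_ _ z0] := polygon_row eps (iota z) (A (iota z)) i0; have [_ _ z1] := polygon_row eps (iota z) (A (iota z)) (ordS i0).
      rewrite h0 in z0; rewrite h1 in z1.
      set P := (polygon eps (iota z) (A (iota z))).1 in cz z0 z1 *.
      have cx : cross (row i0 P) (row (ordS i0) P) 0 o0 = 0 by rewrite mxE ordS0 ordS1 z0 z1; ring.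
      have cy : cross (row i0 P) (row (ordS i0) P) 0 o1 = 0 by rewrite mxE ordS1 ordS2 z0 z1; ring.
      rewrite /pg -/P cx cy !mul0r !add0r !cz.
      have [D1 D2 _] := D.
      have pp k : 0 < level_radius (iota z) k * level_radius (iota z) (ordS k) * Num.sqrt (1 - cosang (iota z) (A (iota z)) k ^+ 2).
        by rewrite !mulr_gt0 ?(radius_gt0 _ D1) //; apply: sqrt_1Bsqr_gt0; exact: D2.
      have := mulr_gt0 (pp i0) (pp i).
      have e0 := @sgb_sqr R (eps i0); have e1' := @sgb_sqr R (eps i).
      move: (level_radius _ i0 * _ * _) (level_radius _ i * _ * _) (sgb (eps i0)) (sgb (eps i)) e0 e1' => x y s s' e0 e1' xy.
      have -> // : s * s' * (s * x * (s' * y)) = x * y.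
      by rewrite -[RHS]mul1r -[RHS]mul1r -{1}e0 -e1'; ring.
  move=> [Sq [Uq Dq] aq tq cq]; split=> //=.
  have s0 : 0 < sin q.2 by [].
  set u := row i0 q.1 in cq; set N := cross u (row (ordS i0) q.1) in cq.
  (* The oriented unit normal of the plane of the first edge. Once the first vertex and [nu] are
     rotated to [e1] and [e3], the heights are the third coordinates. *)
  pose nu := (sg i0 / sin q.2) *: N.
  have uu : dot u u = 1 by exact: Bn_unit.
  have NN : dot N N = sin q.2 ^+ 2.
    by rewrite dot_cross_cross !Bn_unit // Bn_dot // mulr1 sin2cos2.
  have nn : dot nu nu = 1.
    rewrite dotZl dotZr NN; have := @sgb_sqr R (eps i0); move: (sgb _) => s ss1.
    have -> : s / sin q.2 * (s / sin q.2 * sin q.2 ^+ 2) = s * s by field; rewrite gt_eqF.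
    by [].
  have nu0 : dot nu u = 0 by rewrite dotZl dot_crossl mulr0.
  have [B [SB Bu Bnu]] := frame_maps uu nn nu0.
  pose q' : config := (q.1 *m B^T, q.2).
  have oq : orbit q q' by exact: orbit_act.
  have Bq' : Bn q' by exact: Bn_act.
  have hz i : row i q'.1 0 o2 = heights eps i0 q 0 i.
    have -> : row i q'.1 0 o2 = dot (row i q'.1) e3.
      by rewrite dotE !mxE /= !mulr0 !add0r mulr1.
    rewrite -Bnu row_mul dot_SO3 // mxE -/u -/N dotC dotZl; ring.
  have pos i : 0 < sg i * cross (row i q'.1) (row (ordS i) q'.1) 0 o2.
    have -> : cross (row i q'.1) (row (ordS i) q'.1) 0 o2 = dot (cross (row i q'.1) (row (ordS i) q'.1)) e3.
      by rewrite [RHS]dotE ![e3 _ _]mxE /= !mulr0 !add0r mulr1.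
    rewrite -Bnu !row_mul cross_SO3 // dot_SO3 // dotC dotZl.
    have := divr_gt0 (cq i) s0; rewrite -/u -/N.
    move: (sgb (eps i0)) (sgb (eps i)) (dot _ _) (sin q.2) => s s' d x.
    by have -> : s' * (s / x * d) = s * s' * d / x by ring.
  have [E T] := frame_polygon i00 n2 (h := heights eps i0 q) Bq' Dq (etrans (row_mul _ _ _) Bu) hz pos.
  have [_ _ _ uniq] := AP _ Uq.
  (* Closing up makes the total turn a multiple of [2 pi], proximity to [2 pi t] fixes the multiple,
     and uniqueness within [eta] gives the length. *)
  have aA : q.2 = A (heights eps i0 q) by apply: uniq => //; exact: cos_eq1_near.
  exists (heights eps i0 q *m pad^T).
    by rewrite /Z /= /iota padTK //; exact: (heights_base _ i00 n2).
  rewrite /iota padTK; last exact: (heights_base _ i00 n2).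
  by rewrite -(orbit_eq oq) [in RHS]E /pg -aA.
- by rewrite /= cZ.
- by move=> x /= [z Zz <-]; rewrite crdK.
- move=> q [Bq dq]; exists S, (fun q => heights eps i0 q *m pad^T); split.
  + exact: open_sin.
  + exact: Bn_sin.
  + move=> j.
    have DD : diff_times j (fun q : config => \sum_i heights eps i0 q 0 i *: row i pad^T) S.
      apply: diff_times_sum; [exact: open_sin|move=> i _].
      apply: diff_timesZl; first exact: open_sin.
      exact: diff_times_heights_entry.
    by apply: (diff_times_ext open_sin _ DD) => r _; rewrite mulmx_sum_row.
  + by move=> r [Br dr] Sr /=; rewrite crdE.
- move=> y; rewrite -/c cZ => Zy; exists Z, (fun z => pg (iota z)); split; rewrite -?/c ?cZ //.
    move=> j; exact: (diff_times_complin oU li ci (spg j)).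
  by move=> z Zz; split=> //; exact: pgB.
Qed.

End StandardChart.

(** * The Hessian of mu *)

Section Hessian.
Context {R : realType} {n : nat}.
Notation config := (config R n).
Variable eps : 'I_n -> bool.
Implicit Types (h : 'rV[R]_n) (c : chart R (set config) (n - 2)).
Local Notation sg i := (@sgb R (eps i)).

Definition heightform (k : R) h : R := \sum_i edgeform k (eps i) (h 0 i) (h 0 (ordS i)).

Lemma even_derive_radius h i : even_derive (fun t => level_radius (t *: h) i) (- 2^-1 * h 0 i ^+ 2).
Proof.
have u0 : 1 + (0 : R) ^+ 2 * (- h 0 i ^+ 2) = 1 by rewrite expr0n mul0r addr0.
have D : is_derive (1 + (0 : R) ^+ 2 * (- h 0 i ^+ 2)) (1:R) Num.sqrt (2^-1).
  have := @is_derive1_sqrt R 1 ltr01; rewrite u0 sqrtr1 mulr1; exact.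
have := even_derive_comp D (even_deriveD (@even_derive_cst R 1) (@even_derive_sqr R (- h 0 i ^+ 2))).
rewrite add0r mulrN mulNr; apply: even_derive_ext => t.
by rewrite /level_radius mxE exprMn mulrN.
Qed.

Lemma level_radius0 i : level_radius (0 : 'rV[R]_n) i = 1.
Proof. by rewrite /level_radius mxE expr0n subr0 sqrtr1. Qed.

Lemma even_derive_cosang h (u : R -> R) q i : even_derive u q ->
  even_derive (fun t => cosang (t *: h) (u t) i)
    (- (sin (u 0) * q + (h 0 i * h 0 (ordS i) - cos (u 0) / 2 * (h 0 i ^+ 2 + h 0 (ordS i) ^+ 2)))).
Proof.
move=> uq.
have C := even_derive_comp (is_derive_cos (u 0)) uq.
have N := even_deriveD C (@even_derive_sqr R (- (h 0 i * h 0 (ordS i)))).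
have P := even_deriveM (@even_derive_radius h i) (@even_derive_radius h (ordS i)).
have P0 : level_radius (0 *: h) i * level_radius (0 *: h) (ordS i) = 1 by rewrite scale0r !level_radius0 mulr1.
have D : is_derive (level_radius (0 *: h) i * level_radius (0 *: h) (ordS i)) (1:R) (fun x => x^-1) (-1).
  rewrite P0; have := is_deriveV (oner_neq0 R : id (1:R) != 0) (is_derive_id (1:R) (1:R)).
  by rewrite expr1n invr1 scaleN1r.
have V := even_derive_comp D P.
have := even_deriveM N V; rewrite /= P0 scale0r !level_radius0 expr0n /= mul0r addr0 invr1 !mulr1 !mul1r => F.
apply: even_derive_eq (even_derive_ext _ F) _ => [t|].
  by rewrite /cosang !mxE; congr (_ / _); congr (_ + _); ring.
by move: (sin _) (cos _) (h 0 i) (h 0 (ordS i)) => s k x y; field.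
Qed.

(** The total turn is constant along the ray, so its derivative with respect to [t^2] vanishes; the
    factor [1 / sin a0] from the derivative of [acos] is cleared by multiplication. *)
Lemma even_length h (u : R -> R) (a0 w q : R) : 0 < a0 < pi -> u 0 = a0 ->
  (\forall t \near (0:R), total_turn eps (t *: h) (u t) = w) -> even_derive u q ->
  sign_sum eps * sin a0 * q = - heightform (cos a0) h.
Proof.
move=> ha u0 tt uq.
have s0 : 0 < sin a0 by exact: sin_gt0_pi.
have T i := even_derive_cosang (h:=h) (i:=i) uq.
have c0 i : cosang (0 *: h) (u 0) i = cos a0 by rewrite scale0r cosang0 u0.
have D i : is_derive (cosang (0 *: h) (u 0) i) (1:R) (@acos R) (- (sin a0)^-1).
  rewrite c0; have := is_derive1_acos (cos_lt1 ha).
  by rewrite -sin2cos2 sqrtr_sqr gtr0_norm.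
have A i := even_deriveM (even_derive_cst (sg i)) (even_derive_comp (D i) (T i)).
have S := @even_derive_sum R _ (index_enum 'I_n) _ _ A.
have S0 : even_derive (fun t => \sum_i sg i * acos (cosang (t *: h) (u t) i)) 0.
  apply: even_derive_near (@even_derive_cst R w).
  by apply: filterS tt => t <-.
have := even_derive_uniq S S0; rewrite u0 => E.
have : sin a0 * (\sum_(i : 'I_n) (0 * acos (cosang (0 *: h) a0 i) +
  sg i * (- (sin a0)^-1 * - (sin a0 * q + (h 0 i * h 0 (ordS i) - cos a0 / 2 * (h 0 i ^+ 2 + h 0 (ordS i) ^+ 2)))))) = 0.
  by rewrite E mulr0.
rewrite mulr_sumr (eq_bigr (fun i => sg i * sin a0 * q + edgeform (cos a0) (eps i) (h 0 i) (h 0 (ordS i)))); last first.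
  move=> i _; rewrite /edgeform; move: s0 (acos _) (sg i) (cos a0) (h 0 i) (h 0 (ordS i)).
  by move: (sin a0) => s s0 z e k x y; field; rewrite gt_eqF.
rewrite big_split /= -!mulr_suml -/(sign_sum eps) -/(heightform _ h) => /eqP.
by rewrite addr_eq0 => /eqP.
Qed.

Lemma config_linear_continuous (W : normedModType R) (l : config -> W) : linear l -> continuous l.
Proof.
move=> ll; have [L ->] := lin_of ll.
have D : diff_times 1 (fun q : config => \sum_i \sum_k q.1 i k *: L ((delta_mx i k, 0) : config) + q.2 *: L ((0, 1) : config)) setT.
  apply: diff_timesD; first exact: openT.
    apply: diff_times_sum => [|i _]; first exact: openT.
    apply: diff_times_sum => [|k _]; first exact: openT.
    by apply: diff_timesZl; [exact: openT|exact: diff_times_entry].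
  by apply: diff_timesZl; [exact: openT|exact: diff_times_snd].
have [dL _] : diff_times 1 L setT.
  apply: (diff_times_ext openT _ D) => q _; rewrite [in RHS](config_sum q) linearD linear_sum linearZ.
  by congr (_ + _); apply: eq_bigr => i _; rewrite linear_sum; apply: eq_bigr => k _; rewrite linearZ.
by move=> q; exact: differentiable_continuous (dL q I).
Qed.

Lemma smooth_on_snd (V : normedModType R) (s : V -> config) (O : set V) : open O -> smooth_on s O ->
  smooth_on (fun z => (s z).2) O.
Proof.
move=> oO ss j; elim: j s ss => [//|j IH] s ss.
have ds z : O z -> differentiable s z by exact: smooth_on_differentiable.
split=> [z Oz|v]; first exact: (derive_snd 0 (ds z Oz)).1.
apply: (diff_times_ext oO _ (IH _ (smooth_on_derive v ss))) => z Oz.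
by rewrite (derive_snd v (ds z Oz)).2.
Qed.

Lemma polygon_great_circle a : in_great_circle (e3 : 'rV[R]_3) (polygon eps (0 : 'rV[R]_n) a).1.
Proof.
split; first by rewrite /sphere /= dotE !mxE /= !mulr0 !add0r mulr1.
by move=> i; rewrite dotE !mxE /= !mul0r mulr0 !addr0.
Qed.

Variables (a0 : R) (t : nat).
Hypotheses (on : odd n) (ha : 0 < a0 < pi) (ss : 0 < @sign_sum R n eps) (st : sign_sum eps * a0 = 2 * pi * t%:R).
Let x0 := orbit (polygon eps (0 : 'rV[R]_n) a0).

(** [M] is the differential at 0 of the map from all [n] heights to the coordinates of the given
    chart. Along a ray of heights, [mu] is expanded once in the chart by [second_order_curve] and
    once from the closing condition by [even_length]. *)
Lemma hessian_heights c : Xn_atlas c -> dom c x0 ->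
  (hess (@mu R n \o param c) (coord c x0))^T = hess (@mu R n \o param c) (coord c x0) /\
  exists M : 'M[R]_(n, n - 2), forall h,
    sign_sum eps * sin a0 * (2^-1 * qform (hess (@mu R n \o param c) (coord c x0)) (h *m M)) = - heightform (cos a0) h.
Proof.
move=> ac dx; have [Q [s [W [g [[oQ Qy0 sms sB] [os0 mus] [oW Wy0 dg] gs gW]]]]] := chart_data ac dx.
set y0 := coord c x0 in Qy0 os0 Wy0 dg *; set f := @mu R n \o param c.
have [U [eta [A [[oU U0 eta0 A0] sA AP]]]] := implicit_length ha ss st.
have sf : smooth_on f Q.
  by apply: (smooth_on_ext oQ _ (smooth_on_snd oQ sms)) => z /mus.
have ndf : \forall z \near y0, differentiable f z.
  by apply: filterS (open_near oQ Qy0) => z; exact: smooth_on_differentiable.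
have ddf i : differentiable ('D_(delta_mx 0 i) f) y0.
  exact: smooth_on_differentiable (smooth_on_derive (delta_mx 0 i) sf) Qy0.
have f0 i : 'D_(delta_mx 0 i) f y0 = 0.
  exact: degenerate_derive on ac dx (orbit_refl _) (polygon_great_circle a0).
split.
  by apply/matrixP => i j; rewrite !mxE; apply: derive_comm.
have [B SB sy] : orbit (polygon eps 0 a0) (s y0) by rewrite -/x0 -os0; exact: orbit_refl.
(* The standard polygon and the representative [s y0] chosen by the chart differ by the rotation
   [B]; it carries polygons near the former into the set [W] where [g] computes the coordinates. *)
pose act (q : config) : config := (q.1 *m B^T, q.2).
have lact : linear act by move=> k u v; rewrite /act /= mulmxDl -scalemxAl.
have cact := config_linear_continuous lact.
pose pg h := polygon eps h (A h).
have dpg : differentiable pg 0.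
  have [] // := @diff_times_polygon R n eps 1 A U oU _ (sA 1); last by move=> D _; exact: D.
  by move=> h /AP[].
pose st' h := act (pg h).
have dst : differentiable st' 0 := (derive_linear_comp 0 lact cact dpg).1.
have st0 : st' 0 = s y0 by rewrite /st' /pg A0 sy.
have dg' : differentiable g (st' 0) by rewrite st0.
have dgs : differentiable (fun h => g (st' h)) 0 by exact: (@differentiable_comp _ _ _ _ st' g).
have g0 : g (st' 0) = y0 by rewrite st0 gs.
pose L : {linear 'rV[R]_n -> 'rV[R]_(n - 2)} := 'd (fun h => g (st' h)) 0.
exists (lin1_mx L) => h; rewrite mul_rV_lin1.
pose y (r : R) := g (st' (0 + r *: h)).
have dgs0 : differentiable (fun h => g (st' h)) (0 + (0:R) *: h) by rewrite scale0r addr0.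
have Dy := is_derive_line dgs0.
have y00 : y 0 = y0 by rewrite /y scale0r addr0.
have DyE : 'D_1 y 0 = L h by rewrite (is_deriveE Dy) scale0r addr0 deriveE.
have dy : differentiable y 0.
  apply/derivable1_diffP; exact: ex_derive.
have K : even_derive (fun r => f (y r)) (2^-1 * qform (hess f y0) (L h)).
  by rewrite -DyE -y00; apply: second_order_curve; rewrite ?y00.
have cl : {for (0:R), continuous (fun r : R => r *: h)}.
  by have := @scalel_continuous R _ h 0.
have NU : \forall r \near (0:R), U (r *: h).
  by apply: (near_preimage cl oU); rewrite scale0r.
apply: (even_length (u := fun r => A (r *: h)) (w := 2 * pi * t%:R) ha).
- by rewrite scale0r.
- by apply: filterS NU => r /AP[].
apply: even_derive_near K.
have NW : \forall r \near (0:R), W (st' (r *: h)).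
  have cst' : {for 0 *: h, continuous st'} by rewrite scale0r; exact: differentiable_continuous.
  apply: (near_preimage (continuous_comp cl cst') oW).
  by rewrite /= scale0r st0.
apply: filterS2 NU NW => r Ur Wr.
have Bq : Bn (st' (r *: h)).
  by apply: Bn_act => //; have [D T _ _] := AP _ Ur; exact: polygon_Bn D T.
have [gE dE] := gW _ Bq Wr.
rewrite /y add0r gE /f /=; have [_ _ ck _ _] := ac.
by rewrite ck // mu_orbit.
Qed.

(** Passes from linear families of functions on [nat] to rows of heights; their periodicity takes
    care of the edge from the last vertex to the first. *)
Lemma definite_rows k sigma p : definite_dim k sigma [seq eps i | i <- enum 'I_n] p ->
  exists M : 'M[R]_(p, n), forall v : 'rV_p, v != 0 -> 0 < sigma * heightform k (v *m M).
Proof.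
move=> [L [Llin Lper Lpos]]; set s := [seq _ | _ <- _] in Lper Lpos.
have ns : size s = n by rewrite size_map size_enum_ord.
exists (\matrix_(l, i) L (delta_mx 0 l) i) => v v0.
have L0 j : L 0 j = 0.
  by have := Llin 1 0 0 j; rewrite scaler0 addr0 mul1r => /eqP; rewrite -subr_eq0 opprD addrA subrr sub0r oppr_eq0 => /eqP.
have LE (i : 'I_n) : (v *m \matrix_(l, i) L (delta_mx 0 l) i) 0 i = L v i.
  rewrite mxE [in RHS](row_sum_delta v).
  have -> : L (\sum_j v 0 j *: delta_mx 0 j) i = \sum_j v 0 j * L (delta_mx 0 j) i.
    by elim/big_ind2: _ => // [a x b' y <- <-|j _]; [have := Llin 1 x y i; rewrite scale1r mul1r|rewrite -[_ *: _]addr0 Llin L0 addr0].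
  by apply: eq_bigr => j _; rewrite mxE.
have := Lpos v v0; rewrite pathformE ns.
have -> // : \sum_(i < n) edgeform k (nth true s i) (L v i) (L v i.+1) = heightform k (v *m \matrix_(l, i) L (delta_mx 0 l) i).
apply: eq_bigr => i _; rewrite !LE (nth_map i) ?size_enum_ord // nth_ord_enum /=.
have [lt|ge] := ltnP i.+1 n; first by rewrite modn_small.
have e : i.+1 = n by apply/eqP; rewrite eqn_leq ge ltn_ord.
by rewrite e modnn -[in RHS]Lper ns.
Qed.

Lemma sign_sumE : sign_sum eps = #|[pred i | eps i]|%:R - #|[pred i | ~~ eps i]|%:R :> R.
Proof.
rewrite /sign_sum (bigID eps) /= (eq_bigr (fun=> 1)) => [|i ei]; last by rewrite /sgb ei.
rewrite sumr_const [X in _ + X](eq_bigr (fun=> -1)) => [|i /negbTE ei]; last by rewrite /sgb ei.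
by rewrite sumr_const mulNrn.
Qed.

End Hessian.

Definition standard_length {R : realType} (al t : nat) : R := 2 * pi * t%:R / al%:R.

Lemma standard_length_itv (R : realType) (al t : nat) : (0 < t)%N -> (2 * t < al)%N ->
  0 < (standard_length al t : R) < pi.
Proof.
move=> t0 ta; have alN : (0 < al)%N by lia.
have al0 : 0 < al%:R :> R by rewrite ltr0n.
rewrite /standard_length divr_gt0 ?mulr_gt0 ?pi_gt0 ?ltr0n //=.
by rewrite ltr_pdivrMr // mulrAC mulrC -natrM ltr_pM2l ?pi_gt0 ?ltr_nat //; lia.
Qed.

(* al and b stand for f - b and b, and 2 t for beta; eps i says that edge i is a forward-track. *)
Definition standard_signs {n : nat} (eps : 'I_n -> bool) (al b t : nat) : Prop :=
  [/\ #|[pred i | eps i]| = (al + b)%N, #|[pred i | ~~ eps i]| = b, (0 < t)%N & (2 * t < al)%N].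

Definition standard_orbit {R : realType} {n : nat} (eps : 'I_n -> bool) (al t : nat) : set (config R n) :=
  orbit (polygon eps (0 : 'rV[R]_n) (standard_length al t)).

(** * Index at a standard degenerate orbit *)

Section MorseIndex.
Context {R : realType} {n : nat}.
Notation config := (config R n).
Variables (eps : 'I_n -> bool) (al b t : nat).
Hypothesis sg : standard_signs eps al b t.

Lemma standard_itv : 0 < (standard_length al t : R) < pi.
Proof. by have [_ _ t0 ta] := sg; exact: standard_length_itv. Qed.

Lemma standard_sign_sum : sign_sum eps = al%:R :> R.
Proof. by have [cf cb _ _] := sg; rewrite sign_sumE cf cb natrD addrK. Qed.

Lemma standard_sign_sum_gt0 : 0 < sign_sum eps :> R.
Proof. by have [_ _ t0 ta] := sg; rewrite standard_sign_sum ltr0n; lia. Qed.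

Lemma standard_closing : sign_sum eps * standard_length al t = 2 * pi * t%:R :> R.
Proof. by have := standard_sign_sum_gt0; rewrite standard_sign_sum => al0; rewrite mulrC divfK // gt_eqF. Qed.

Lemma standard_signs_n : n = (al + b + b)%N.
Proof.
have [cf cb _ _] := sg; rewrite -[LHS](card_ord n) -(cardC [pred i | eps i]) cf; congr addn.
by rewrite -[RHS]cb; apply: eq_card.
Qed.

Lemma standard_morse (c : chart R (set config) (n - 2)) : odd n -> (2 < n)%N -> Xn_atlas c ->
  dom c (standard_orbit eps al t) ->
  hessian (@mu R n) c (standard_orbit eps al t) \in unitmx /\
  max_negative_dim (hessian (@mu R n) c (standard_orbit eps al t)) (b + (2 * t - 1)).
Proof.
move=> on n3 ac dx; have ha := standard_itv; have ss := standard_sign_sum_gt0.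
have [cf cb t0 ta] := sg; have nE := standard_signs_n.
have [sy [M ME]] := hessian_heights on ha ss standard_closing ac dx.
have [Dp Dm] := @definite_dim_forward R al t t0 ta; rewrite -/(standard_length al t) in Dp Dm.
have ct : count_mem true [seq eps i | i <- enum 'I_n] = (al + b)%N.
  rewrite -cf count_map -sum1_count big_enum_cond /= -sum1_card.
  by apply: eq_bigl => i; rewrite !inE eqb_id.
have cF : count_mem false [seq eps i | i <- enum 'I_n] = b.
  rewrite -cb count_map -sum1_count big_enum_cond /= -sum1_card.
  by apply: eq_bigl => i; rewrite !inE eqbF_neg.
have alN : (0 < al)%N by lia.
have [Mp Pp] := definite_rows (definite_dim_count (expr1n R 2) alN Dp ct cF).
have m1 : (-1 : R) ^+ 2 = 1 by rewrite sqrrN expr1n.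
have [Mm Pm] := definite_rows (definite_dim_count m1 alN Dm ct cF).
have s0 : 0 < sign_sum eps * sin (standard_length al t) :> R.
  by rewrite mulr_gt0 //; exact: sin_gt0_pi.
(* The Hessian form is a negative multiple of the height form, so a space on which the latter is
   positive counts for the index. *)
have key (e : R) (F Q : R) : e ^+ 2 = 1 -> sign_sum eps * sin (standard_length al t) * (2^-1 * Q) = - F -> 0 < e * F -> 0 < - e * Q.
  move: (_ * sin _) s0 => k k0 s2 E; rewrite -(opprK F) -E mulrN -mulNr mulrCA pmulr_rgt0 // mulrCA pmulr_rgt0 //.
(* The [al - 2] frequencies outside the kernel and the [2 b] dimensions of the hyperbolic planes
   fill [n - 2]. *)
have dims : (b + (2 * t - 1) + (b + (al - 1 - 2 * t)) = n - 2)%N by lia.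
apply: (index_of_splitting (M := Mp *m M) (N := Mm *m M) dims sy) => v v0; rewrite mulmxA.
  exact: (key 1 _ _ (expr1n R 2) (ME _) (Pp v v0)).
by have := key (-1) _ _ m1 (ME _) (Pm v v0); rewrite opprK.
Qed.

End MorseIndex.

(** * Critical orbits and the pairs (alpha, beta) *)

Section Standardization.
Context {R : realType} {n : nat}.
Notation config := (config R n).
Hypothesis n2 : (1 < n)%N.
Implicit Types (p q : config) (x : set config) (nu : 'rV[R]_3) (eps : 'I_n -> bool) (a : R).

Let i0 : 'I_n := Ordinal (ltnW n2).

Lemma sgb_inj : injective (@sgb R).
Proof. by move=> [] [] //; rewrite /sgb => H; exfalso; lra. Qed.

Lemma sgbN b : sgb (~~ b) = - sgb b :> R.
Proof. by case: b; rewrite /sgb ?opprK. Qed.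

Lemma cos_eq1 (y : R) : 0 < y -> cos y = 1 -> exists t : nat, y = 2 * pi * t%:R.
Proof.
move=> y0 cy; have pp : 0 < 2 * pi :> R by rewrite mulr_gt0 // pi_gt0.
have /truncn_itv/andP[] : 0 <= y / (2 * pi) by rewrite ltW // divr_gt0.
set t := Num.trunc _; rewrite ler_pdivlMr // ltr_pdivrMr // => lo hi.
exists t; apply: cos_eq1_near cy _; rewrite ger0_norm.
  by rewrite ltrBlDr addrC [X in X + _]mulrC -[X in _ + X]mul1r -mulrDl natr1.
by rewrite subr_ge0 mulrC.
Qed.

(** The direction of an edge becomes the sign of the coefficient of [nu] in a cross product, which
    is easy to follow under rotations and under reversal of [nu]. *)
Lemma degenerate_cross nu p i : Bn p -> in_great_circle nu p.1 ->
  cross (row i p.1) (row (ordS i) p.1) = (sgb `[< forward nu p i >] * sin p.2) *: nu.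
Proof.
move=> Bp gp; have [sn dn] := gp; rewrite (degenerate_edge i Bp gp) crossDr !crossZr crossuu scaler0 add0r.
by rewrite cross_cross Bn_unit // [dot _ nu]dotC dn scale0r subr0 scale1r.
Qed.

Lemma normal_neq0 nu p : in_great_circle nu p.1 -> nu != 0.
Proof.
move=> [sn _]; apply: contra_eq_neq sn => ->.
by rewrite dotE !mxE !mul0r !addr0 eq_sym oner_eq0.
Qed.

Lemma forward_opp nu p i : Bn p -> in_great_circle nu p.1 ->
  `[< forward (- nu) p i >] = ~~ `[< forward nu p i >].
Proof.
move=> Bp gp; apply: sgb_inj; rewrite sgbN.
have := degenerate_cross i Bp (great_circle_opp gp); rewrite (degenerate_cross i Bp gp) scalerN -scaleNr => /eqP.
rewrite -subr_eq0 -scalerBl scaler_eq0 (negbTE (normal_neq0 gp)) orbF -mulNr -mulrBl mulf_eq0.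
by rewrite (gt_eqF (Bn_sin Bp)) orbF subr_eq0 => /eqP ->; rewrite opprK.
Qed.

Lemma nforward_opp nu p : Bn p -> in_great_circle nu p.1 -> nforward (- nu) p = nback nu p.
Proof. by move=> Bp gp; apply: eq_card => i; rewrite !inE forward_opp. Qed.

Lemma nback_opp nu p : Bn p -> in_great_circle nu p.1 -> nback (- nu) p = nforward nu p.
Proof. by move=> Bp gp; apply: eq_card => i; rewrite !inE forward_opp // negbK. Qed.

(** After the rotation taking the first vertex to [e1] and [nu] to [e3] all heights are zero, and
    [frame_polygon] applies. *)
Lemma standardize nu p : Bn p -> in_great_circle nu p.1 ->
  let eps i := `[< forward nu p i >] in
  orbit p = orbit (polygon eps (0 : 'rV[R]_n) p.2) /\ cos (sign_sum eps * p.2) = 1.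
Proof.
move=> Bp gp eps; have [sn dn] := gp.
have [A [SA Au An]] := frame_maps (Bn_unit i0 Bp) sn (dn i0).
pose q : config := (p.1 *m A^T, p.2).
have Bq : Bn q by exact: Bn_act.
have gq : in_great_circle e3 q.1 by rewrite -An; exact: great_circle_act.
have [_ ha _] := Bq.
have fq i : `[< forward e3 q i >] = eps i.
  by apply: asbool_equiv_eq; rewrite -An; exact: forward_act.
have e3E (u : 'rV[R]_3) : dot e3 u = u 0 o2 by rewrite dotE !mxE /= !mul0r !add0r mul1r.
have [||||E C] := @frame_polygon _ _ eps i0 erefl n2 q 0 Bq.
- exact: turn_dom0.
- by rewrite row_mul Au.
- by move=> i; rewrite -e3E gq.2 mxE.
- move=> i; rewrite (degenerate_cross i Bq gq) fq mxE -[e3 0 o2]e3E gq.1 mulr1 mulrA sgb_sqr mul1r.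
  exact: Bn_sin.
split; last by rewrite -(total_turn0 eps ha).
by rewrite -(orbit_eq (orbit_act p SA)) -/q E.
Qed.

Lemma polygon_forward eps a (t : nat) i : 0 < a < pi -> sign_sum eps * a = 2 * pi * t%:R ->
  `[< forward (e3 : 'rV[R]_3) (polygon eps 0 a) i >] = eps i.
Proof.
move=> ha st; have D := turn_dom0 (n := n) ha.
have T : total_turn eps (0 : 'rV[R]_n) a = 2 * pi * t%:R by rewrite total_turn0.
have B := polygon_Bn D T.
have := polygon_cross i D T; rewrite (degenerate_cross i B (polygon_great_circle _ _)) mxE.
rewrite !level_radius0 cosang0 -sin2cos2 sqrtr_sqr gtr0_norm; last exact: (Bn_sin B).
have -> : (e3 : 'rV[R]_3) 0 o2 = 1 by rewrite mxE.
rewrite !mulr1 mul1r => H; apply: sgb_inj; apply: mulIf H.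
by rewrite gt_eqF //; exact: (Bn_sin B).
Qed.

(** The inner products of the normals of edges 0 and [i] are invariant under rotations and determine
    [eps] up to a global sign, which the positivity of both sign sums fixes. *)
Lemma polygon_inj eps eps' a (t t' : nat) : 0 < a < pi ->
  sign_sum eps * a = 2 * pi * t%:R -> sign_sum eps' * a = 2 * pi * t'%:R ->
  0 < @sign_sum R n eps -> 0 < @sign_sum R n eps' ->
  orbit (polygon eps (0 : 'rV[R]_n) a) = orbit (polygon eps' 0 a) -> eps = eps'.
Proof.
move=> ha st st' ss ss' E; have D := turn_dom0 (n := n) ha.
have T : total_turn eps (0 : 'rV[R]_n) a = 2 * pi * t%:R by rewrite total_turn0.
have T' : total_turn eps' (0 : 'rV[R]_n) a = 2 * pi * t'%:R by rewrite total_turn0.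
have B := polygon_Bn D T; have B' := polygon_Bn D T'.
have X i := degenerate_cross i B (polygon_great_circle eps a).
have X' i := degenerate_cross i B' (polygon_great_circle eps' a).
have s0 := Bn_sin B; rewrite /= in s0.
have dd (u v : R) : dot (u *: e3) (v *: e3) = u * v :> R.
  by rewrite dotZl dotZr; have [-> _] := polygon_great_circle eps a; rewrite mulr1.
have K i : sgb (eps i0) * sgb (eps i) = sgb (eps' i0) * sgb (eps' i) :> R.
  have [A SA EAp] : orbit (polygon eps 0 a) (polygon eps' 0 a) by rewrite E; exact: orbit_refl.
  have EA : (polygon eps' 0 a).1 = (polygon eps 0 a).1 *m A^T by rewrite EAp.
  have := dd (sgb (eps' i0) * sin a) (sgb (eps' i) * sin a).
  rewrite -(polygon_forward i ha st') -(polygon_forward i0 ha st') -!X' EA !row_mul !cross_SO3 // dot_SO3 // !X dd.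
  rewrite !(polygon_forward _ ha st) !(polygon_forward _ ha st') /=.
  move: (sin a) s0 (sgb _) (sgb _) (sgb (eps' _)) (sgb (eps' _)) => s s0 e1' e2' e3' e4' H.
  have s2 : s ^+ 2 != 0 by rewrite expf_neq0 // gt_eqF.
  by apply: (mulIf s2); move: H; rewrite /=; lra.
have K' i : sgb (eps' i) = sgb (eps i0) * sgb (eps' i0) * sgb (eps i) :> R.
  rewrite mulrAC K -[LHS]mul1r -(@sgb_sqr R (eps' i0)).
  by move: (sgb _) (sgb _) => u v; ring.
have [e|e] : sgb (eps i0) * sgb (eps' i0) = 1 :> R \/ sgb (eps i0) * sgb (eps' i0) = -1 :> R.
- by case: (eps i0); case: (eps' i0); rewrite /sgb; [left|right|right|left]; ring.
- by apply/funext => i; apply: sgb_inj; rewrite K' e mul1r.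
- move: ss'; rewrite /sign_sum (eq_bigr (fun i => - sgb (eps i))) => [|i _]; last by rewrite K' e mulN1r.
  by rewrite sumrN -/(sign_sum eps) oppr_gt0 => /(lt_trans ss); rewrite ltxx.
Qed.

End Standardization.

Section Correspondence.
Context {R : realType} {n : nat}.
Notation config := (config R n).
Hypothesis n2 : (1 < n)%N.
Implicit Types (p q : config) (x : set config) (nu : 'rV[R]_3) (eps : 'I_n -> bool) (a : R) (al b t : nat).

Lemma standard_Bn eps al b t : standard_signs eps al b t -> Bn (polygon eps (0 : 'rV[R]_n) (standard_length al t)).
Proof.
move=> sg; have ha := standard_itv (R := R) sg.
by apply: (polygon_Bn (turn_dom0 ha)); rewrite total_turn0 //; exact: (standard_closing sg).
Qed.

(** The edge length is below [pi], whence [2 * t < al]. A negative winding number reduces to this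
    case by reversing [nu]. *)
Lemma oriented_standard nu p al (w : int) : Bn p -> in_great_circle nu p.1 -> 0 < w ->
  al%:Z = (nforward nu p)%:Z - (nback nu p)%:Z -> p.2 * al%:R = 2 * pi * w%:~R ->
  exists eps b t, [/\ w = t%:Z, standard_signs eps al b t & orbit p = standard_orbit eps al t].
Proof.
move=> Bp gp w0 alE E; pose eps i := `[< forward nu p i >]; pose t := `|w|%N.
have wt : w = t%:Z by rewrite gtz0_abs.
have t0 : (0 < t)%N by rewrite -ltz_nat -wt.
have [_ /andP[p0 ppi] _] := Bp.
rewrite wt -pmulrn in E.
have al0 : (0 < al)%N.
  rewrite lt0n; apply/eqP => a0; move: E; rewrite a0 mulr0 => /esym/eqP.
  by apply/negP; rewrite !mulf_neq0 ?(gt_eqF (pi_gt0 R)) ?pnatr_eq0 // -lt0n.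
have pE : p.2 = standard_length al t.
  by rewrite /standard_length -E mulfK // pnatr_eq0 -lt0n.
exists eps, (nback nu p), t; split=> //.
  split=> //; first by rewrite -/(nforward nu p); lia.
  have : p.2 * al%:R < pi * al%:R by rewrite ltr_pM2r // ltr0n.
  by rewrite E mulrAC mulrC -natrM ltr_pM2l ?pi_gt0 // ltr_nat; lia.
by rewrite /standard_orbit -pE; exact: (standardize n2 Bp gp).1.
Qed.

Lemma corresponds_standard x al be : Xn x -> corresponds x (al, be) ->
  exists eps b t, [/\ be = (2 * t)%N, standard_signs eps al b t & x = standard_orbit eps al t].
Proof.
move=> xX [p [nu [w [xp gp _ E C]]]]; have [Bp ->] := Xn_mem xX xp.
case: C => /= -[w0 [alE beE]].
  have [|eps [b [t [wt ? ?]]]] := oriented_standard Bp gp w0 alE; first by rewrite -E -alE.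
  by exists eps, b, t; split=> //; rewrite wt in beE; lia.
have w0' : 0 < - w by rewrite oppr_gt0.
have alE' : al%:Z = (nforward (- nu) p)%:Z - (nback (- nu) p)%:Z by rewrite nforward_opp ?nback_opp.
have [|eps [b [t [wt ? ?]]]] := oriented_standard Bp (great_circle_opp gp) w0' alE'.
  by rewrite mulrNz mulrN -E -mulrN -mulrNz opprB -alE.
by exists eps, b, t; split=> //; lia.
Qed.

Lemma standard_corresponds eps al b t : standard_signs eps al b t ->
  corresponds (standard_orbit (R := R) eps al t) (al, (2 * t)%N).
Proof.
move=> sg; have Bp := standard_Bn sg; have [cf cb t0 ta] := sg.
have ha := standard_itv (R := R) sg; have cl := standard_closing (R := R) sg.
set p := polygon eps 0 (standard_length al t) in Bp; have gp : in_great_circle e3 p.1 := polygon_great_circle eps _.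
have F i : `[< forward e3 p i >] = eps i := polygon_forward i ha cl.
have nf : nforward e3 p = (al + b)%N by rewrite -cf; apply: eq_card => i; rewrite !inE F.
have nb : nback e3 p = b by rewrite -cb; apply: eq_card => i; rewrite !inE F.
have pE : p.2 * al%:R = 2 * pi * t%:R by rewrite -cl (standard_sign_sum sg) mulrC.
have ln : (n.-1 < n)%N by rewrite prednK // ltnW.
have il (i : 'I_n) : i.+1 = n -> i = Ordinal ln by move=> e; apply: val_inj; exact: (congr1 predn e).
(* The correspondence wants the last edge negatively directed. If it is forward for [e3], the great
   circle is oriented by [- e3] instead, which exchanges [f] with [b] and turns [w] into [- t]. *)
have [el|el] := boolP (eps (Ordinal ln)); last first.
  exists p, e3, t%:Z; split=> //; first exact: orbit_refl.
  - by move=> i /il ->; apply/asboolPn; rewrite F.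
  - by rewrite nf nb PoszD addrK -pE.
  - by left; rewrite nf nb PoszD addrK; split=> //; rewrite PoszM.
exists p, (- e3), (- t%:Z); rewrite nforward_opp // nback_opp // nf nb; split=> //.
- exact: orbit_refl.
- exact: great_circle_opp.
- by move=> i /il ->; apply/asboolPn; rewrite forward_opp // F el.
- by rewrite PoszD opprD addrCA subrr addr0 !mulrNz !mulrN -pE.
- right; split; first by rewrite oppr_lt0.
  by rewrite /= PoszD addrK mulrN opprK PoszM.
Qed.

Lemma critical_Xn x : mu_critical x -> Xn x.
Proof. by move=> [[c ac dx] _]; case: ac => -[dX _] _ _ _ _; exact: dX. Qed.

Lemma standard_orbit_inj eps al b t eps' al' b' t' : standard_signs eps al b t -> standard_signs eps' al' b' t' ->
  standard_orbit (R := R) eps al t = standard_orbit eps' al' t' -> [/\ eps = eps', al = al' & t = t'].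
Proof.
move=> sg sg' E.
have aE : standard_length al t = standard_length al' t' :> R.
  by have := congr1 (@mu R n) E; rewrite !mu_orbit.
have cl := standard_closing (R := R) sg; have cl' := standard_closing (R := R) sg'.
have ss := standard_sign_sum_gt0 (R := R) sg; have ss' := standard_sign_sum_gt0 (R := R) sg'.
rewrite /standard_orbit -aE in E cl'.
have ee : eps = eps' by exact: (polygon_inj n2 (standard_itv sg) cl cl' ss ss' E).
have [cf cb _ _] := sg; have [cf' cb' _ _] := sg'; rewrite -ee in cf' cb' cl'.
split=> //; first by lia.
apply/eqP; rewrite -(eqr_nat R); apply/eqP; apply: (@mulfI _ (2 * pi)); last by rewrite -cl -cl'.
by rewrite mulf_neq0 // gt_eqF // pi_gt0.
Qed.

End Correspondence.

(** * Critical orbits in standard form and their number *)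

Section Counting.
Context {R : realType} {n : nat}.
Notation config := (config R n).
Hypotheses (on : odd n) (n3 : (2 < n)%N).
Implicit Types (x : set config) (eps : 'I_n -> bool) (B : {set 'I_n}) (al b t : nat).

Let n2 : (1 < n)%N. Proof. exact: ltnW. Qed.

Lemma standard_critical eps al b t : standard_signs eps al b t -> mu_critical (standard_orbit (R := R) eps al t).
Proof.
move=> sg; split.
  exact: (standard_chart (i0 := Ordinal (ltnW n2)) erefl n3 (standard_itv sg) (standard_sign_sum_gt0 sg) (standard_closing sg)).
by move=> c ac dx v; exact: (degenerate_derive v on ac dx (orbit_refl _) (polygon_great_circle eps _)).
Qed.

Lemma critical_standard x : mu_critical x -> exists eps al b t,
  standard_signs eps al b t /\ x = standard_orbit eps al t.
Proof.
move=> cx; have xX := critical_Xn cx; have [[c ac dx] dv] := cx.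
have [p Bp xE] := xX; have xp : x p by rewrite -xE; exact: orbit_refl.
have [nu0 g0] := critical_degenerate n2 ac dx (dv c ac dx) xp.
(* The sum of the signs is nonzero because [n] is odd, and reversing [nu] changes its sign; the
   standard form has it positive. *)
have [nu [gp ss]] : exists nu, in_great_circle nu p.1 /\ 0 < sign_sum (fun i => `[< forward nu p i >]) :> R.
  have := odd_sign_sum (R := R) (fun i => `[< forward nu0 p i >]) on; rewrite neq_lt => /orP[lt|gt]; last by exists nu0.
  exists (- nu0); split; first exact: great_circle_opp.
  rewrite /sign_sum (eq_bigr (fun i => - sgb `[< forward nu0 p i >])) => [|i _].
    by rewrite sumrN oppr_gt0.
  by rewrite forward_opp // sgbN.
have [oE cE] := standardize n2 Bp gp; have [_ /andP[p0 _] _] := Bp.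
have [t tE] := cos_eq1 (mulr_gt0 ss p0) cE.
have := sign_sumE (R := R) (fun i => `[< forward nu p i >]); rewrite -/(nforward nu p) -/(nback nu p) => sE.
have lt : (nback nu p < nforward nu p)%N by rewrite -(ltr_nat R) -subr_gt0 -sE.
have alE : (nforward nu p - nback nu p)%:Z = (nforward nu p)%:Z - (nback nu p)%:Z by lia.
have w0 : 0 < t%:Z.
  rewrite ltz_nat lt0n; apply/eqP => t0; have := mulr_gt0 ss p0.
  by rewrite tE t0 mulr0 ltxx.
have [|eps [b [t' [_ sg E]]]] := oriented_standard n2 Bp gp w0 alE.
  by rewrite natrB ?(ltnW lt) // -sE mulrC tE.
by exists eps, (nforward nu p - nback nu p)%N, b, t'; split=> //; rewrite -E.
Qed.

Lemma standard_signs_set al b t B : n = (al + b + b)%N -> #|B| = b -> (0 < t)%N -> (2 * t < al)%N ->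
  standard_signs (fun i => i \notin B) al b t.
Proof.
move=> nE cB t0 ta; split=> //; last by rewrite -cB; apply: eq_card => i; rewrite !inE negbK.
have := cardC (mem B); rewrite card_ord cB [X in _ = X]nE [X in _ = X]addnC => /addnI <-.
by apply: eq_card => i; rewrite !inE.
Qed.

Lemma card_corresponding al b t : n = (al + b + b)%N -> (0 < t)%N -> (2 * t < al)%N ->
  ([set x : set config | mu_critical x /\ corresponds x (al, (2 * t)%N)] #= `I_('C(n, b)))%card.
Proof.
move=> nE t0 ta; pose S := [set B : {set 'I_n} | #|B| == b]%SET.
pose F (B : {set 'I_n}) : set config := standard_orbit (fun i => i \notin B) al t.
have SP B : B \in S -> standard_signs (fun i => i \notin B) al b t.
  by rewrite inE => /eqP cB; exact: standard_signs_set.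
(* Numbers the sets of back-tracks to match the cardinality statement; for [j] below the binomial
   coefficient the default [set0] is not reached. *)
pose f (j : nat) := F (nth finset.set0 (enum S) j).
have sS : size (enum S) = 'C(n, b) by rewrite -cardE card_draws card_ord.
have mS j : (j < 'C(n, b))%N -> nth finset.set0 (enum S) j \in S.
  by move=> jn; rewrite -mem_enum mem_nth // sS.
have -> : [set x : set config | mu_critical x /\ corresponds x (al, (2 * t)%N)] = f @` `I_('C(n, b)).
  apply/seteqP; split=> [x [cx corr]|x [j jn <-]]; last first.
    have sg := SP _ (mS j jn).
    by split; [exact: (standard_critical sg)|exact: (standard_corresponds n2 sg)].
  have [eps [b' [t' [tt sg ->]]]] := corresponds_standard n2 (critical_Xn cx) corr.
  have bb : b' = b by have := standard_signs_n sg; lia.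
  have -> : t' = t by lia.
  have [_ cb _ _] := sg; pose B := [set i | ~~ eps i]%SET.
  have BS : B \in S.
    by rewrite inE -bb -cb; apply/eqP; apply: eq_card => i; rewrite !inE.
  exists (index B (enum S)).
    by rewrite /= -sS index_mem mem_enum.
  rewrite /f nth_index ?mem_enum // /F; congr standard_orbit.
  by apply/funext => i; rewrite inE negbK.
apply: inj_card_eq => i j; rewrite !inE => iS jS E.
have [e _ _] := standard_orbit_inj n2 (SP _ (mS i iS)) (SP _ (mS j jS)) E.
have : nth finset.set0 (enum S) i = nth finset.set0 (enum S) j.
  by apply/setP => k; have := congr1 (fun g => g k) e => /negb_inj.
by move/eqP; rewrite nth_uniq ?enum_uniq ?sS // => /eqP.
Qed.

End Counting.

Theorem theoremB (R : realType) (n m : nat) (hn : n = (2 * m + 1)%N)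
    (hn3 : (3 <= n)%N) :
  [/\ forall alpha beta s t : nat,
        Gamma n (alpha, beta) ->
        alpha = (2 * s + 1)%N -> beta = (2 * t)%N ->
        (forall x : set (config R n),
           mu_critical x -> corresponds x (alpha, beta) ->
           mu x = beta%:R / alpha%:R * pi /\
           has_index (@Xn_atlas R n) (@mu R n) x (m - s + 2 * t - 1)%N) /\
        ([set x : set (config R n) |
            mu_critical x /\ corresponds x (alpha, beta)]
           #= `I_('C(n, m - s)))%card,
      forall x : set (config R n),
        mu_critical x -> morse_nondegenerate (@Xn_atlas R n) (@mu R n) x
    & forall x : set (config R n),
        mu_critical x ->
        exists! ab : nat * nat, Gamma n ab /\ corresponds x ab].
Proof.
have on : odd n by rewrite hn; lia.
have n2 : (1 < n)%N := ltnW hn3.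
split.
- move=> al be s t [[/= _ be0] _ _ /andP[lt le]] als bet; have t0 : (0 < t)%N by lia.
  (* From [al <= n] follows [s <= m], so the truncated subtraction is exact; [m - s] is the number
     of back-tracks in the orientation of positive winding. *)
  have nE : n = (al + (m - s) + (m - s))%N by lia.
  rewrite bet in lt *; split; last exact: card_corresponding.
  move=> x cx corr; have [eps [b [t' [tt sg ->]]]] := corresponds_standard n2 (critical_Xn cx) corr.
  have bE : b = (m - s)%N by have := standard_signs_n sg; lia.
  have tE : t' = t by lia.
  rewrite {}tE in sg *; split.
    by rewrite mu_orbit /= /standard_length natrM; move: (pi : R) => y; ring.
  move=> c ac dx; have [_] := standard_morse sg on hn3 ac dx.
  by have -> : (m - s + 2 * t - 1 = b + (2 * t - 1))%N by lia.
- move=> x cx c ac; have [eps [al [b [t [sg ->]]]]] := critical_standard on hn3 cx.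
  by move=> dx; have [] := standard_morse sg on hn3 ac dx.
move=> x cx; have [eps [al [b [t [sg xE]]]]] := critical_standard on hn3 cx.
have [_ _ t0 ta] := sg; have nE := standard_signs_n sg.
exists (al, (2 * t)%N); split.
  split; last by rewrite xE; exact: (standard_corresponds n2 sg).
  by split=> /=; [lia|lia|lia|lia].
move=> [al' be'] [_ corr].
have [eps' [b' [t' [-> sg' xE']]]] := corresponds_standard n2 (critical_Xn cx) corr.
by have [_ -> ->] := standard_orbit_inj n2 sg sg' (etrans (esym xE) xE').
Qed.
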